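(* Let $T(k)$ be the well-bred vertex operator of $\mathcal{A}_R$ whose coefficients are given by the inductive expressions recalled in the context. Then $T$ obeys the FRT relations $$R_{12}(k_1,k_2)\,T_1(k_1)\,T_2(k_2)=T_2(k_2)\,T_1(k_1)\,R_{12}(k_1,k_2).$$ In other words, the entries $T^{ij}(k)$ generate an infinite dimensional quantum group (denoted $\mathcal{U}_R$) with evaluated $R$-matrix $R_{12}$.
   Context: **R-matrix and ZF algebra.** Fix $N\ge 1$, $V=\mathbb{C}^N$ with canonical basis $e_i$ (columns), dual row vectors $e_i^\dagger$, elementary matrices $E_{ij}$. $R(k_1,k_2)\in\mathrm{End}(V\otimes V)$ depends on spectral parameters (real numbers). For labels $a\ne b$ of copies of $V$, $R_{ab}:=R_{ab}(k_a,k_b)$ acts on copies $a$ (first factor) and $b$ (second factor). It is assumed that $R_{12}R_{13}R_{23}=R_{23}R_{13}R_{12}$ (Yang-Baxter) and $R_{12}R_{21}=\mathbb{I}$ (unitarity), with $R_{21}=R_{21}(k_2,k_1)$. $\mathcal{A}_R$ is the unital algebra generated by $a_i(k),a_i^\dagger(k)$ ($1\le i\le N$) with relations $a_1a_2=R_{21}a_2a_1$, $a_1^\dagger a_2^\dagger=a_2^\dagger a_1^\dagger R_{21}$, $a_1a_2^\dagger=a_2^\dagger R_{12}a_1+\delta_{12}$, where $a_b=\sum_i a_i(k_b)e_i$ and $a^\dagger_b=\sum_i a_i^\dagger(k_b)e_i^\dagger$ in copy $b$ of $V$, and $\delta_{12}=\delta(k_1-k_2)\sum_i e_i\otimes e_i^\dagger$.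 Infinite formal normally ordered series ($a^\dagger$'s left of $a$'s, integrated over spectral parameters) are allowed as elements of $\mathcal{A}_R$. **Well-bred.** A matrix $L(k)$ with entries in $\mathcal{A}_R$ is well-bred if $L_1a_2=R_{21}a_2L_1$ and $L_1a_2^\dagger=a_2^\dagger R_{12}L_1$ ($L_b=L(k_b)$ acting in copy $b$). **The well-bred vertex operator.** $T(k_\infty)=\sum T^{ij}(k_\infty)E_{ij}=\mathbb{I}+\sum_{n\ge1}\frac{(-1)^n}{n!}a^\dagger_{n\ldots1}T^{(n)}_{\infty1\ldots n}a_{1\ldots n}$, with $a_{1\ldots n}=a_1\cdots a_n$, $a^\dagger_{n\ldots1}=a_n^\dagger\cdots a_1^\dagger$, $T^{(n)}_{\infty1\ldots n}\in\mathrm{End}(V)^{\otimes(n+1)}$ numerical, depending on $k_\infty,k_1,\ldots,k_n$; indices of spaces $1,\ldots,n$ are summed and $k_1,\ldots,k_n$ integrated, space $\infty$ carries the matrix indices of $T$. The coefficients are defined by $T^{(1)}_{\infty0}=\mathbb{I}-R_{\infty0}$ and, for $n\ge1$, $$T^{(n+1)}_{\infty01\ldots n}=\tfrac1{n+1}\sum_{i=0}^n(\mathcal{R}^{01\ldots n}_{p_i})^{-1}T^{(n)}_{\infty p_i(1)\ldots p_i(n)}\mathcal{R}^{01\ldots n}_{p_i}-\tfrac1{(n+1)!}\sum_{\sigma\in\mathcal{S}_{n+1}}(\mathcal{R}^{01\ldots n}_{p_n\circ\sigma})^{-1}R_{\infty\sigma(0)}T^{(n)}_{\infty\sigma(1)\ldots\sigma(n)}\mathcal{R}^{01\ldots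 n}_{p_n\circ\sigma}.$$ Here $\mathcal{S}_{n+1}$ permutes $\{0,\ldots,n\}$; $p_j$ sends $(0,1,\ldots,n)$ to $(1,\ldots,j,0,j+1,\ldots,n)$, $p_0=\mathrm{id}$; $(\sigma\circ\mu)(i)=\mu(\sigma(i))$; and $\mathcal{R}^{01\ldots n}_\sigma$ is the product of $R$-matrices with $a_{\sigma(0)\ldots\sigma(n)}=\mathcal{R}^{01\ldots n}_\sigma a_{01\ldots n}$, obtained by passing from the word $01\ldots n$ to $\sigma(0)\ldots\sigma(n)$ by adjacent swaps, each swap $(a,b)\to(b,a)$ multiplying on the left by $R_{ab}$. This $T$ is well-bred. *)

(* Defs.v *)
From HB Require Import structures.
From mathcomp Require Import all_boot all_order all_algebra all_fingroup.
From mathcomp Require Import boolp reals.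
From mathcomp.real_closed Require Import complex.
Set Implicit Arguments.
Unset Strict Implicit.
Unset Printing Implicit Defensive.
Import Order.TTheory GRing.Theory Num.Theory.
Local Open Scope quotient_scope.
Local Open Scope ring_scope.

(* V = C^N.  The copies of V are labelled by a finite type L; the canonical
   basis of V^(tensor L) is indexed by the functions L -> 'I_N, and [tend N C L]
   is End(V^(tensor L)). *)

Definition tidx (N : nat) (L : finType) := {ffun L -> 'I_N}.

Definition tend (N : nat) (A : Type) (L : finType) := 'M[A]_#|tidx N L|.

Definition tent (N : nat) (A : Type) (L : finType) (X : tend N A L)
    (f g : tidx N L) : A := X (enum_rank f) (enum_rank g).

Definition tmx (N : nat) (A : Type) (L : finType)
    (E : tidx N L -> tidx N L -> A) : tend N A L :=
  \matrix_(x, y) E (enum_val x) (enum_val y).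

(* [embed iota X] is X with its leg l placed in copy [iota l], times the
   identity in the copies outside the image of iota (iota is injective
   wherever it is used).  E.g. X_{sigma(0) ... sigma(n)} is [embed sigma X]. *)
Definition embed (N : nat) (A : nmodType) (L L' : finType) (iota : L -> L')
    (X : tend N A L) : tend N A L' :=
  tmx (fun f g =>
    if [forall l, (l \notin codom iota) ==> (f l == g l)]
    then tent X [ffun l => f (iota l)] [ffun l => g (iota l)] else 0).

(* X_b for an N x N matrix X, acting in copy b *)
Definition leg (N : nat) (A : nmodType) (L : finType) (b : L) (X : 'M[A]_N) :
    tend N A L :=
  tmx (fun f g =>
    if [forall l, (l != b) ==> (f l == g l)] then X (f b) (g b) else 0).

Definition pair2 (T : Type) (a b : T) : 'I_2 -> T :=
  fun i => if i == ord0 then a else b.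

Definition Rmatrix (R : realType) (N : nat) := R -> R -> tend N R[i] 'I_2.

Section RMatrix.
Variables (R : realType) (N : nat) (Rm : Rmatrix R N).

(* entry of Rm k1 k2 in row e_a (x) e_b and column e_c (x) e_d *)
Definition Rent (k1 k2 : R) (a b c d : 'I_N) : R[i] :=
  tent (Rm k1 k2) (finfun (pair2 a b)) (finfun (pair2 c d)).

(* R_{ab}(k_a, k_b) *)
Definition Rleg (L : finType) (k : L -> R) (a b : L) : tend N R[i] L :=
  embed (pair2 a b) (Rm (k a) (k b)).

Definition Yang_Baxter : Prop :=
  forall k : 'I_3 -> R,
    let R_ := Rleg k in
    let c1 := @Ordinal 3 0 isT in
    let c2 := @Ordinal 3 1 isT in
    let c3 := @Ordinal 3 2 isT in
    R_ c1 c2 *m R_ c1 c3 *m R_ c2 c3 = R_ c2 c3 *m R_ c1 c3 *m R_ c1 c2.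

Definition unitarity : Prop :=
  forall k : 'I_2 -> R,
    let c1 := @Ordinal 2 0 isT in
    let c2 := @Ordinal 2 1 isT in
    Rleg k c1 c2 *m Rleg k c2 c1 = 1%:M.

(* [Rroute k s w] is the matrix M with a_w = M a_s, for w a rearrangement of
   the duplicate-free word s.  The adjacent swaps are performed in the
   following order: first the letter x = head w is brought to the front of s
   across the letters y_1 ... y_m preceding it (y_m first), which contributes
   R_{y_1 x} ... R_{y_m x}; then the remaining letters are sorted in the same
   way.  By the Yang-Baxter and unitarity relations any other sequence of
   adjacent swaps gives the same product. *)
Fixpoint Rroute (L : finType) (k : L -> R) (s w : seq L) : tend N R[i] L :=
  if w is x :: w' then
    Rroute k (rem x s) w' *m
      foldr (fun y M => Rleg k y x *m M) 1%:M (take (index x s) s)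
  else 1%:M.

(* T^(n+1) acts on the copies [None] (written infinity) and
   [Some 0, ..., Some n] of V; [k None] is k_infinity. *)

(* R^{01...n}_sigma, acting in the copies [Some 0, ..., Some n] *)
Definition Rperm (n : nat) (k : option 'I_n -> R) (s : 'S_n) :
    tend N R[i] (option 'I_n) :=
  Rroute k [seq Some i | i <- enum 'I_n] [seq Some (s i) | i <- enum 'I_n].

(* p_j maps (0, 1, ..., n) to (1, ..., j, 0, j+1, ..., n) *)
Definition pcyc (n : nat) (j : 'I_n.+1) : 'S_n.+1 := lift_perm j ord0 1%g.

(* the labels (infinity, s(1), ..., s(n)) *)
Definition tail_labels (n : nat) (s : 'S_n.+1) (o : option 'I_n) :
    option 'I_n.+1 := omap (fun j => s (lift ord0 j)) o.

(* [Tcoef n k] is T^(n+1), given by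
     T^(1) = 1 - R_{infinity 0},
     T^(n+1) = 1/(n+1) sum_i (R_{p_i})^-1 T^(n)_{infinity p_i(1)...p_i(n)} R_{p_i}
       - 1/(n+1)! sum_s (R_{p_n o s})^-1 R_{infinity s(0)}
                          T^(n)_{infinity s(1)...s(n)} R_{p_n o s}
   where (p_n o s)(i) = s(p_n(i)), which is the product p_n * s in MathComp. *)
Fixpoint Tcoef (n : nat) :
    (option 'I_n.+1 -> R) -> tend N R[i] (option 'I_n.+1) :=
  match n return (option 'I_n.+1 -> R) -> tend N R[i] (option 'I_n.+1) with
  | 0 => fun k => 1%:M - Rleg k None (Some ord0)
  | m.+1 => fun k =>
      let T_ (s : 'S_m.+2) :=
        embed (tail_labels s) (Tcoef (fun o => k (tail_labels s o))) in
      (m.+2%:R)^-1 *: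
        (\sum_(i < m.+2)
           invmx (Rperm k (pcyc i)) *m T_ (pcyc i) *m Rperm k (pcyc i))
      - ((m.+2)`!%:R)^-1 *:
        (\sum_(s : 'S_m.+2)
           invmx (Rperm k (pcyc ord_max * s)%g) *m
           (Rleg k None (Some (s ord0)) *m T_ s) *m
           Rperm k (pcyc ord_max * s)%g)
  end.

(* a_i(k) and a_i^dagger(k) are distributions in k, so the elements of the ZF
   algebra are built from formal integrals

     [int dk_1 ... dk_q  c(k_1, ..., k_q) w(k_1, ..., k_q)]

   with a numerical function c and a word w whose letters a_i(k_v),
   a_i^dagger(k_v) carry integration variables v : 'I_q.  In particular
   a_i(k) itself is the distribution f |-> int dk f(k) a_i(k). *)

Inductive letter (q : nat) :=
  | Ann of 'I_N & 'I_q   (* a_i(k_v) *)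
  | Cre of 'I_N & 'I_q.  (* a_i^dagger(k_v) *)

Definition is_ann (q : nat) (l : letter q) : bool :=
  if l is Ann _ _ then true else false.

Definition lvar (q : nat) (l : letter q) : 'I_q :=
  match l with Ann _ v => v | Cre _ v => v end.

Definition rename (q q' : nat) (m : 'I_q -> 'I_q') (l : letter q) :
    letter q' :=
  match l with Ann i v => Ann i (m v) | Cre i v => Cre i (m v) end.

(* The word makes sense: a variable occurs at most once in an a, at most once
   in an a^dagger, and a^dagger(k_v) is to the left of a(k_v) if both occur
   (a(k_v) a^dagger(k_v) would produce delta(0)).  Concatenation of words with
   disjoint variables and both sides of the exchange relations below preserve
   this property. *)
Definition admissible (q : nat) (w : seq (letter q)) : bool :=
  let s := [seq (is_ann l, lvar l) | l <- w] in
  uniq s && [forall v, ~~ subseq [:: (true, v); (false, v)] s].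

Inductive zexpr :=
  | ZZero
  | ZOne
  | ZAdd of zexpr & zexpr
  | ZOpp of zexpr
  | ZMul of zexpr & zexpr
  | ZScale of R[i] & zexpr
  | ZInt q of (('I_q -> R) -> R[i]) & seq (letter q).

(* Equality in the unital C-algebra generated by the formal integrals.
   The integrals are formal: besides linearity, products, and renaming of the
   dummy variables, no evaluation rule is imposed, so that no regularity of R
   or convergence of integrals has to be assumed. *)
Inductive zeq : zexpr -> zexpr -> Prop :=
  | zeq_refl x : zeq x x
  | zeq_sym x y : zeq x y -> zeq y x
  | zeq_trans y x z : zeq x y -> zeq y z -> zeq x z
  | zeq_add x x' y y' : zeq x x' -> zeq y y' -> zeq (ZAdd x y) (ZAdd x' y')
  | zeq_opp x x' : zeq x x' -> zeq (ZOpp x) (ZOpp x')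
  | zeq_mul x x' y y' : zeq x x' -> zeq y y' -> zeq (ZMul x y) (ZMul x' y')
  | zeq_scale a x x' : zeq x x' -> zeq (ZScale a x) (ZScale a x')
  | zeq_addA x y z : zeq (ZAdd x (ZAdd y z)) (ZAdd (ZAdd x y) z)
  | zeq_addC x y : zeq (ZAdd x y) (ZAdd y x)
  | zeq_add0 x : zeq (ZAdd ZZero x) x
  | zeq_addN x : zeq (ZAdd (ZOpp x) x) ZZero
  | zeq_mulA x y z : zeq (ZMul x (ZMul y z)) (ZMul (ZMul x y) z)
  | zeq_mul1l x : zeq (ZMul ZOne x) x
  | zeq_mul1r x : zeq (ZMul x ZOne) x
  | zeq_mulDl x y z : zeq (ZMul (ZAdd x y) z) (ZAdd (ZMul x z) (ZMul y z))
  | zeq_mulDr x y z : zeq (ZMul x (ZAdd y z)) (ZAdd (ZMul x y) (ZMul x z))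
  | zeq_scaleA a b x : zeq (ZScale a (ZScale b x)) (ZScale (a * b) x)
  | zeq_scale1 x : zeq (ZScale 1 x) x
  | zeq_scaleDr a x y :
      zeq (ZScale a (ZAdd x y)) (ZAdd (ZScale a x) (ZScale a y))
  | zeq_scaleDl a b x :
      zeq (ZScale (a + b) x) (ZAdd (ZScale a x) (ZScale b x))
  | zeq_scaleAl a x y : zeq (ZScale a (ZMul x y)) (ZMul (ZScale a x) y)
  | zeq_scaleAr a x y : zeq (ZScale a (ZMul x y)) (ZMul x (ZScale a y))
  | zeq_int_nil (z : R[i]) :
      zeq (@ZInt 0 (fun _ => z) [::]) (ZScale z ZOne)
  | zeq_int_add q (c c' : ('I_q -> R) -> R[i]) w :
      zeq (ZInt (fun k => c k + c' k) w) (ZAdd (ZInt c w) (ZInt c' w))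
  | zeq_int_scale q a (c : ('I_q -> R) -> R[i]) w :
      zeq (ZInt (fun k => a * c k) w) (ZScale a (ZInt c w))
  | zeq_int_mul q q' (c : ('I_q -> R) -> R[i]) (c' : ('I_q' -> R) -> R[i])
      w w' :
      zeq (ZMul (ZInt c w) (ZInt c' w'))
          (@ZInt (q + q')
             (fun k => c (k \o lshift q') * c' (k \o @rshift q q'))
             (map (rename (lshift q')) w ++ map (rename (@rshift q q')) w'))
  | zeq_int_perm q (s : 'S_q) (c : ('I_q -> R) -> R[i]) w :
      zeq (ZInt c w) (ZInt (fun k => c (k \o s)) (map (rename s) w))
  | zeq_int_inadmissible q (c : ('I_q -> R) -> R[i]) w :
      ~~ admissible w -> zeq (ZInt c w) ZZero
  (* a_1 a_2 = R_21 a_2 a_1 *)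
  | zeq_ann_ann q (c : ('I_q -> R) -> R[i]) u i v1 j v2 w :
      admissible (u ++ Ann i v1 :: Ann j v2 :: w) ->
      zeq (ZInt c (u ++ Ann i v1 :: Ann j v2 :: w))
          (\big[ZAdd/ZZero]_(i' < N) \big[ZAdd/ZZero]_(j' < N)
             ZInt (fun k => c k * Rent (k v2) (k v1) j i j' i')
                  (u ++ Ann j' v2 :: Ann i' v1 :: w))
  (* a^dagger_1 a^dagger_2 = a^dagger_2 a^dagger_1 R_21 *)
  | zeq_cre_cre q (c : ('I_q -> R) -> R[i]) u i v1 j v2 w :
      admissible (u ++ Cre i v1 :: Cre j v2 :: w) ->
      zeq (ZInt c (u ++ Cre i v1 :: Cre j v2 :: w))
          (\big[ZAdd/ZZero]_(i' < N) \big[ZAdd/ZZero]_(j' < N)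
             ZInt (fun k => c k * Rent (k v2) (k v1) j' i' j i)
                  (u ++ Cre j' v2 :: Cre i' v1 :: w))
  (* a_1 a^dagger_2 = a^dagger_2 R_12 a_1 + delta_12.  In the last term
     delta(k_1 - k_2) removes one integration: m identifies the variables v1
     and v2 and is otherwise a renaming of the remaining ones. *)
  | zeq_ann_cre q (c : ('I_q.+1 -> R) -> R[i]) u i v1 j v2 w
      (m : 'I_q.+1 -> 'I_q) :
      admissible (u ++ Ann i v1 :: Cre j v2 :: w) ->
      m v1 = m v2 -> {in predC1 v2 &, injective m} ->
      zeq (ZInt c (u ++ Ann i v1 :: Cre j v2 :: w))
          (ZAdd
             (\big[ZAdd/ZZero]_(i' < N) \big[ZAdd/ZZero]_(j' < N)
                ZInt (fun k => c k * Rent (k v1) (k v2) i j' i' j)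
                     (u ++ Cre j' v2 :: Ann i' v1 :: w))
             (if i == j then ZInt (fun k => c (k \o m)) (map (rename m) (u ++ w))
              else ZZero)).

Definition zeqb : rel {classic zexpr} := fun x y => `[< zeq x y >].

Lemma zeqb_refl : reflexive zeqb.
Proof. by move=> x; apply/asboolP; exact: zeq_refl. Qed.

Lemma zeqb_sym : symmetric zeqb.
Proof. by move=> x y; apply/asboolP/asboolP; exact: zeq_sym. Qed.

Lemma zeqb_trans : transitive zeqb.
Proof.
by move=> y x z /asboolP xy /asboolP yz; apply/asboolP; exact: zeq_trans yz.
Qed.

Canonical zeqb_equiv := EquivRel zeqb zeqb_refl zeqb_sym zeqb_trans.

Definition ZF : Type := {eq_quot zeqb}.
HB.instance Definition _ := Choice.on ZF.

Definition zclass (x : zexpr) : ZF := \pi_{eq_quot zeqb} (x : {classic zexpr}).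
Definition zrepr (x : ZF) : zexpr := generic_quotient.repr (x : {eq_quot zeqb}).

Lemma zreprK x : zclass (zrepr x) = x.
Proof. exact: reprK. Qed.

Lemma zclassP x y : zclass x = zclass y <-> zeq x y.
Proof.
by split=> [/(eqmodP zeqb_equiv)/asboolP//|xy]; apply/(eqmodP zeqb_equiv)/asboolP.
Qed.

Lemma zclassK x : zeq (zrepr (zclass x)) x.
Proof. by apply/zclassP; rewrite zreprK. Qed.

Definition zadd (x y : ZF) := zclass (ZAdd (zrepr x) (zrepr y)).
Definition zopp (x : ZF) := zclass (ZOpp (zrepr x)).
Definition zmul (x y : ZF) := zclass (ZMul (zrepr x) (zrepr y)).
Definition zscale (a : R[i]) (x : ZF) := zclass (ZScale a (zrepr x)).

Lemma zclassD x y : zclass (ZAdd x y) = zadd (zclass x) (zclass y).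
Proof. by apply/zclassP/zeq_sym; apply: zeq_add; exact: zclassK. Qed.

Lemma zclassN x : zclass (ZOpp x) = zopp (zclass x).
Proof. by apply/zclassP/zeq_sym; apply: zeq_opp; exact: zclassK. Qed.

Lemma zclassM x y : zclass (ZMul x y) = zmul (zclass x) (zclass y).
Proof. by apply/zclassP/zeq_sym; apply: zeq_mul; exact: zclassK. Qed.

Lemma zclassZ a x : zclass (ZScale a x) = zscale a (zclass x).
Proof. by apply/zclassP/zeq_sym; apply: zeq_scale; exact: zclassK. Qed.

Let zE := (zclassD, zclassN, zclassM, zclassZ).

Lemma zaddA : associative zadd.
Proof.
by move=> x y z; rewrite -[x]zreprK -[y]zreprK -[z]zreprK -!zE;
  apply/zclassP; exact: zeq_addA.
Qed.

Lemma zaddC : commutative zadd.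
Proof.
by move=> x y; rewrite -[x]zreprK -[y]zreprK -!zE;
  apply/zclassP; exact: zeq_addC.
Qed.

Lemma zadd0 : left_id (zclass ZZero) zadd.
Proof.
by move=> x; rewrite -[x]zreprK -!zE; apply/zclassP; exact: zeq_add0.
Qed.

Lemma zaddN : left_inverse (zclass ZZero) zopp zadd.
Proof.
by move=> x; rewrite -[x]zreprK -!zE; apply/zclassP; exact: zeq_addN.
Qed.

HB.instance Definition _ := GRing.isZmodule.Build ZF zaddA zaddC zadd0 zaddN.

Lemma zaddE (x y : ZF) : x + y = zadd x y.
Proof. by []. Qed.

Lemma zmulA : associative zmul.
Proof.
by move=> x y z; rewrite -[x]zreprK -[y]zreprK -[z]zreprK -!zE;
  apply/zclassP; exact: zeq_mulA.
Qed.

Lemma zmul1l : left_id (zclass ZOne) zmul.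
Proof.
by move=> x; rewrite -[x]zreprK -!zE; apply/zclassP; exact: zeq_mul1l.
Qed.

Lemma zmul1r : right_id (zclass ZOne) zmul.
Proof.
by move=> x; rewrite -[x]zreprK -!zE; apply/zclassP; exact: zeq_mul1r.
Qed.

Lemma zmulDl : left_distributive zmul +%R.
Proof.
by move=> x y z; rewrite !zaddE -[x]zreprK -[y]zreprK -[z]zreprK -!zE;
  apply/zclassP; exact: zeq_mulDl.
Qed.

Lemma zmulDr : right_distributive zmul +%R.
Proof.
by move=> x y z; rewrite !zaddE -[x]zreprK -[y]zreprK -[z]zreprK -!zE;
  apply/zclassP; exact: zeq_mulDr.
Qed.

HB.instance Definition _ :=
  GRing.Zmodule_isPzRing.Build ZF zmulA zmul1l zmul1r zmulDl zmulDr.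

Lemma zmulE (x y : ZF) : x * y = zmul x y.
Proof. by []. Qed.

(* 1 != 0: setting all integrals over at least one variable to 0 is compatible
   with the relations *)
Fixpoint zaug (x : zexpr) : R[i] :=
  match x with
  | ZZero => 0
  | ZOne => 1
  | ZAdd x y => zaug x + zaug y
  | ZOpp x => - zaug x
  | ZMul x y => zaug x * zaug y
  | ZScale a x => a * zaug x
  | ZInt q c _ => if q == 0%N then c (fun _ => 0) else 0
  end.

Lemma zaug_int q (v : 'I_q) (c : ('I_q -> R) -> R[i]) (w : seq (letter q)) : 
  zaug (ZInt c w) = 0.
Proof. by case: q v c w => [[]|]. Qed.

Lemma zaug_sum0 (I : finType) (F : I -> zexpr) :
  (forall i, zaug (F i) = 0) -> zaug (\big[ZAdd/ZZero]_i F i) = 0.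
Proof. by move=> F0; elim/big_ind: _ => //= x y -> ->; rewrite addr0. Qed.

Lemma zaugP x y : zeq x y -> zaug x = zaug y.
Proof.
elim=> //=.
- by move=> ? ? ? _ -> _ ->.
- by move=> ? ? ? ? _ -> _ ->.
- by move=> ? ? _ ->.
- by move=> ? ? ? ? _ -> _ ->.
- by move=> ? ? ? _ ->.
- by move=> *; rewrite addrA.
- by move=> *; rewrite addrC.
- by move=> *; rewrite add0r.
- by move=> *; rewrite addNr.
- by move=> *; rewrite mulrA.
- by move=> *; rewrite mul1r.
- by move=> *; rewrite mulr1.
- by move=> *; rewrite mulrDl.
- by move=> *; rewrite mulrDr.
- by move=> *; rewrite mulrA.
- by move=> *; rewrite mul1r.
- by move=> *; rewrite mulrDr.
- by move=> *; rewrite mulrDl.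
- by move=> *; rewrite mulrA.
- by move=> *; rewrite mulrCA.
- by move=> *; rewrite mulr1.
- by move=> q *; case: (q == 0%N); rewrite ?addr0.
- by move=> q *; case: (q == 0%N); rewrite ?mulr0.
- by move=> [|q] [|q'] c c' w w' /=; rewrite ?mulr0 ?mul0r.
- move=> [|q] c w // /negP[]; case: w => [|[_ []//|_ []//] ?].
  by apply/forallP => -[].
- move=> q c u i v1 j v2 w _; rewrite [LHS](zaug_int v1 c [::]).
  by rewrite zaug_sum0// => i'; rewrite zaug_sum0// => j'; rewrite (zaug_int v1).
- move=> q c u i v1 j v2 w _; rewrite [LHS](zaug_int v1 c [::]).
  by rewrite zaug_sum0// => i'; rewrite zaug_sum0// => j'; rewrite (zaug_int v1).
- move=> q c u i v1 j v2 w m _ _ _; rewrite zaug_sum0 ?add0r; last first.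
    by move=> i'; rewrite zaug_sum0// => j'; rewrite (zaug_int v1).
  by case: eqP => // _; rewrite (zaug_int (m v1)).
Qed.

Lemma zone_neq0 : (1 : ZF) != 0.
Proof. by apply/eqP => /zclassP/zaugP/eqP; rewrite /= oner_eq0. Qed.

HB.instance Definition _ := GRing.PzSemiRing_isNonZero.Build ZF zone_neq0.

Lemma zscaleA a b (x : ZF) : zscale a (zscale b x) = zscale (a * b) x.
Proof.
by rewrite -[x]zreprK -!zE; apply/zclassP; exact: zeq_scaleA.
Qed.

Lemma zscale1 : left_id 1 zscale.
Proof.
by move=> x; rewrite -[x]zreprK -!zE; apply/zclassP; exact: zeq_scale1.
Qed.

Lemma zscaleDr : right_distributive zscale +%R.
Proof.
by move=> a x y; rewrite !zaddE -[x]zreprK -[y]zreprK -!zE;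
  apply/zclassP; exact: zeq_scaleDr.
Qed.

Lemma zscaleDl (x : ZF) : {morph zscale^~ x : a b / a + b}.
Proof.
by move=> a b; rewrite /= !zaddE -[x]zreprK -!zE; apply/zclassP; exact: zeq_scaleDl.
Qed.

HB.instance Definition _ :=
  GRing.Zmodule_isLmodule.Build R[i] ZF zscaleA zscale1 zscaleDr zscaleDl.

Lemma zscaleE a (x : ZF) : a *: x = zscale a x.
Proof. by []. Qed.

Lemma zscaleAl a (x y : ZF) : a *: (x * y) = (a *: x) * y.
Proof.
by rewrite !zmulE !zscaleE -[x]zreprK -[y]zreprK -!zE;
  apply/zclassP; exact: zeq_scaleAl.
Qed.

HB.instance Definition _ := GRing.Lmodule_isLalgebra.Build R[i] ZF zscaleAl.

Lemma zscaleAr a (x y : ZF) : a *: (x * y) = x * (a *: y).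
Proof.
by rewrite !zmulE !zscaleE -[x]zreprK -[y]zreprK -!zE;
  apply/zclassP; exact: zeq_scaleAr.
Qed.

HB.instance Definition _ := GRing.Lalgebra_isAlgebra.Build R[i] ZF zscaleAr.

Definition zint (q : nat) (c : ('I_q -> R) -> R[i]) (w : seq (letter q)) : ZF :=
  zclass (ZInt c w).

(* [ann_tail p] is the left ideal spanned by the words ending with at least p
   annihilators.  A series of normally ordered terms a^dagger^n ... a^n
   converges in the topology defined by these left ideals, and the product of
   such series is the limit of the products of their partial sums.  Two
   convergent sequences have the same limit in the completed algebra when their
   difference is eventually in every [ann_tail p].  (The adic topology of the
   word length would be useless: by a a^dagger = a^dagger R a + delta, the
   closure of 0 would contain every vacuum expectation value.) *)

Definition ends_with_ann (q p : nat) (w : seq (letter q)) : bool :=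
  (p <= size w)%N && all (@is_ann q) (drop (size w - p) w).

Inductive ann_tail (p : nat) : ZF -> Prop :=
  | ann_tail0 : ann_tail p 0
  | ann_tailD q (c : ('I_q -> R) -> R[i]) w x :
      ends_with_ann p w -> ann_tail p x -> ann_tail p (zint c w + x).

Definition same_limit (s t : nat -> ZF) : Prop :=
  forall p, exists M0, forall M, (M0 <= M)%N -> ann_tail p (s M - t M).

(* a^dagger_{f(n)}(k_n) ... a^dagger_{f(1)}(k_1) a_{g(1)}(k_1) ... a_{g(n)}(k_n) *)
Definition normal_word (n : nat) (f g : 'I_n -> 'I_N) : seq (letter n) :=
  rev [seq Cre (f l) l | l <- enum 'I_n] ++ [seq Ann (g l) l | l <- enum 'I_n].

(* a^dagger_{n...1} X_{infinity 1...n} a_{1...n}, integrated over k_1 ... k_n *)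
Definition normal_term (n : nat)
    (X : (option 'I_n -> R) -> tend N R[i] (option 'I_n)) (kinf : R) : 'M[ZF]_N :=
  \matrix_(i, j) \sum_(f : tidx N 'I_n) \sum_(g : tidx N 'I_n)
    zint (fun k => tent (X (oapp k kinf)) [ffun o => oapp f i o]
                                          [ffun o => oapp g j o])
         (normal_word f g).

(* partial sum, over 1 <= n <= M, of the series defining T(kinf) *)
Definition Tpart (M : nat) (kinf : R) : 'M[ZF]_N :=
  \matrix_(i, j) ((1%:M : 'M[ZF]_N) i j +
    \sum_(n < M) ((-1) ^+ n.+1 / (n.+1)`!%:R) *:
      normal_term (@Tcoef n) kinf i j).

Definition same_limit_mx (m n : nat) (X Y : nat -> 'M[ZF]_(m, n)) : Prop :=
  forall i j, same_limit (fun M => X M i j) (fun M => Y M i j).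

(* R_12 T_1(k1) T_2(k2) = T_2(k2) T_1(k1) R_12, where T M k are the
   partial sums of T(k) *)
Definition FRT (T : nat -> R -> 'M[ZF]_N) : Prop :=
  forall k1 k2 : R,
    let c1 := @Ordinal 2 0 isT in
    let c2 := @Ordinal 2 1 isT in
    let R12 := map_mx (in_alg ZF) (Rm k1 k2) in
    same_limit_mx (fun M => R12 *m leg c1 (T M k1) *m leg c2 (T M k2))
                  (fun M => leg c2 (T M k2) *m leg c1 (T M k1) *m R12).

End RMatrix.

(* Main.v *)
Require Import Defs.
From HB Require Import structures.
From mathcomp Require Import all_boot all_order all_algebra all_fingroup.
From mathcomp Require Import boolp reals.
From mathcomp.real_closed Require Import complex.
Set Implicit Arguments.
Unset Strict Implicit.
Unset Printing Implicit Defensive.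
Import Order.TTheory GRing.Theory Num.Theory.
Local Open Scope ring_scope.

(* Let N = int a^dagger(k) a(k) be the number operator.  Up to reordering by
   R-matrices, which normally ordered words absorb, the recursion for the
   coefficients says that
     T N = int a^dagger_0 R_{infinity 0} T a_0.                             (1)
   Modulo terms with more than d annihilators on the right, N multiplies by d
   a series whose terms all have at least d annihilators on the right.  Hence a
   series Y with Y (N + s) = Psi(Y), where Psi raises the number of
   annihilators, vanishes as soon as its terms with d + s = 0 do.  By (1) and
   the Yang-Baxter equation this applies to
   Y = T a^dagger_x - a^dagger_x R_{infinity x} T with s = 1, and then to
   Y = R_12 T_1 T_2 - T_2 T_1 R_12 with s = 0, whose vacuum term is
   R_12 - R_12 = 0.  For the partial sums of T all these identities hold up to
   terms with about M annihilators.

   Since Y and Psi(Y) carry integration variables shared with the letters around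
   them, every identity is proved inside an arbitrary context: a coefficient
   function C and words u, v, standing for int C u Y v. *)

(** * Words and formal integrals over finite sets of variables *)

Section Words.
Variable N : nat.

(** The number operator is used because it crosses letters as in the free boson case: the R-matrix
    met at its creator is met again at its annihilator, so only the contraction survives, and it is
    a scalar. Division by the nonzero integer d + s then turns an equation for Y into an induction
    on the number of annihilators.

    The value s = 1 has two sources: N loses one in crossing a^dagger_x, and the a_0 of (1) can be
    contracted with a^dagger_x. Together they give exactly -Y, so d + s > 0 already for d = 0 and no
    initial term has to be known. In the FRT combination s = 0, and N does not see the vacuum term.

    The relation with a^dagger_x is needed first because (1), applied to the right factor of T_1
    T_2, leaves a^dagger_0 between the factors, and it must cross the left one.

    The left ideals [ann_tail] are not stable under multiplication by creators on the right, so a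
    bound for Y alone says little about Y inside a word. All estimates therefore use [hgt d v]: what
    remains of d annihilators once the letters of v have acted. The operation Psi adds an
    annihilator in front of v, and this is the gain that drives both inductions. *)

Definition vletter (V : Type) := (bool * ('I_N * V))%type.

Definition van (V : Type) (i : 'I_N) (v : V) : vletter V := (true, (i, v)).
Definition vcr (V : Type) (i : 'I_N) (v : V) : vletter V := (false, (i, v)).
Definition vren (V W : Type) (h : V -> W) (l : vletter V) : vletter W :=
  (l.1, (l.2.1, h l.2.2)).

Definition to_letter (V : Type) (q : nat) (h : V -> 'I_q) (l : vletter V) :
    letter N q :=
  if l.1 then Ann l.2.1 (h l.2.2) else Cre l.2.1 (h l.2.2).

Definition kind (V : Type) (l : vletter V) : bool * V := (l.1, l.2.2).

Definition kinds (V : eqType) (v : V) (w : seq (vletter V)) : bitseq :=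
  [seq l.1 | l <- w & l.2.2 == v].

Definition okkinds (s : bitseq) : bool :=
  s \in [:: [::]; [:: true]; [:: false]; [:: false; true]].

(* [admissible], read off variable by variable: the letters carrying [v] form
   one of the patterns -, a, a^dagger, a^dagger a *)
Definition vadm (V : finType) (w : seq (vletter V)) : bool :=
  [forall v, okkinds (kinds v w)].

Lemma kinds_cat (V : eqType) (v : V) u w :
  kinds v (u ++ w) = kinds v u ++ kinds v w.
Proof. by rewrite /kinds filter_cat map_cat. Qed.

Lemma kinds_cons (V : eqType) (v : V) l w :
  kinds v (l :: w) = (if l.2.2 == v then [:: l.1] else [::]) ++ kinds v w.
Proof. by rewrite /kinds /=; case: ifP. Qed.

Lemma kinds_ren_inj (V W : eqType) (h : V -> W) v w :
  injective h -> kinds (h v) (map (vren h) w) = kinds v w.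
Proof.
move=> hI; rewrite /kinds filter_map -map_comp; congr map.
by apply: eq_filter => l /=; rewrite inj_eq.
Qed.

Lemma kinds_ren_notin (V W : eqType) (h : V -> W) z w :
  (forall v, h v != z) -> kinds z (map (vren h) w) = [::].
Proof.
move=> hz; rewrite /kinds filter_map.
by rewrite (eq_filter (a2 := pred0)) ?filter_pred0 // => l /=; apply/negbTE.
Qed.

(** A duplicate-free list of booleans has at most two elements, so three letters decide every
    case. *)
Lemma okkindsE (s : bitseq) :
  okkinds s = uniq s && ~~ subseq [:: true; false] s.
Proof.
case: s => [|a [|b [|c s]]] //; try by case: a => //; case: b.
by case: a; case: b; case: c => //=; rewrite ?andbF ?inE ?orbT.
Qed.

Lemma subseq_kinds (V : eqType) (v : V) (w : seq (vletter V)) a b :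
  subseq [:: (a, v); (b, v)] (map (@kind V) w) = subseq [:: a; b] (kinds v w).
Proof.
have sub1 c (u : seq (vletter V)) :
    subseq [:: (c, v)] (map (@kind V) u) = subseq [:: c] (kinds v u).
  rewrite !sub1seq; apply/mapP/mapP => [[l lu]|[l]].
    by case: l lu => d [i x] lu [-> ->]; exists (d, (i, x)); rewrite ?mem_filter ?eqxx.
  by rewrite mem_filter => /andP[/eqP <- lu ->]; exists l.
elim: w => [|[d [i x]] w IHw] //=; rewrite /kinds /=.
rewrite /kind /= [(a, v) == _]xpair_eqE eq_sym [v == x]eq_sym.
case: (eqVneq x v) => [->|] /=; rewrite ?andbT ?andbF //.
by rewrite [d == a]eq_sym; case: eqP => // _; exact: sub1.
Qed.

Lemma uniq_kinds (V : finType) (w : seq (vletter V)) :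
  uniq (map (@kind V) w) = [forall v, uniq (kinds v w)].
Proof.
elim: w => [|[d [i x]] w IHw] /=; first by symmetry; apply/forallP.
rewrite IHw; have ->: ((d, x) \in map (@kind V) w) = (d \in kinds x w).
  apply/mapP/mapP => [[[e [j y]] lw [-> ->]]|[[e [j y]]]].
    by exists (e, (j, y)); rewrite ?mem_filter ?eqxx.
  by rewrite mem_filter => /andP[/= /eqP -> lw ->]; exists (e, (j, x)).
apply/andP/forallP => [[dx /forallP H] v|H].
  rewrite kinds_cons /=; case: eqVneq => [<-|_] //=; rewrite ?dx; exact: H.
split; first by have := H x; rewrite kinds_cons /= eqxx => /andP[].
by apply/forallP => v; have := H v; rewrite kinds_cons /=; case: eqP => //= _ /andP[].
Qed.

(** Both conditions in [admissible] compare only letters that carry the same variable, so they split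
    over the variables and are insensitive to a bijective renaming. *)
Lemma admissible_to_letter (V : finType) q (h : V -> 'I_q) w :
  bijective h -> admissible (map (to_letter h) w) = vadm w.
Proof.
case=> h' hK h'K; rewrite /admissible -map_comp.
pose g (bv : bool * V) := (bv.1, h bv.2).
have gI : injective g by move=> [a x] [b y] [-> /(can_inj hK) ->].
have -> : [seq (is_ann (to_letter h l), lvar (to_letter h l)) | l <- w] =
    map g (map (@kind V) w).
  by rewrite -map_comp; apply: eq_map => -[[] [i x]].
rewrite map_inj_uniq // uniq_kinds.
apply/andP/forallP => [[/forallP U /forallP S] v|H].
  rewrite okkindsE U -subseq_kinds /=; apply: contra (S (h v)) => sub.
  by have := map_subseq g sub.
split; apply/forallP => v.
  by have := H v; rewrite okkindsE => /andP[].
have := H (h' v); rewrite okkindsE => /andP[_]; rewrite -subseq_kinds.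
apply: contra; rewrite -{1 2}(h'K v) => /(map_subseq (fun p => (p.1, h' p.2))).
rewrite /= !hK -[X in subseq _ X]map_comp.
by rewrite (eq_map (g := id)) ?map_id // => -[a x] /=; rewrite hK.
Qed.

End Words.

Section Zint.
Variables (R : realType) (N : nat) (Rm : Rmatrix R N).
Local Notation ZF := (ZF Rm).
Local Notation vl := (vletter N).

Lemma zintD q (c c' : ('I_q -> R) -> R[i]) w :
  zint Rm (fun k => c k + c' k) w = zint Rm c w + zint Rm c' w.
Proof. by rewrite zaddE -zclassD; apply/zclassP; exact: zeq_int_add. Qed.

Lemma zintZ q a (c : ('I_q -> R) -> R[i]) w :
  zint Rm (fun k => a * c k) w = a *: zint Rm c w.
Proof. by rewrite zscaleE -zclassZ; apply/zclassP; exact: zeq_int_scale. Qed.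

Lemma zclass_sum (I : finType) (F : I -> zexpr R N) :
  zclass Rm (\big[@ZAdd R N/@ZZero R N]_i F i) = \sum_i zclass Rm (F i).
Proof.
apply: (big_ind2 (fun x y => zclass Rm x = y)) => // x x' y y' <- <-.
by rewrite zaddE -zclassD.
Qed.

(* Labelling the variables by any finite type, instead of ['I_q], avoids
   renumbering when contexts are enlarged. *)
Definition zV (V : finType) (C : (V -> R) -> R[i]) (w : seq (vl V)) : ZF :=
  @zint R N Rm #|V| (fun k => C (k \o enum_rank)) (map (to_letter enum_rank) w).

Lemma zV_zint (V : finType) q (h : V -> 'I_q) C w :
  bijective h -> zV C w = @zint R N Rm q (fun k => C (k \o h)) (map (to_letter h) w).
Proof.
move=> hB; have qE : #|V| = q by rewrite (bij_eq_card hB) card_ord.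
(* [zeq_int_perm] renames within a single ordinal; once the two cardinalities are unified, the
   bijection becomes a permutation. *)
subst q; have [h' hK h'K] := hB.
have sI : injective (fun i : 'I_#|V| => h (enum_val i)).
  by move=> x y /(can_inj hK)/enum_val_inj.
rewrite /zV /zint; apply/zclassP.
apply: zeq_trans (zeq_int_perm Rm (perm sI) _ _) _.
have -> : (fun k : 'I_#|V| -> R => C ((k \o perm sI) \o enum_rank)) =
    (fun k => C (k \o h)).
  apply: funext => k; congr C; apply: funext => v /=.
  by rewrite permE /= enum_rankK.
rewrite -map_comp; set w1 := map _ _; set w2 := map _ _.
suff -> : w1 = w2 by exact: zeq_refl.
by apply: eq_map => -[[] [i x]] /=; rewrite permE /= enum_rankK.
Qed.

Lemma zV_reindex (V W : finType) (h : V -> W) C w :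
  bijective h -> zV C w = zV (fun k => C (k \o h)) (map (vren h) w).
Proof.
move=> hB; rewrite (@zV_zint V #|W| (enum_rank \o h)); last first.
  by apply: bij_comp hB; exact: enum_rank_bij.
by rewrite /zV -map_comp.
Qed.

Lemma eq_zV (V : finType) (C C' : (V -> R) -> R[i]) w w' :
  C =1 C' -> w = w' -> zV C w = zV C' w'.
Proof. by move=> /funext -> ->. Qed.

Lemma zVD (V : finType) (C C' : (V -> R) -> R[i]) w :
  zV (fun k => C k + C' k) w = zV C w + zV C' w.
Proof. exact: zintD. Qed.

Lemma zVZ (V : finType) a (C : (V -> R) -> R[i]) w :
  zV (fun k => a * C k) w = a *: zV C w.
Proof. exact: zintZ. Qed.

Lemma zV0 (V : finType) (w : seq (vl V)) : zV (fun=> 0) w = 0.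
Proof.
by rewrite (eq_zV (C' := fun k => 0 * 0) _ (erefl w)) ?zVZ ?scale0r // => k; rewrite mul0r.
Qed.

Lemma zV_sum (V : finType) (I : Type) (r : seq I) (P : pred I)
    (C : I -> (V -> R) -> R[i]) w :
  zV (fun k => \sum_(i <- r | P i) C i k) w = \sum_(i <- r | P i) zV (C i) w.
Proof.
elim: r => [|x r IHr].
  by rewrite big_nil -(zV0 w); apply: eq_zV => // k; rewrite big_nil.
rewrite big_cons -IHr; case: ifP => Px.
  by rewrite -zVD; apply: eq_zV => // k; rewrite big_cons Px.
by apply: eq_zV => // k; rewrite big_cons Px.
Qed.

Lemma zV_mul (V W : finType) (C : (V -> R) -> R[i]) (C' : (W -> R) -> R[i]) w w' :
  zV C w * zV C' w' =
  zV (fun k : V + W -> R => C (k \o inl) * C' (k \o inr))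
    (map (vren inl) w ++ map (vren inr) w').
Proof.
pose h (x : V + W) : 'I_(#|V| + #|W|) :=
  match x with inl v => lshift _ (enum_rank v) | inr v => rshift _ (enum_rank v) end.
pose g (x : 'I_(#|V| + #|W|)) : V + W :=
  match split x with inl v => inl (enum_val v) | inr v => inr (enum_val v) end.
have hB : bijective h.
  exists g; first by move=> [] v; rewrite /g /h ?(unsplitK (inl _)) ?(unsplitK (inr _)) enum_rankK.
  move=> x; rewrite /g /h -[RHS]splitK; case: (split x) => v /=; by rewrite enum_valK.
rewrite [RHS](zV_zint _ _ hB) zmulE /zV /zint -zclassM; apply/zclassP.
apply: zeq_trans (zeq_int_mul _ _ _ _ _) _.
suff -> : map (rename (lshift #|W|)) [seq to_letter enum_rank i | i <- w] ++
    map (rename (@rshift #|V| #|W|)) [seq to_letter enum_rank i | i <- w'] =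
    [seq to_letter h i | i <- [seq vren inl i | i <- w] ++ [seq vren inr i | i <- w']].
  exact: zeq_refl.
rewrite map_cat -!map_comp; congr (_ ++ _); by apply: eq_map => -[[] [i x]].
Qed.

Lemma zV_inadm (V : finType) (C : (V -> R) -> R[i]) w : ~~ vadm w -> zV C w = 0.
Proof.
move=> aw; apply/zclassP; apply: zeq_int_inadmissible.
rewrite admissible_to_letter //; exact: enum_rank_bij.
Qed.

Lemma vadm_swap (V : finType) b (u w : seq (vl V)) i x j y i' j' :
  vadm (u ++ (b, (i, x)) :: (b, (j, y)) :: w) =
  vadm (u ++ (b, (j', y)) :: (b, (i', x)) :: w).
Proof.
apply: eq_forallb => v; rewrite !kinds_cat !kinds_cons /=.
by case: (x == v); case: (y == v).
Qed.

(** No admissibility is assumed: exchanging two letters of the same kind preserves the pattern at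
    every variable, so for an inadmissible word both sides vanish. *)
Lemma zV_ann_ann (V : finType) (C : (V -> R) -> R[i]) u w i x j y :
  zV C (u ++ van i x :: van j y :: w) =
  \sum_i' \sum_j' zV (fun k => C k * Rent Rm (k y) (k x) j i j' i')
    (u ++ van j' y :: van i' x :: w).
Proof.
have [au|au] := boolP (vadm (u ++ van i x :: van j y :: w)); last first.
  rewrite zV_inadm // big1 // => i' _; rewrite big1 // => j' _.
  by rewrite zV_inadm // -(vadm_swap true u w i x j y i' j').
rewrite -(admissible_to_letter _ (@enum_rank_bij V)) map_cat /= in au.
have/zclassP := zeq_ann_ann Rm (fun k => C (k \o enum_rank)) au.
rewrite /zV /zint map_cat /= => ->.
rewrite zclass_sum; apply: eq_bigr => i' _; rewrite zclass_sum.
by apply: eq_bigr => j' _; rewrite map_cat.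
Qed.

Lemma zV_cre_cre (V : finType) (C : (V -> R) -> R[i]) u w i x j y :
  zV C (u ++ vcr i x :: vcr j y :: w) =
  \sum_i' \sum_j' zV (fun k => C k * Rent Rm (k y) (k x) j' i' j i)
    (u ++ vcr j' y :: vcr i' x :: w).
Proof.
have [au|au] := boolP (vadm (u ++ vcr i x :: vcr j y :: w)); last first.
  rewrite zV_inadm // big1 // => i' _; rewrite big1 // => j' _.
  by rewrite zV_inadm // -(vadm_swap false u w i x j y i' j').
rewrite -(admissible_to_letter _ (@enum_rank_bij V)) map_cat /= in au.
have/zclassP := zeq_cre_cre Rm (fun k => C (k \o enum_rank)) au.
rewrite /zV /zint map_cat /= => ->.
rewrite zclass_sum; apply: eq_bigr => i' _; rewrite zclass_sum.
by apply: eq_bigr => j' _; rewrite map_cat.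
Qed.

(** For an inadmissible word the right-hand side must vanish as well. For the exchanged words this
    uses [x != y], since at a common variable the exchange would turn a a^dagger into the admissible
    a^dagger a; for the contracted word it is the last hypothesis. *)
Lemma zV_ann_cre (V W : finType) (m : V -> W) (C : (V -> R) -> R[i]) u w i x j y :
  #|V| = #|W|.+1 -> m x = m y -> {in predC1 y &, injective m} ->
  x != y ->
  (vadm (map (vren m) (u ++ w)) -> vadm (u ++ van i x :: vcr j y :: w)) ->
  zV C (u ++ van i x :: vcr j y :: w) =
  (\sum_i' \sum_j' zV (fun k => C k * Rent Rm (k x) (k y) i j' i' j)
    (u ++ vcr j' y :: van i' x :: w)) +
  (if i == j then zV (fun k => C (k \o m)) (map (vren m) (u ++ w)) else 0).
Proof.
move=> cV mxy mI nxy aW.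
have [au|au] := boolP (vadm (u ++ van i x :: vcr j y :: w)); last first.
  rewrite !zV_inadm //; last by apply: contra au.
  rewrite if_same addr0 big1 // => i' _; rewrite big1 // => j' _.
  rewrite zV_inadm //; apply: contra au => /forallP au.
  apply/forallP => v; move: (au v); rewrite !kinds_cat !kinds_cons /=.
  by case: (eqVneq y v) => [<-|] //; rewrite (negbTE nxy).
pose g : V -> 'I_#|W|.+1 := cast_ord cV \o enum_rank.
have gB : bijective g.
  exists (enum_val \o cast_ord (esym cV)) => z; rewrite /g /=.
    by rewrite cast_ordK enum_rankK.
  by rewrite enum_valK cast_ordKV.
have [g' gK g'K] := gB.
rewrite -(admissible_to_letter _ gB) map_cat /= in au.
pose mm : 'I_#|W|.+1 -> 'I_#|W| := enum_rank \o m \o g'.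
have mm1 : mm (g x) = mm (g y) by rewrite /mm /= !gK mxy.
have mm2 : {in predC1 (g y) &, injective mm}.
  move=> a b; rewrite !inE -(g'K a) -(g'K b) !(can_eq gK) /mm /= !gK => ax bx.
  by move/enum_rank_inj/mI => ->.
have/zclassP := zeq_ann_cre Rm (fun k => C (k \o g)) au mm1 mm2.
rewrite [zV C (u ++ van i x :: _)](zV_zint _ _ gB) /zint.
rewrite [map (to_letter g) _]map_cat /= => ->.
rewrite zclassD -zaddE zclass_sum; congr (_ + _).
  apply: eq_bigr => i' _; rewrite zclass_sum.
  apply: eq_bigr => j' _; rewrite (zV_zint _ _ gB) /zint map_cat //=.
case: eqP => // _; rewrite /zV /zint; apply/zclassP.
suff -> : (fun k => C ((k \o mm) \o g)) = (fun k : 'I_#|W| -> R => C ((k \o enum_rank) \o m)).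
  suff -> : [seq rename mm i0 | i0 <- [seq to_letter g i | i <- u] ++ [seq to_letter g i | i <- w]] =
    [seq to_letter enum_rank i | i <- [seq vren m i | i <- u ++ w]].
    exact: zeq_refl.
  rewrite -map_cat -!map_comp; apply: eq_map => -[[] [a z]] /=; by rewrite /mm /= gK.
by apply: funext => k; congr C; apply: funext => v; rewrite /mm /= gK.
Qed.

End Zint.

(** * Counting annihilators; the number operator *)

Section Tails.
Variables (R : realType) (N : nat) (Rm : Rmatrix R N).
Local Notation ZF := (ZF Rm).
Local Notation vl := (vletter N).
Local Notation zV := (@zV R N Rm _).

Lemma ann_tail_zint p q (c : ('I_q -> R) -> R[i]) w :
  ends_with_ann p w -> ann_tail p (zint Rm c w).
Proof. by move=> pw; rewrite -[zint _ _ _]addr0; apply: ann_tailD => //; exact: ann_tail0. Qed.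

Lemma ann_tail_add p (x y : ZF) : ann_tail p x -> ann_tail p y -> ann_tail p (x + y).
Proof.
by elim=> [|q c w z pw _ IHz] ty; rewrite ?add0r // -addrA; apply: ann_tailD => //; exact: IHz.
Qed.

Lemma ann_tail_scale p a (x : ZF) : ann_tail p x -> ann_tail p (a *: x).
Proof.
elim=> [|q c w z pw _ IHz]; first by rewrite scaler0; exact: ann_tail0.
by rewrite scalerDr -zintZ; exact: ann_tailD.
Qed.

Lemma ann_tail_opp p (x : ZF) : ann_tail p x -> ann_tail p (- x).
Proof. by rewrite -scaleN1r; exact: ann_tail_scale. Qed.

Lemma ann_tail_sum p (I : Type) (r : seq I) (P : pred I) (F : I -> ZF) :
  (forall i, P i -> ann_tail p (F i)) -> ann_tail p (\sum_(i <- r | P i) F i).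
Proof.
move=> tF; apply: big_ind => //; first exact: ann_tail0.
exact: ann_tail_add.
Qed.

(** Bounds over lists are carried by [all]: the monomials summed later contain functions and have no
    [eqType] structure, hence no membership predicate. *)
Lemma ann_tail_sum_all p (I : Type) (r : seq I) (P : pred I) (F : I -> ZF) :
  all P r -> (forall i, P i -> ann_tail p (F i)) -> ann_tail p (\sum_(i <- r) F i).
Proof.
move=> /all_filterP <- tF; rewrite big_filter; exact: ann_tail_sum.
Qed.

Lemma ann_tail_le p p' (x : ZF) : (p' <= p)%N -> ann_tail p x -> ann_tail p' x.
Proof.
move=> pp'; elim=> [|q c w z /andP[pw aw] _ IHz]; first exact: ann_tail0.
apply: ann_tailD IHz; rewrite /ends_with_ann (leq_trans pp') //=.
have -> : (size w - p' = (p - p') + (size w - p))%N.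
  by rewrite addnC addnBA // subnK.
rewrite -drop_drop; move: aw; rewrite -{1}(cat_take_drop (p - p') (drop _ w)).
by rewrite all_cat => /andP[].
Qed.

(* A lower bound for the number of annihilators at the right end of every
   normally ordered term of [w], when [d] annihilators stand left of [w]. *)
Definition hgt (V : Type) (d : nat) (w : seq (vl V)) : nat :=
  foldl (fun d l => if l.1 then d.+1 else d.-1) d w.

Lemma hgt_cat (V : Type) d (u w : seq (vl V)) : hgt d (u ++ w) = hgt (hgt d u) w.
Proof. exact: foldl_cat. Qed.

Lemma hgt_ren (V W : Type) (h : V -> W) d w : hgt d (map (vren h) w) = hgt d w.
Proof. by rewrite /hgt; elim: w d => //= l w IHw d; rewrite IHw. Qed.

Lemma leq_hgt (V : Type) d d' (w : seq (vl V)) : (d <= d')%N -> (hgt d w <= hgt d' w)%N.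
Proof.
elim: w d d' => //= l w IHw d d' dd'; apply: IHw.
by case: l.1 => //; case: d d' dd' => [|d] [|d'].
Qed.

Lemma hgtS_le (V : Type) d (w : seq (vl V)) : (hgt d.+1 w <= (hgt d w).+1)%N.
Proof.
elim: w d => //= l w IHw d; by case: l.1 => //=; case: d => [|d] //=.
Qed.

Definition nann (V : Type) (w : seq (vl V)) : nat := count (fun l => l.1) w.
Definition ncre (V : Type) (w : seq (vl V)) : nat := count (fun l => ~~ l.1) w.

(** Equality would hold if the height could become negative; truncation at zero can only increase
    it. *)
Lemma hgt_ge (V : Type) d (w : seq (vl V)) : (d + nann w <= hgt d w + ncre w)%N.
Proof.
elim: w d => [|l w IHw] d; first by rewrite /nann /ncre /= !addn0.
rewrite /nann /ncre /=; case: l.1 => /=; rewrite ?add0n ?add1n.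
  by rewrite addnS -addSn; exact: IHw.
rewrite addnS; case: d => [|d] /=; last by rewrite addSn ltnS; exact: IHw.
by rewrite ltnW // ltnS; exact: IHw.
Qed.

Lemma hgt_ann (V : Type) d (s : seq (vl V)) :
  all (fun l => l.1) s -> hgt d s = (d + size s)%N.
Proof.
elim: s d => [|l s IHs] d /=; first by rewrite addn0.
by case/andP=> -> /IHs ->; rewrite addnS.
Qed.

Lemma hgt_cre (V : Type) d (s : seq (vl V)) :
  all (fun l => ~~ l.1) s -> hgt d s = (d - size s)%N.
Proof.
elim: s d => [|l s IHs] d /=; first by rewrite subn0.
by case/andP=> /negbTE -> /IHs ->; rewrite subnS -subn1 subnAC subn1.
Qed.

Lemma zV_ends (V : finType) (C : (V -> R) -> R[i]) u s :
  all (fun l => l.1) s -> ann_tail (size s) (zV C (u ++ s)).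
Proof.
move=> sa; apply: ann_tail_zint; rewrite /ends_with_ann size_map size_cat leq_addl /=.
rewrite addnK map_cat drop_size_cat ?size_map // all_map.
by apply: sub_all sa => -[[] [i x]].
Qed.

Lemma vadm_same (V : finType) x (u w : seq (vl V)) i j :
  ~~ vadm (u ++ van i x :: vcr j x :: w).
Proof.
apply/negP => /forallP/(_ x); rewrite kinds_cat !kinds_cons /= eqxx /=.
rewrite okkindsE => /andP[_ /negP[]].
by apply: subseq_trans (suffix_subseq _ _); exact: (prefix_subseq [:: true; false]).
Qed.

(** Normal ordering: the first creator of [w] moves left through the annihilators [s], and in each
    resulting term it is contracted with at most one of them. The induction is on a bound for the
    length, because a contraction replaces [w] by a renamed copy over another set of variables. *)
Lemma zV_height_aux n (V : finType) (C : (V -> R) -> R[i]) u s w :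
  (size w <= n)%N -> all (fun l => l.1) s ->
  ann_tail (hgt (size s) w) (zV C (u ++ s ++ w)).
Proof.
elim: n V C u s w => [|n IHn] V C u s [|[[] [i x]] w] //=; rewrite ?cats0.
- by move=> _; exact: zV_ends.
- by move=> _; exact: zV_ends.
- rewrite ltnS => sw sa; have := IHn _ C u (rcons s (van i x)) w sw.
  by rewrite all_rcons sa size_rcons cat_rcons; exact.
rewrite ltnS => sw sa.
(* The creator still has to cross [s1] and has already crossed [s2]; the predecessor of [p] allows
   for the one annihilator that a contraction consumes. *)
suff inner p : forall i (s1 s2 : seq (vl V)) (u : seq (vl V)) C, size s1 = p ->
    all (fun l => l.1) s1 -> all (fun l => l.1) s2 ->
    ann_tail (hgt (p.-1 + size s2) w) (zV C (u ++ s1 ++ vcr i x :: s2 ++ w)).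
  by have := inner (size s) i s [::] u C erefl sa isT; rewrite addn0.
elim: p => [|p IHp] {}i s1 s2 {}u {}C.
  move=> /size0nil -> _ s2a /=; rewrite add0n -cat_rcons; exact: IHn.
case/lastP: s1 => [|s1 [b [j y]]]; rewrite ?size_rcons // => -[s1p].
rewrite all_rcons /= => /andP[-> s1a] s2a.
rewrite cat_rcons -/(van j y) catA.
have [<-|nyx] := eqVneq y x.
  by rewrite zV_inadm ?vadm_same //; exact: ann_tail0.
have [adm|nadm] := boolP (vadm ((u ++ s1) ++ van j y :: vcr i x :: s2 ++ w)); last first.
  by rewrite zV_inadm //; exact: ann_tail0.
pose W : finType := {z : V | z != x}.
(* The contraction eliminates [x]: this is the only variable where [insubd] falls back on its
   default, which is [y]. *)
pose m (z : V) : W := insubd (exist _ y nyx : W) z.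
have vm z : z != x -> val (m z) = z by move=> zx; rewrite /m insubdK.
rewrite (@zV_ann_cre _ _ _ V W m) //.
- apply: ann_tail_add.
    apply: ann_tail_sum => i' _; apply: ann_tail_sum => j' _.
    rewrite -catA -[van i' y :: _]/((van i' y :: s2) ++ w).
    apply: ann_tail_le _ (IHp j' s1 (van i' y :: s2) u _ s1p s1a _) => //.
    apply: leq_hgt => /=; case: (p) => //= q; by rewrite addnS.
  case: eqP => _; last exact: ann_tail0.
  rewrite -catA catA -catA catA -catA [s1 ++ _]catA !map_cat.
  have := IHn W (fun k => C (k \o m)) (map (vren m) u) (map (vren m) (s1 ++ s2)) (map (vren m) w).
  rewrite size_map hgt_ren size_map size_cat s1p map_cat.
  apply=> //; rewrite -map_cat all_map all_cat; apply/andP; split.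
    by apply: sub_all s1a => -[].
  by apply: sub_all s2a => -[].
- by rewrite card_sig -(cardC (pred1 x)) card1.
- by apply: val_inj; rewrite vm // /m /insubd insubF ?eqxx.
- by move=> z z'; rewrite !inE => zx zx' /(congr1 val); rewrite !vm.
Qed.

Lemma zV_height (V : finType) (C : (V -> R) -> R[i]) w : ann_tail (hgt 0 w) (zV C w).
Proof. exact: (@zV_height_aux (size w) V C [::] [::] w (leqnn _) isT). Qed.

End Tails.

Section Number.
Variables (R : realType) (N : nat) (Rm : Rmatrix R N).
Local Notation ZF := (ZF Rm).
Local Notation vl := (vletter N).
Local Notation zV := (@zV R N Rm _).

(* N = int dk a^dagger(k) a(k) *)
Definition numop : ZF :=
  \sum_m zV (fun _ : unit -> R => 1) [:: vcr m tt; van m tt].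

(* int C u N v *)
Definition zVnum (V : finType) (C : (V -> R) -> R[i]) (u v : seq (vl V)) : ZF :=
  \sum_m zV (fun k : option V -> R => C (k \o Some))
    (map (vren Some) u ++ vcr m None :: van m None :: map (vren Some) v).

Lemma vadm_some (V : finType) (w : seq (vl V)) (w' : seq (vl (option V))) :
  (forall v, kinds (Some v) w' = kinds v w) -> okkinds (kinds None w') ->
  vadm w -> vadm w'.
Proof. by move=> Sw Nw /forallP aw; apply/forallP => -[v|] //; rewrite Sw. Qed.

Lemma kinds_some (V : finType) (v : V) (w : seq (vl V)) :
  kinds (Some v) (map (vren Some) w) = kinds v w.
Proof. exact: kinds_ren_inj Some_inj. Qed.

Lemma kinds_none (V : finType) (w : seq (vl V)) : kinds None (map (vren Some) w) = [::].
Proof. exact: kinds_ren_notin. Qed.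

Lemma map_vren_comp (V W X : Type) (f : W -> X) (g : V -> W) (w : seq (vl V)) :
  map (vren f) (map (vren g) w) = map (vren (f \o g)) w.
Proof. by rewrite -map_comp. Qed.

Lemma map_vren_id (V : Type) (f : V -> V) (w : seq (vl V)) :
  f =1 id -> map (vren f) w = w.
Proof. by move=> fI; rewrite -[RHS]map_id; apply: eq_map => -[b [i x]]; rewrite /vren /= fI. Qed.

Definition merge_none (V : Type) (y : V) (o : option V) : V := odflt y o.

Lemma map_vren_merge (V : Type) (y : V) (w : seq (vl V)) :
  map (vren (merge_none y)) (map (vren Some) w) = w.
Proof. by rewrite map_vren_comp map_vren_id. Qed.

(** [zeq_ann_cre] asks for injectivity away from the creator's variable. This is [None] when a(y)
    meets the creator of N, and [Some y], treated next, when the annihilator of N meets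
    a^dagger(y). *)
Lemma merge_none_inj (V : finType) (y : V) : {in predC1 None &, injective (merge_none y)}.
Proof. by move=> [a|] [b|] //= _ _ ->. Qed.

Lemma merge_some_inj (V : finType) (y : V) :
  {in predC1 (Some y) &, injective (merge_none y)}.
Proof.
move=> [a|] [b|] //=; rewrite !inE /=.
- by move=> _ _ ->.
- by move=> /eqP ne _ ab; case: ne; rewrite ab.
by move=> _ /eqP ne ab; case: ne; rewrite ab.
Qed.

(** The R-matrix from carrying a(y) past the creator of N equals the one from reordering a(y) with
    the annihilator of N, so the exchange terms match one by one and the contraction remains. *)
Lemma zVnum_ann (V : finType) (C : (V -> R) -> R[i]) u j y v :
  zVnum C (rcons u (van j y)) v =
  zVnum C u (van j y :: v) + zV C (u ++ van j y :: v).
Proof.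
rewrite /zVnum.
under eq_bigr => m _.
  rewrite map_rcons cat_rcons -/(van j (Some y)).
  rewrite (@zV_ann_cre _ _ _ _ V (merge_none y)) //; first last.
  - rewrite map_cat /= !map_vren_merge => aw.
    apply: vadm_some aw => [z|]; rewrite !kinds_cat !kinds_cons /= ?kinds_some ?kinds_none //.
  - exact: merge_none_inj.
  - by rewrite card_option.
  over.
rewrite big_split /=; congr (_ + _); last first.
  rewrite (bigD1 j) //= eqxx big1 ?addr0 => [|m /negbTE nm]; last by rewrite eq_sym nm.
  by rewrite map_cat /= !map_vren_comp !map_vren_id.
under [RHS]eq_bigr => m _.
  rewrite -[_ :: van m _ :: _]cat1s catA zV_ann_ann.
  over.
under eq_bigr do rewrite exchange_big.
rewrite exchange_big; apply: eq_bigr => m _; apply: eq_bigr => i' _.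
apply: eq_bigr => j' _; apply: eq_zV => //.
by rewrite -catA.
Qed.

Lemma zVnum_cre (V : finType) (C : (V -> R) -> R[i]) u j y v :
  zVnum C (rcons u (vcr j y)) v =
  zVnum C u (vcr j y :: v) - zV C (u ++ vcr j y :: v).
Proof.
apply/eqP; rewrite eq_sym subr_eq; apply/eqP; rewrite /zVnum.
under eq_bigr => m _.
  rewrite -cat1s catA /= -/(vcr j (Some y)).
  rewrite (@zV_ann_cre _ _ _ _ V (merge_none y)) //; first last.
  - rewrite !map_cat /= !map_vren_merge -catA => aw.
    apply: vadm_some aw => [z|]; rewrite !kinds_cat !kinds_cons /= ?kinds_some ?kinds_none //.
    by rewrite cats0 -catA.
  - exact: merge_some_inj.
  - by rewrite card_option.
  over.
rewrite big_split /=; congr (_ + _); last first.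
  rewrite (bigD1 j) //= eqxx big1 ?addr0 => [|m /negbTE nm]; last by rewrite nm.
  by rewrite !map_cat /= !map_vren_merge -catA.
under [RHS]eq_bigr => m _.
  rewrite map_rcons cat_rcons zV_cre_cre.
  over.
under [RHS]eq_bigr do rewrite exchange_big.
rewrite [RHS]exchange_big; apply: eq_bigr => m _; apply: eq_bigr => i' _.
apply: eq_bigr => j' _; apply: eq_zV => //.
by rewrite -catA.
Qed.

Lemma zVnum_cat (V : finType) (C : (V -> R) -> R[i]) u w v :
  zVnum C (u ++ w) v =
  zVnum C u (w ++ v) + ((nann w)%:R - (ncre w)%:R) *: zV C (u ++ w ++ v).
Proof.
elim/last_ind: w v => [|w [[] [j y]] IHw] v.
- by rewrite cats0 subrr scale0r addr0.
- rewrite -rcons_cat zVnum_ann IHw cat_rcons -catA -addrA; congr (_ + _).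
  rewrite /nann /ncre -!cats1 !count_cat /= !addn0 addn1 -natr1 [(_ + 1 - _)%R]addrAC.
  by rewrite [RHS]scalerDl scale1r.
rewrite -rcons_cat zVnum_cre IHw cat_rcons -catA -addrA; congr (_ + _).
rewrite /nann /ncre -!cats1 !count_cat /= !addn0 addn1 -natr1 opprD addrA.
by rewrite [RHS]scalerDl scaleN1r.
Qed.

Lemma zV_numop (V : finType) (C : (V -> R) -> R[i]) w :
  zV C w * numop = zVnum C w [::].
Proof.
rewrite mulr_sumr; apply: eq_bigr => m _; rewrite zV_mul /=.
pose h (x : V + unit) : option V := if x is inl v then Some v else None.
rewrite (@zV_reindex _ _ _ _ _ h); last first.
  by exists (fun o => if o is Some v then inl v else inr tt) => [[v|[]]|[v|]].
apply: eq_zV => [k|]; first by rewrite mulr1.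
by rewrite map_cat map_vren_comp.
Qed.

(** Carried leftwards through the last p annihilators, N contributes one for each of them; the term
    where it has crossed them all ends with its own annihilator followed by these p. *)
Lemma numop_ann_tail p (x : ZF) : ann_tail p x -> ann_tail p.+1 (x * numop - p%:R *: x).
Proof.
elim=> [|q c w y /andP[pw aw] _ IHy].
  by rewrite mul0r scaler0 subrr; exact: ann_tail0.
rewrite mulrDl scalerDr opprD addrACA; apply: ann_tail_add IHy.
pose of_letter (l : letter N q) : vl 'I_q :=
  match l with Ann i v => van i v | Cre i v => vcr i v end.
have -> : zint Rm c w = zV c (map of_letter w).
  rewrite (@zV_zint _ _ _ _ q id); last by exists id.
  rewrite -map_comp (eq_map (g := id)) ?map_id //; by case.
rewrite -[w](cat_take_drop (size w - p)) map_cat.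
set u := map _ _; set s := map _ _.
have sp : size s = p by rewrite size_map size_drop subKn.
have sa : all (fun l => l.1) s by rewrite all_map; apply: sub_all aw => -[].
rewrite zV_numop zVnum_cat cats0.
have -> : nann s = p by rewrite -sp; apply/eqP; rewrite -all_count.
have -> : ncre s = 0%N.
  by apply/eqP; rewrite -leqn0 leqNgt -has_count -all_predC; apply: sub_all sa => l /= ->.
rewrite subr0 addrK; apply: ann_tail_sum => m _.
rewrite -sp -(size_map (vren Some)) -cat_rcons -[X in X.+1]/(size (map (vren Some) s)).
by apply: (@zV_ends _ _ _ _ _ _ (van m None :: map (vren Some) s)) => /=; rewrite all_map; apply: sub_all sa => -[].
Qed.

(* The induction step of both uniqueness arguments: [x] is int C u Y v, [y] is
   int C u Y N v, and [y + s x] is int C u Psi(Y) v. *)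
Lemma ann_tail_step (V : Type) d s (v : seq (vl V)) (x y : ZF) :
  (0 < d + s)%N -> ann_tail (hgt d v) x ->
  x * numop = y + ((nann v)%:R - (ncre v)%:R) *: x ->
  ann_tail (hgt d.+1 v) (y + s%:R *: x) -> ann_tail (hgt d.+1 v) x.
Proof.
move=> ds0 tx xN ty.
have tN := ann_tail_le (hgtS_le d v) (numop_ann_tail tx).
set D := hgt d v in tN.
have Dge : (d + nann v <= D + ncre v)%N := hgt_ge d v.
(* Up to higher terms N multiplies [x] by [D]; crossing [v] accounts for [nann v - ncre v] of it,
   and the recursion adds [s]. By [hgt_ge] the resulting factor is at least [d + s], so it is
   invertible. *)
set e := (D + ncre v - nann v + s)%N.
have e0 : e%:R != 0 :> R[i].
  rewrite pnatr_eq0 -lt0n (leq_trans ds0) // leq_add2r.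
  by rewrite leq_subRL ?(leq_trans _ Dge) ?leq_addl // addnC.
have -> : x = e%:R^-1 *: ((y + s%:R *: x) - (x * numop - D%:R *: x)).
  apply: (canRL (scalerK e0)).
  have -> : y + s%:R *: x - (x * numop - D%:R *: x) =
      (s%:R + D%:R - ((nann v)%:R - (ncre v)%:R)) *: x.
    have cancel_y (a b : ZF) : y + a - (y + b - D%:R *: x) = a + D%:R *: x - b.
      by rewrite opprB addrA opprD -[y + a + _]addrA addrACA subrr add0r.
    by rewrite xN cancel_y -scalerDl -scalerBl.
  congr (_ *: x); rewrite /e natrD natrB ?natrD; first by rewrite opprB addrC !addrA addrAC.
  by rewrite (leq_trans _ Dge) ?leq_addl.
by apply: ann_tail_scale; apply: ann_tail_add => //; exact: ann_tail_opp.
Qed.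

End Number.

(** * Closed formal sums in context *)

Section ClosedSums.
Variables (R : realType) (N : nat) (Rm : Rmatrix R N).
Local Notation ZF := (ZF Rm).
Local Notation vl := (vletter N).
Local Notation zV := (@zV R N Rm _).
Local Notation zVnum := (@zVnum R N Rm _).

(* The variables are ordinals since a record containing a [finType] would live in
   too large a universe for [exchange_big]. *)
Record mon := Mon {
  mdim : nat;
  mcoef : ('I_mdim -> R) -> R[i];
  mword : seq (vl 'I_mdim) }.

Local Notation mvar m := 'I_(mdim m).

(* The formal sum [P] of closed integrals, placed between the words [u] and
   [v], all multiplied by the function [C] of the variables [V] and integrated. *)
Definition ctx (P : seq mon) (V : finType) (C : (V -> R) -> R[i]) (u v : seq (vl V)) : ZF :=
  \sum_(m <- P) zV (fun k : V + mvar m -> R => C (k \o inl) * mcoef (k \o inr))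
    (map (vren inl) u ++ map (vren inr) (mword m) ++ map (vren inl) v).

Lemma eq_ctx (P : seq mon) (V : finType) (C C' : (V -> R) -> R[i]) u v :
  C =1 C' -> ctx P C u v = ctx P C' u v.
Proof. by move=> /funext ->. Qed.

Lemma ctx_cat (P Q : seq mon) (V : finType) (C : (V -> R) -> R[i]) u v :
  ctx (P ++ Q) C u v = ctx P C u v + ctx Q C u v.
Proof. exact: big_cat. Qed.

Lemma ctx_flatten (I : Type) (r : seq I) (P : I -> seq mon) (V : finType)
    (C : (V -> R) -> R[i]) u v :
  ctx (flatten [seq P i | i <- r]) C u v = \sum_(i <- r) ctx (P i) C u v.
Proof. by rewrite /ctx big_flatten big_map. Qed.

Lemma ctxZ (P : seq mon) (V : finType) a (C : (V -> R) -> R[i]) u v :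
  ctx P (fun k => a * C k) u v = a *: ctx P C u v.
Proof.
rewrite /ctx scaler_sumr; apply: eq_bigr => m _; rewrite -zVZ.
by apply: eq_zV => // k; rewrite mulrA.
Qed.

Lemma ctx_sum (P : seq mon) (V : finType) (I : Type) (r : seq I) (Q : pred I)
    (C : I -> (V -> R) -> R[i]) u v :
  ctx P (fun k => \sum_(i <- r | Q i) C i k) u v = \sum_(i <- r | Q i) ctx P (C i) u v.
Proof.
rewrite /ctx [RHS]exchange_big; apply: eq_bigr => m _ /=; rewrite -zV_sum.
by apply: eq_zV => // k; rewrite mulr_suml.
Qed.

Definition mscale (a : R[i]) (m : mon) : mon :=
  @Mon (mdim m) (fun k => a * mcoef k) (mword m).

Lemma ctx_scale (P : seq mon) a (V : finType) (C : (V -> R) -> R[i]) u v :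
  ctx (map (mscale a) P) C u v = a *: ctx P C u v.
Proof.
rewrite /ctx big_map scaler_sumr; apply: eq_bigr => m _; rewrite -zVZ.
by apply: eq_zV => // k; rewrite mulrCA.
Qed.

Lemma ctx_hgt d (P : seq mon) (V : finType) (C : (V -> R) -> R[i]) u v :
  all (fun m => d <= hgt 0 (mword m))%N P -> ann_tail (hgt d v) (ctx P C u v).
Proof.
rewrite /ctx; elim: P => [|m P IHP] /=; first by rewrite big_nil => _; exact: ann_tail0.
case/andP=> dm /IHP tP; rewrite big_cons; apply: ann_tail_add tP.
apply: ann_tail_le (zV_height _ _ _); rewrite !hgt_cat !hgt_ren leq_hgt //.
by rewrite (leq_trans dm) // leq_hgt.
Qed.

Definition ctxnum (P : seq mon) (V : finType) (C : (V -> R) -> R[i]) (u v : seq (vl V)) : ZF :=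
  \sum_m ctx P (fun k : option V -> R => C (k \o Some)) (map (vren Some) u)
    (vcr m None :: van m None :: map (vren Some) v).

Lemma ctxnumE (P : seq mon) (V : finType) (C : (V -> R) -> R[i]) u v :
  ctxnum P C u v =
  \sum_(m <- P) zVnum (fun k : V + mvar m -> R => C (k \o inl) * mcoef (k \o inr))
    (map (vren inl) u ++ map (vren inr) (mword m)) (map (vren inl) v).
Proof.
rewrite /ctxnum /ctx exchange_big; apply: eq_bigr => m _; apply: eq_bigr => i _ /=.
pose h (x : option V + mvar m) : option (V + mvar m) :=
  match x with inl (Some v) => Some (inl v) | inl None => None | inr z => Some (inr z) end.
rewrite (@zV_reindex _ _ _ _ _ h); last first.
  exists (fun o => match o with Some (inl v) => inl (Some v)
                             | None => inl None | Some (inr z) => inr z end).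
    by move=> [[v'|]|z].
  by move=> [[v'|z]|].
by apply: eq_zV => //; rewrite !map_cat /= !map_vren_comp -?catA.
Qed.

Lemma ctx_numop (P : seq mon) (V : finType) (C : (V -> R) -> R[i]) u v :
  ctx P C u v * numop Rm = ctxnum P C u v + ((nann v)%:R - (ncre v)%:R) *: ctx P C u v.
Proof.
rewrite ctxnumE /ctx mulr_suml scaler_sumr -big_split; apply: eq_bigr => m _ /=.
rewrite zV_numop catA zVnum_cat cats0; congr (_ + (_ - _) *: _);
by rewrite /nann /ncre count_map; congr (_%:R).
Qed.

Lemma ctx_cre_cre (P : seq mon) (V : finType) (C : (V -> R) -> R[i]) u v i x j y :
  ctx P C (u ++ [:: vcr i x; vcr j y]) v =
  \sum_i' \sum_j' ctx P (fun k => C k * Rent Rm (k y) (k x) j' i' j i)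
    (u ++ [:: vcr j' y; vcr i' x]) v.
Proof.
rewrite /ctx; under [RHS]eq_bigr do rewrite exchange_big.
rewrite exchange_big; apply: eq_bigr => m _ /=.
rewrite map_cat -catA zV_cre_cre; apply: eq_bigr => i' _; apply: eq_bigr => j' _.
by apply: eq_zV => [k|]; rewrite ?map_cat -?catA // mulrAC.
Qed.

(** The annihilator shares its variable [None] with the creator to the left of [P]. The delta
    function identifies this variable with [x], so the contraction leaves a^dagger(x) on the left of
    [P]. *)
Lemma ctx_ann_cre (P : seq mon) (V : finType) (C : (option V -> R) -> R[i]) u v m m' l x :
  ctx P C (map (vren Some) u ++ [:: vcr m None])
    (van m' None :: vcr l (Some x) :: map (vren Some) v) =
  (\sum_i' \sum_j' ctx P (fun k => C k * Rent Rm (k None) (k (Some x)) m' j' i' l)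
    (map (vren Some) u ++ [:: vcr m None])
    (vcr j' (Some x) :: van i' None :: map (vren Some) v)) +
  (if m' == l then ctx P (fun k => C (k \o merge_none x)) (u ++ [:: vcr m x]) v else 0).
Proof.
rewrite /ctx; under [X in _ = X + _]eq_bigr do rewrite exchange_big.
rewrite exchange_big /=.
rewrite -[if m' == l then _ else 0]/(if m' == l then \sum_(a <- P) _ else 0).
have -> : (if m' == l then
     \sum_(m0 <- P)
        zV (fun k : V + mvar m0 -> R => C ((k \o inl) \o merge_none x) * mcoef (k \o inr))
         (map (vren inl) (u ++ [:: vcr m x]) ++ map (vren inr) (mword m0) ++ map (vren inl) v)
   else 0) = \sum_(m0 <- P) if m' == l then
     zV (fun k : V + mvar m0 -> R => C ((k \o inl) \o merge_none x) * mcoef (k \o inr))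
         (map (vren inl) (u ++ [:: vcr m x]) ++ map (vren inr) (mword m0) ++ map (vren inl) v)
   else 0.
  by case: ifP => // _; rewrite big1.
rewrite -big_split; apply: eq_bigr => a _ /=.
pose h (z : option V + mvar a) : V + mvar a :=
  match z with inl o => inl (merge_none x o) | inr z => inr z end.
have hE w1 : map (vren h) (map (vren inl) (map (vren Some) w1)) = map (vren inl) w1.
  by rewrite !map_vren_comp.
rewrite [X in zV _ X]catA (@zV_ann_cre _ _ _ _ (V + mvar a)%type h) //=.
- congr (_ + _).
    apply: eq_bigr => i' _; apply: eq_bigr => j' _.
    by apply: eq_zV => [k|]; rewrite ?map_cat -?catA // mulrAC.
  case: ifP => // _; apply: eq_zV => //.
  by rewrite !map_cat !hE -!catA /= map_vren_comp.
- by rewrite !card_sum card_option.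
- move=> [[z|]|z] [[z'|]|z']; rewrite !inE //= => /eqP ne /eqP ne' [] e //.
  + by rewrite e.
  + by case: ne; rewrite e.
  + by case: ne'; rewrite e.
  by rewrite e.
rewrite !map_cat !hE /= => /forallP aw; apply/forallP => z.
have inlI : injective (@inl (option V) (mvar a)) by move=> ? ? [].
have inlI' : injective (@inl V (mvar a)) by move=> ? ? [].
have inrI : injective (@inr (option V) (mvar a)) by move=> ? ? [].
have inrI' : injective (@inr V (mvar a)) by move=> ? ? [].
case: z => [[z|]|z].
- have := aw (inl z); rewrite !(kinds_cat, kinds_cons) /= !(kinds_ren_inj _ _ inlI, kinds_ren_inj _ _ inlI').
  rewrite !kinds_some map_vren_comp !(kinds_ren_notin (h := inr)) ?(kinds_ren_notin (h := h \o inr)) //=.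
  by rewrite !cats0 ?cat0s -?catA.
- rewrite !(kinds_cat, kinds_cons) /= !(kinds_ren_inj _ _ inlI) !kinds_none /=.
  by rewrite (kinds_ren_notin (h := inr)).
have := aw (inr z); rewrite !(kinds_cat, kinds_cons) /= !(kinds_ren_notin (h := inl)) //=.
rewrite map_vren_comp (kinds_ren_inj _ _ inrI) (@kinds_ren_inj _ _ _ (h \o inr)) //.
Qed.

Definition mmul (m1 m2 : mon) : mon :=
  @Mon (mdim m1 + mdim m2)
    (fun k => mcoef (k \o lshift (mdim m2)) * mcoef (k \o @rshift (mdim m1) (mdim m2)))
    (map (vren (lshift (mdim m2))) (mword m1) ++
     map (vren (@rshift (mdim m1) (mdim m2))) (mword m2)).

Definition pmul (P Q : seq mon) : seq mon := [seq mmul m1 m2 | m1 <- P, m2 <- Q].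

(** A product is one factor in a context that contains a word of the other; together with [ctx_mulr]
    this lets a relation for either factor be used inside the product. *)
Lemma ctx_mull (P Q : seq mon) (V : finType) (C : (V -> R) -> R[i]) u v :
  ctx (pmul P Q) C u v =
  \sum_(m <- P) ctx Q (fun k : V + mvar m -> R => C (k \o inl) * mcoef (k \o inr))
    (map (vren inl) u ++ map (vren inr) (mword m)) (map (vren inl) v).
Proof.
rewrite /ctx big_allpairs_dep; apply: eq_bigr => m1 _; apply: eq_bigr => m2 _ /=.
pose h (x : (V + mvar m1) + mvar m2) : V + 'I_(mdim m1 + mdim m2) :=
  match x with inl (inl v) => inl v | inl (inr z) => inr (lshift _ z)
             | inr z => inr (rshift _ z) end.
rewrite [RHS](@zV_reindex _ _ _ _ _ h); last first.
  exists (fun x => match x with inl v => inl (inl v)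
    | inr z => match split z with inl z => inl (inr z) | inr z => inr z end end).
    by move=> [[z|z]|z] //=; rewrite ?(unsplitK (inl _)) ?(unsplitK (inr _)).
  by move=> [z|z] //=; rewrite -[in RHS](splitK z); case: split.
apply: eq_zV => [k|]; first by rewrite mulrA.
by rewrite !map_cat !map_vren_comp -!catA.
Qed.

Lemma ctx_mulr (P Q : seq mon) (V : finType) (C : (V -> R) -> R[i]) u v :
  ctx (pmul P Q) C u v =
  \sum_(m <- Q) ctx P (fun k : V + mvar m -> R => C (k \o inl) * mcoef (k \o inr))
    (map (vren inl) u) (map (vren inr) (mword m) ++ map (vren inl) v).
Proof.
rewrite /ctx big_allpairs_dep exchange_big; apply: eq_bigr => m2 _; apply: eq_bigr => m1 _ /=.
pose h (x : (V + mvar m2) + mvar m1) : V + 'I_(mdim m1 + mdim m2) :=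
  match x with inl (inl v) => inl v | inl (inr z) => inr (rshift _ z)
             | inr z => inr (lshift _ z) end.
rewrite [RHS](@zV_reindex _ _ _ _ _ h); last first.
  exists (fun x => match x with inl v => inl (inl v)
    | inr z => match split z with inl z => inr z | inr z => inl (inr z) end end).
    by move=> [[z|z]|z] //=; rewrite ?(unsplitK (inl _)) ?(unsplitK (inr _)).
  by move=> [z|z] //=; rewrite -[in RHS](splitK z); case: split.
apply: eq_zV => [k|]; first by rewrite mulrA mulrAC.
by rewrite !map_cat !map_vren_comp -!catA.
Qed.

Lemma ctxnum_pmul (P Q : seq mon) (V : finType) (C : (V -> R) -> R[i]) u v :
  ctxnum (pmul P Q) C u v =
  \sum_(m <- P) ctxnum Q (fun k : V + 'I_(mdim m) -> R => C (k \o inl) * mcoef (k \o inr))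
    (map (vren inl) u ++ map (vren inr) (mword m)) (map (vren inl) v).
Proof.
have ctxnumE (P' : seq mon) (V' : finType) (C' : (V' -> R) -> R[i]) u' v' :
    ctxnum P' C' u' v' =
    ctx P' C' u' v' * numop Rm - ((nann v')%:R - (ncre v')%:R) *: ctx P' C' u' v'.
  by rewrite ctx_numop addrK.
rewrite ctxnumE ctx_mull mulr_suml scaler_sumr -sumrB; apply: eq_bigr => m _.
rewrite ctxnumE; congr (_ - (_ - _) *: _);
by rewrite /nann /ncre count_map; congr (_%:R).
Qed.

(** Both sides stand for u P a^dagger_0 Q a_0 v. On the right, [P] is the closed sum and a^dagger_0
    the first letter after it, the form in which [wbdefect] applies to [P]. *)
Lemma ctx_pmul_split (P Q : seq mon) (V : finType) (C : (V -> R) -> R[i]) (D : R -> R[i])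
    u v l l' :
  \sum_(m <- P) ctx Q
     (fun k : option (V + 'I_(mdim m)) -> R =>
        (C (k \o Some \o inl) * mcoef (k \o Some \o inr)) * D (k None))
     (map (vren Some) (map (vren inl) u ++ map (vren inr) (mword m)) ++ [:: vcr l None])
     (van l' None :: map (vren Some) (map (vren inl) v)) =
  \sum_(m <- Q) ctx P
     (fun k : option V + 'I_(mdim m) -> R =>
        (C (k \o inl \o Some) * D (k (inl None))) * mcoef (k \o inr))
     (map (vren inl) (map (vren Some) u))
     (vcr l (inl None) :: map (vren inr) (mword m) ++
        van l' (inl None) :: map (vren inl) (map (vren Some) v)).
Proof.
rewrite /ctx exchange_big; apply: eq_bigr => m2 _; apply: eq_bigr => m1 _ /=.
pose h (x : option (V + 'I_(mdim m1)) + 'I_(mdim m2)) : (option V + 'I_(mdim m2)) + 'I_(mdim m1) :=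
  match x with
  | inl (Some (inl v)) => inl (inl (Some v)) | inl None => inl (inl None)
  | inl (Some (inr z)) => inr z | inr z => inl (inr z) end.
rewrite (@zV_reindex _ _ _ _ _ h); last first.
  exists (fun x => match x with
    | inl (inl (Some v)) => inl (Some (inl v)) | inl (inl None) => inl None
    | inr z => inl (Some (inr z)) | inl (inr z) => inr z end).
    by move=> [[[v'|z]|]|z].
  by move=> [[[v'|]|z]|z].
apply: eq_zV => [k|].
  rewrite /= -!mulrA; congr (_ * _); by rewrite mulrC -mulrA.
by rewrite !(map_cat, map_cons) !map_vren_comp -!catA.
Qed.

Definition mval (P : seq mon) : ZF := \sum_(m <- P) zV (@mcoef m) (mword m).

Lemma mval_ctx (P : seq mon) : mval P = ctx P (fun _ : void -> R => 1) [::] [::].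
Proof.
apply: eq_bigr => m _; rewrite cats0 /=.
rewrite (@zV_reindex _ _ _ _ (void + mvar m)%type inr).
  by apply: eq_zV => // k; rewrite mul1r.
by exists (fun x : void + mvar m => match x with inl v => match v with end | inr z => z end) => // -[].
Qed.

Lemma mval_mul (P Q : seq mon) : mval (pmul P Q) = mval P * mval Q.
Proof.
rewrite /mval big_allpairs_dep mulr_suml; apply: eq_bigr => m1 _.
rewrite mulr_sumr; apply: eq_bigr => m2 _; rewrite zV_mul.
rewrite [RHS](@zV_reindex _ _ _ _ _ (@unsplit (mdim m1) (mdim m2))).
  by apply: eq_zV => //; rewrite map_cat !map_vren_comp.
by exists split; [exact: unsplitK | exact: splitK].
Qed.

End ClosedSums.

(** * Half of the well-bredness of T *)

Section Sums.
Variables (Z : nmodType) (I : finType).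

Lemma sum7_perm34 (G : I -> I -> I -> I -> I -> I -> I -> Z) :
  \sum_a \sum_b \sum_c \sum_d \sum_e \sum_f \sum_g G a b c d e f g =
  \sum_d \sum_e \sum_f \sum_g \sum_a \sum_b \sum_c G a b c d e f g.
Proof.
rewrite !pair_bigA /=.
pose h (p : I * I * I * I * I * I * I) :=
  let: (d, e, f, g, a, b, c) := p in (a, b, c, d, e, f, g).
rewrite (reindex h); first by apply: eq_bigr => -[[[[[[? ?] ?] ?] ?] ?] ?].
by exists (fun p => let: (a, b, c, d, e, f, g) := p in (d, e, f, g, a, b, c));
  move=> -[[[[[[? ?] ?] ?] ?] ?] ?].
Qed.

Lemma sum7_perm_defect (G : I -> I -> I -> I -> I -> I -> I -> Z) :
  \sum_m \sum_i' \sum_m' \sum_n \sum_l' \sum_i2 \sum_l2 G m i' m' n l' i2 l2 =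
  \sum_i2 \sum_n \sum_l2 \sum_m \sum_i' \sum_m' \sum_l' G m i' m' n l' i2 l2.
Proof.
rewrite !pair_bigA /=.
pose h (p : I * I * I * I * I * I * I) :=
  let: (i2, n, l2, m, i', m', l') := p in (m, i', m', n, l', i2, l2).
rewrite (reindex h); first by apply: eq_bigr => -[[[[[[? ?] ?] ?] ?] ?] ?].
by exists (fun p => let: (m, i', m', n, l', i2, l2) := p in (i2, n, l2, m, i', m', l'));
  move=> -[[[[[[? ?] ?] ?] ?] ?] ?].
Qed.

Lemma sum7_perm21 (G : I -> I -> I -> I -> I -> I -> I -> Z) :
  \sum_l \sum_a \sum_b \sum_n \sum_x \sum_y \sum_m G l a b n x y m =
  \sum_x \sum_y \sum_m \sum_a \sum_n \sum_b \sum_l G l a b n x y m.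
Proof.
rewrite !pair_bigA /=.
pose h (p : I * I * I * I * I * I * I) :=
  let: (x, y, m, a, n, b, l) := p in (l, a, b, n, x, y, m).
rewrite (reindex h); first by apply: eq_bigr => -[[[[[[? ?] ?] ?] ?] ?] ?].
by exists (fun p => let: (l, a, b, n, x, y, m) := p in (x, y, m, a, n, b, l));
  move=> -[[[[[[? ?] ?] ?] ?] ?] ?].
Qed.

Lemma sum7_perm12 (G : I -> I -> I -> I -> I -> I -> I -> Z) :
  \sum_l \sum_a \sum_b \sum_n \sum_x \sum_y \sum_m G l a b n x y m =
  \sum_x \sum_y \sum_l \sum_n \sum_a \sum_b \sum_m G l a b n x y m.
Proof.
rewrite !pair_bigA /=.
pose h (p : I * I * I * I * I * I * I) :=
  let: (x, y, l, n, a, b, m) := p in (l, a, b, n, x, y, m).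
rewrite (reindex h); first by apply: eq_bigr => -[[[[[[? ?] ?] ?] ?] ?] ?].
by exists (fun p => let: (l, a, b, n, x, y, m) := p in (x, y, l, n, a, b, m));
  move=> -[[[[[[? ?] ?] ?] ?] ?] ?].
Qed.

Lemma sum7_perm12' (G : I -> I -> I -> I -> I -> I -> I -> Z) :
  \sum_x \sum_y \sum_m \sum_b \sum_n \sum_a \sum_l G x y m b n a l =
  \sum_a \sum_b \sum_l \sum_n \sum_x \sum_y \sum_m G x y m b n a l.
Proof.
rewrite !pair_bigA /=.
pose h (p : I * I * I * I * I * I * I) :=
  let: (a, b, l, n, x, y, m) := p in (x, y, m, b, n, a, l).
rewrite (reindex h); first by apply: eq_bigr => -[[[[[[? ?] ?] ?] ?] ?] ?].
by exists (fun p => let: (x, y, m, b, n, a, l) := p in (a, b, l, n, x, y, m));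
  move=> -[[[[[[? ?] ?] ?] ?] ?] ?].
Qed.

End Sums.

Lemma scaler_sum5 (K : pzRingType) (Z : lmodType K) (I : finType) (r : K)
    (G : I -> I -> I -> I -> I -> Z) :
  r *: (\sum_a \sum_b \sum_c \sum_d \sum_e G a b c d e) =
  \sum_a \sum_b \sum_c \sum_d \sum_e r *: G a b c d e.
Proof. by rewrite !pair_bigA scaler_sumr. Qed.

Section WellBred.
Variables (R : realType) (N : nat) (Rm : Rmatrix R N).
Local Notation ZF := (ZF Rm).
Local Notation ctx P := (@ctx R N Rm P _).
Local Notation ctxnum P := (@ctxnum R N Rm P _).
Local Notation mon := (mon R N).
Local Notation Rent := (Rent Rm).

Lemma ctx_mulsum3 (P : seq mon) (V : finType) (c : (V -> R) -> R[i])
    (G : 'I_N -> 'I_N -> 'I_N -> (V -> R) -> R[i]) u v :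
  ctx P (fun k => c k * \sum_x \sum_y \sum_z G x y z k) u v =
  \sum_x \sum_y \sum_z ctx P (fun k => c k * G x y z k) u v.
Proof.
rewrite !pair_bigA /= -ctx_sum; apply: eq_ctx => k.
by rewrite !pair_bigA /= mulr_sumr.
Qed.

Definition YBE_entries : Prop := forall (k1 k2 k3 : R) (a b c a' b' c' : 'I_N),
  \sum_x \sum_y \sum_z Rent k1 k2 a b x y * Rent k1 k3 x c a' z * Rent k2 k3 y z b' c' =
  \sum_x \sum_y \sum_z Rent k2 k3 b c y z * Rent k1 k3 a z x c' * Rent k1 k2 x y a' b'.

(* [T N = int a^dagger_0 R_{infinity 0} T a_0], up to terms with more than [M]
   annihilators *)
Definition intertwines (T : 'I_N -> 'I_N -> seq mon) (kappa : R) (M : nat) : Prop :=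
  exists2 Err : 'I_N -> 'I_N -> seq mon,
    (forall i j, all (fun m : mon => M.+1 <= hgt 0 (mword m))%N (Err i j)) &
    forall (V : finType) (C : (V -> R) -> R[i]) u v i j,
      ctxnum (T i j) C u v =
      \sum_m \sum_i' \sum_m'
        ctx (T i' j)
          (fun k : option V -> R => C (k \o Some) * Rent kappa (k None) i m i' m')
          (map (vren Some) u ++ [:: vcr m None])
          (van m' None :: map (vren Some) v)
      + ctx (Err i j) C u v.

(* the failure of [T a^dagger_x = a^dagger_x R_{infinity x} T] *)
Definition wbdefect (T : 'I_N -> 'I_N -> seq mon) (kappa : R) (V : finType) (x : V)
    (C : (V -> R) -> R[i]) u v i j l : ZF :=
  ctx (T i j) C u (vcr l x :: v) -
  \sum_i' \sum_l' ctx (T i' j) (fun k => C k * Rent kappa (k x) i l' i' l)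
    (u ++ [:: vcr l' x]) v.

(** Only in the first term does N have to cross a^dagger_x in order to reach T; this is the origin
    of the extra [- ctx]. *)
Lemma numop_wbdefect T kappa (V : finType) (x : V) (C : (V -> R) -> R[i]) u v i j l :
  wbdefect T kappa x C u v i j l * numop Rm =
  (ctxnum (T i j) C u (vcr l x :: v) - ctx (T i j) C u (vcr l x :: v)
   - \sum_i' \sum_l' ctxnum (T i' j) (fun k => C k * Rent kappa (k x) i l' i' l)
      (u ++ [:: vcr l' x]) v)
  + ((nann v)%:R - (ncre v)%:R) *: wbdefect T kappa x C u v i j l.
Proof.
rewrite /wbdefect mulrBl ctx_numop mulr_suml.
under eq_bigr do rewrite mulr_suml.
under eq_bigr do under eq_bigr do rewrite ctx_numop.
under eq_bigr do rewrite big_split /= -scaler_sumr.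
rewrite big_split /= -scaler_sumr scalerBr opprD.
have -> : (nann (vcr l x :: v))%:R - (ncre (vcr l x :: v))%:R =
    (nann v)%:R - (ncre v)%:R - 1 :> R[i].
  by rewrite [nann _]/= [ncre _]/= add0n add1n -natr1 opprD addrA.
by rewrite [(_ - _ - 1) *: _]scalerBl scale1r [X in _ + X + _ = _]addrC [X in X + _ = _]addrA addrACA.
Qed.

(** After (1) is applied in T N a^dagger_x, the annihilator a_0 either passes a^dagger_x or is
    contracted with it. The contraction gives a^dagger_x R T, which completes the loss in
    [numop_wbdefect] to -Y. The other terms form Psi(Y), by the Yang-Baxter equation on the spaces
    infinity, 0 and x. *)
Lemma wbdefect_rec T kappa M (V : finType) (x : V) (C : (V -> R) -> R[i]) u v i j l :
  YBE_entries -> intertwines T kappa M ->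
  ann_tail (hgt M v)
   ((ctxnum (T i j) C u (vcr l x :: v) - ctx (T i j) C u (vcr l x :: v)
     - \sum_i' \sum_l' ctxnum (T i' j) (fun k => C k * Rent kappa (k x) i l' i' l)
        (u ++ [:: vcr l' x]) v)
    + wbdefect T kappa x C u v i j l
    - \sum_m \sum_i' \sum_m' \sum_n \sum_l'
        wbdefect T kappa (Some x)
          (fun k : option V -> R => C (k \o Some) * Rent kappa (k None) i m i' m' *
             Rent (k None) (k (Some x)) m' l' n l)
          (map (vren Some) u ++ [:: vcr m None]) (van n None :: map (vren Some) v)
          i' j l').
Proof.
move=> YB [Err tErr Trel].
rewrite [wbdefect T kappa x C u v i j l]/wbdefect.
set S1 := \sum_i' \sum_l' ctxnum _ _ _ _; set W := \sum_i' \sum_l' ctx _ _ _ _.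
set t := ctx (T i j) _ _ _; set A := ctxnum (T i j) _ _ _; set Z := \sum_m _.
have -> : A - t - S1 + (t - W) - Z = A - W - S1 - Z.
  by congr (_ - Z); rewrite addrACA subrK addrA addrAC.
pose F (i2 : 'I_N) (n l2 m2 : 'I_N) (K : R -> R -> R[i]) :=
  ctx (T i2 j) (fun k : option V -> R => C (k \o Some) * K (k None) (k (Some x)))
    (map (vren Some) u ++ [:: vcr m2 None; vcr l2 (Some x)])
    (van n None :: map (vren Some) v).
have AE : A - W = ctx (Err i j) C u (vcr l x :: v) +
    \sum_m \sum_i' \sum_m' \sum_n \sum_l'
     ctx (T i' j) (fun k : option V -> R => C (k \o Some) * Rent kappa (k None) i m i' m' *
             Rent (k None) (k (Some x)) m' l' n l)
       (map (vren Some) u ++ [:: vcr m None])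
       (vcr l' (Some x) :: van n None :: map (vren Some) v).
  rewrite /A Trel [X in X - W]addrC -addrA; congr (_ + _); apply/eqP; rewrite subr_eq; apply/eqP.
  under eq_bigr do under eq_bigr do under eq_bigr do rewrite map_cons ctx_ann_cre.
  rewrite /W [X in _ = _ + X]exchange_big -big_split; apply: eq_bigr => m _ /=.
  rewrite -big_split; apply: eq_bigr => i' _ /=.
  rewrite big_split; congr (_ + _) => /=.
  by rewrite (bigD1 l) //= eqxx big1 ?addr0 // => m' /negbTE ->.
have SE : S1 = \sum_i' \sum_l' ctx (Err i' j) (fun k => C k * Rent kappa (k x) i l' i' l) (u ++ [:: vcr l' x]) v
   + \sum_i2 \sum_n \sum_l2 \sum_m2 F i2 n l2 m2 (fun k0 kx => \sum_i' \sum_l' \sum_m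
      Rent k0 kx m2 l2 m l' * Rent kappa kx i l' i' l * Rent kappa k0 i' m i2 n).
  rewrite /S1; under eq_bigr do under eq_bigr do rewrite Trel addrC.
  under eq_bigr do rewrite big_split; rewrite big_split; congr (_ + _) => /=.
  under eq_bigr do under eq_bigr do under eq_bigr do under eq_bigr do under eq_bigr do
    rewrite map_cat -catA ctx_cre_cre.
  rewrite sum7_perm34; apply: eq_bigr => i2 _; apply: eq_bigr => n _; apply: eq_bigr => l2 _.
  apply: eq_bigr => m2 _; rewrite /F ctx_mulsum3.
  apply: eq_bigr => i' _; apply: eq_bigr => l' _; apply: eq_bigr => m _.
  by apply: eq_ctx => k /=; rewrite -!mulrA; congr (_ * _); rewrite mulrA mulrC.
have ZE : Z = \sum_m \sum_i' \sum_m' \sum_n \sum_l'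
     ctx (T i' j) (fun k : option V -> R => C (k \o Some) * Rent kappa (k None) i m i' m' *
             Rent (k None) (k (Some x)) m' l' n l)
       (map (vren Some) u ++ [:: vcr m None])
       (vcr l' (Some x) :: van n None :: map (vren Some) v)
   - \sum_i2 \sum_n \sum_l2 \sum_m2 F i2 n l2 m2 (fun k0 kx => \sum_i' \sum_m' \sum_l'
      Rent kappa k0 i m2 i' m' * Rent kappa kx i' l2 i2 l' * Rent k0 kx m' l' n l).
  rewrite /Z /wbdefect.
  under eq_bigr do under eq_bigr do under eq_bigr do under eq_bigr do rewrite sumrB.
  under eq_bigr do under eq_bigr do under eq_bigr do rewrite sumrB.
  under eq_bigr do under eq_bigr do rewrite sumrB.
  under eq_bigr do rewrite sumrB.
  rewrite sumrB; congr (_ - _); rewrite sum7_perm_defect.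
  apply: eq_bigr => i2 _; apply: eq_bigr => n _; apply: eq_bigr => l2 _.
  apply: eq_bigr => m2 _; rewrite /F ctx_mulsum3.
  apply: eq_bigr => i' _; apply: eq_bigr => m' _; apply: eq_bigr => l' _.
  rewrite -catA; apply: eq_ctx => k /=; rewrite -!mulrA; congr (_ * (_ * _)).
  by rewrite mulrC.
rewrite AE SE ZE.
set a := ctx (Err i j) _ _ _; set s := \sum_m _; set b := \sum_i' _.
set f1 := \sum_i2 _; set f2 := \sum_i2 _.
have -> : f1 = f2.
  apply: eq_bigr => i2 _; apply: eq_bigr => n _; apply: eq_bigr => l2 _; apply: eq_bigr => m2 _.
  apply: eq_ctx => k; congr (_ * _); rewrite -/Rent.
  set k0 := k None; set kx := k (Some x).
  rewrite (YB kappa k0 kx i m2 l2 i2 n l); apply: eq_bigr => i' _.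
  exact: exchange_big.
have -> : a + s - (b + f2) - (s - f2) = a - b.
  by apply/eqP; rewrite subr_eq opprD addrACA.
(* The error terms have height [M.+1], of which a^dagger_x may consume one; hence the bound
   [hgt M v]. *)
apply: ann_tail_add; first exact: (ctx_hgt Rm C u (vcr l x :: v) (tErr i j)).
apply: ann_tail_opp; apply: ann_tail_sum => i' _; apply: ann_tail_sum => l' _.
by apply: ann_tail_le _ (ctx_hgt Rm _ _ _ (tErr i' j)); rewrite leq_hgt.
Qed.

(** The induction quantifies over all contexts, since Psi(Y) is Y in the context enlarged by the
    pair a^dagger_0, a_0. Its annihilator gives the extra unit: [hgt d] of [van n None :: v] is
    [hgt d.+1 v]. *)
Lemma wbdefect_ann_tail T kappa M d (V : finType) (x : V) (C : (V -> R) -> R[i]) u v i j l :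
  YBE_entries -> intertwines T kappa M -> (d <= M)%N ->
  ann_tail (hgt d v) (wbdefect T kappa x C u v i j l).
Proof.
move=> YB Tint; elim: d V x C u v i j l => [|d IHd] V x C u v i j l dM.
  have all0 (P : seq mon) : all (fun m : mon => 0 <= hgt 0 (mword m))%N P by elim: P.
  apply: ann_tail_add; first exact: (ctx_hgt Rm C u (vcr l x :: v) (all0 (T i j))).
  apply: ann_tail_opp; apply: ann_tail_sum => i' _; apply: ann_tail_sum => l' _.
  exact: ctx_hgt.
apply: (@ann_tail_step _ _ _ _ _ 1 _ _ _ _ _ (numop_wbdefect _ _ _ _ _ _ _ _ _)).
- by rewrite addn1.
- exact: (IHd _ _ _ _ _ _ _ _ (ltnW dM)).
rewrite scale1r -[X in ann_tail _ X](subrK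
  (\sum_m \sum_i' \sum_m' \sum_n \sum_l'
        wbdefect T kappa (Some x)
          (fun k : option V -> R => C (k \o Some) * Rent kappa (k None) i m i' m' *
             Rent (k None) (k (Some x)) m' l' n l)
          (map (vren Some) u ++ [:: vcr m None]) (van n None :: map (vren Some) v)
          i' j l')).
apply: ann_tail_add.
  by apply: ann_tail_le _ (wbdefect_rec _ _ _ _ _ _ _ YB Tint); rewrite leq_hgt.
apply: ann_tail_sum => m _; apply: ann_tail_sum => i' _; apply: ann_tail_sum => m' _.
apply: ann_tail_sum => n _; apply: ann_tail_sum => l' _.
by rewrite -(hgt_ren Some); exact: (IHd _ _ _ _ (van n None :: map (vren Some) v) _ _ _ (ltnW dM)).
Qed.

End WellBred.

(** * The FRT relations in context *)

Section Products.
Variables (R : realType) (N : nat) (Rm : Rmatrix R N).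
Local Notation ZF := (ZF Rm).
Local Notation zV := (@zV R N Rm _).
Local Notation ctx P := (@ctx R N Rm P _).
Local Notation ctxnum P := (@ctxnum R N Rm P _).
Local Notation mon := (mon R N).
Local Notation Rent := (Rent Rm).

Section Intertwine.
Variables (M : nat) (TA TB : 'I_N -> 'I_N -> seq mon) (kA kB : R).
Hypotheses (YB : YBE_entries Rm) (iA : intertwines Rm TA kA M) (iB : intertwines Rm TB kB M).
(** Satisfied by the words of a normally ordered term: at most n annihilators are lost to its
    creators and n are gained afterwards. A bound for [TA] thus survives the words of [TB] on its
    right. *)
Hypothesis hB : forall i j, all (fun m : mon => M <= hgt M (mword m))%N (TB i j).

(** Relation (1) for the right factor puts a^dagger_0 between the factors; moving it to the front
    costs a [wbdefect] of the left factor and brings in the second R-matrix. *)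
Lemma ctxnum_pmul_intertwines (V : finType) (C : (V -> R) -> R[i]) u v a b c d :
  ann_tail (hgt M v)
   (ctxnum (pmul (TA a c) (TB b d)) C u v -
    \sum_m \sum_b' \sum_m' \sum_a' \sum_l
      ctx (pmul (TA a' c) (TB b' d))
        (fun k : option V -> R => C (k \o Some) * Rent kB (k None) b m b' m' *
             Rent kA (k None) a l a' m)
        (map (vren Some) u ++ [:: vcr l None]) (van m' None :: map (vren Some) v)).
Proof.
have [ErrB tErrB relB] := iB.
rewrite ctxnum_pmul; under eq_bigr do rewrite relB.
rewrite big_split /= addrAC; apply: ann_tail_add; last first.
  apply: ann_tail_sum => m _; apply: ann_tail_le (ctx_hgt Rm _ _ _ (tErrB _ _)).
  by rewrite hgt_ren leq_hgt.
rewrite exchange_big /=; under eq_bigr do rewrite exchange_big /=.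
under eq_bigr do under eq_bigr do rewrite exchange_big /=.
rewrite -sumrB; apply: ann_tail_sum => m _.
rewrite -sumrB; apply: ann_tail_sum => b' _.
rewrite -sumrB; apply: ann_tail_sum => m' _.
rewrite (ctx_pmul_split Rm _ _ C (fun k0 => Rent kB k0 b m b' m')).
under [X in _ - X]eq_bigr do under eq_bigr do rewrite ctx_mulr.
under [X in _ - X]eq_bigr do rewrite exchange_big /=.
rewrite [X in _ - X]exchange_big /= -sumrB.
apply: (ann_tail_sum_all (hB b' d)) => w wM.
set v' := map (vren inr) _ ++ _.
have := @wbdefect_ann_tail _ _ _ _ _ _ M _ (inl None)
  (fun k : option V + 'I_(mdim w) -> R =>
           C ((k \o inl) \o Some) * Rent kB (k (inl None)) b m b' m' *
           mcoef (k \o inr))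
  (map (vren inl) (map (vren Some) u)) v' a c m YB iA (leqnn M).
rewrite /wbdefect; set S := \sum_i' _; set S' := \sum_i _.
have -> : S = S'.
  apply: eq_bigr => a' _; apply: eq_bigr => l _.
  by rewrite map_cat; apply: eq_ctx => k; rewrite mulrAC.
apply: ann_tail_le; rewrite /v' hgt_cat hgt_ren /= !hgt_ren leq_hgt //.
by rewrite (leq_trans wM) // leqW.
Qed.

End Intertwine.

Lemma ctx_pmul_vacuum (P P' Q Q' : seq mon) (p q : R[i]) :
  (forall (V : finType) (C : (V -> R) -> R[i]) u v,
     ctx P C u v = p *: zV C (u ++ v) + ctx P' C u v) ->
  (forall (V : finType) (C : (V -> R) -> R[i]) u v,
     ctx Q C u v = q *: zV C (u ++ v) + ctx Q' C u v) ->
  all (fun m : mon => 0 < hgt 0 (mword m))%N P' ->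
  all (fun m : mon => 0 < hgt 0 (mword m))%N Q' ->
  forall (V : finType) (C : (V -> R) -> R[i]) u v,
  ann_tail (hgt 1 v) (ctx (pmul P Q) C u v - (p * q) *: zV C (u ++ v)).
Proof.
move=> PE QE tP tQ V C u v; rewrite ctx_mull.
under eq_bigr do rewrite QE.
rewrite big_split /= -scaler_sumr.
have -> : \sum_(m <- P)
    zV (fun k : V + 'I_(mdim m) -> R => C (k \o inl) * mcoef (k \o inr))
       ((map (vren inl) u ++ map (vren inr) (mword m)) ++ map (vren inl) v) = ctx P C u v.
  by apply: eq_bigr => m _; rewrite catA.
rewrite PE scalerDr scalerA mulrC addrAC [X in X + _]addrAC subrr add0r.
apply: ann_tail_add; first by apply: ann_tail_scale; exact: (ctx_hgt Rm _ _ _ tP).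
by apply: ann_tail_sum => m _; rewrite -(hgt_ren (@inl V 'I_(mdim m))); exact: (ctx_hgt Rm _ _ _ tQ).
Qed.

Section FRTContext.
Variables (M : nat) (T1 T2 T1' T2' : 'I_N -> 'I_N -> seq mon) (k1 k2 : R).
Hypotheses (YB : YBE_entries Rm).
Hypotheses (i1 : intertwines Rm T1 k1 M) (i2 : intertwines Rm T2 k2 M).
Hypothesis h1 : forall i j, all (fun m : mon => M <= hgt M (mword m))%N (T1 i j).
Hypothesis h2 : forall i j, all (fun m : mon => M <= hgt M (mword m))%N (T2 i j).
Hypothesis E1 : forall i j (V : finType) (C : (V -> R) -> R[i]) u v,
  ctx (T1 i j) C u v = (i == j)%:R *: zV C (u ++ v) + ctx (T1' i j) C u v.
Hypothesis E2 : forall i j (V : finType) (C : (V -> R) -> R[i]) u v,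
  ctx (T2 i j) C u v = (i == j)%:R *: zV C (u ++ v) + ctx (T2' i j) C u v.
Hypothesis h1' : forall i j, all (fun m : mon => 0 < hgt 0 (mword m))%N (T1' i j).
Hypothesis h2' : forall i j, all (fun m : mon => 0 < hgt 0 (mword m))%N (T2' i j).

(* an entry of [R_12 T_1 T_2 - T_2 T_1 R_12] *)
Definition FRTdefect (V : finType) (C : (V -> R) -> R[i]) u v a b c d : ZF :=
  \sum_x \sum_y Rent k1 k2 a b x y *: ctx (pmul (T1 x c) (T2 y d)) C u v -
  \sum_x \sum_y Rent k1 k2 x y c d *: ctx (pmul (T2 b y) (T1 a x)) C u v.

Definition FRTdefect_num (V : finType) (C : (V -> R) -> R[i]) u v a b c d : ZF :=
  \sum_x \sum_y Rent k1 k2 a b x y *: ctxnum (pmul (T1 x c) (T2 y d)) C u v -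
  \sum_x \sum_y Rent k1 k2 x y c d *: ctxnum (pmul (T2 b y) (T1 a x)) C u v.

Lemma numop_FRTdefect (V : finType) (C : (V -> R) -> R[i]) u v a b c d :
  FRTdefect C u v a b c d * numop Rm = FRTdefect_num C u v a b c d +
    ((nann v)%:R - (ncre v)%:R) *: FRTdefect C u v a b c d.
Proof.
have numS (A : 'I_N -> 'I_N -> R[i]) (P : 'I_N -> 'I_N -> seq mon) :
    (\sum_x \sum_y A x y *: ctx (P x y) C u v) * numop Rm =
    \sum_x \sum_y A x y *: ctxnum (P x y) C u v +
    ((nann v)%:R - (ncre v)%:R) *: \sum_x \sum_y A x y *: ctx (P x y) C u v.
  rewrite mulr_suml scaler_sumr -big_split; apply: eq_bigr => x _ /=.
  rewrite mulr_suml scaler_sumr -big_split; apply: eq_bigr => y _ /=.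
  by rewrite -scalerAl ctx_numop scalerDr !scalerA [in RHS]mulrC.
by rewrite /FRTdefect mulrBl !numS opprD addrACA -scalerBr.
Qed.

(** With s = 0 the induction step would divide by zero at d = 0, so the induction starts here, from
    the identity terms of the two factors. *)
Lemma FRTdefect1 (V : finType) (C : (V -> R) -> R[i]) u v a b c d :
  ann_tail (hgt 1 v) (FRTdefect C u v a b c d).
Proof.
have key (A : 'I_N -> 'I_N -> R[i]) (P : 'I_N -> 'I_N -> seq mon) (D : 'I_N -> 'I_N -> R[i]) r :
    (forall x y, ann_tail (hgt 1 v) (ctx (P x y) C u v - D x y *: zV C (u ++ v))) ->
    \sum_x \sum_y A x y * D x y = r ->
    ann_tail (hgt 1 v) (\sum_x \sum_y A x y *: ctx (P x y) C u v - r *: zV C (u ++ v)).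
  move=> tP <-; rewrite scaler_suml -sumrB; apply: ann_tail_sum => x _.
  rewrite scaler_suml -sumrB; apply: ann_tail_sum => y _.
  by rewrite -scalerA -scalerBr; apply: ann_tail_scale.
rewrite /FRTdefect -(subrKA (Rent k1 k2 a b c d *: zV C (u ++ v))).
apply: ann_tail_add.
  apply: (key (fun x y => Rent k1 k2 a b x y) _ (fun x y => (x == c)%:R * (y == d)%:R)).
    by move=> x y; exact: (ctx_pmul_vacuum (E1 x c) (E2 y d) (h1' x c) (h2' y d)).
  rewrite (bigD1 c) //= (bigD1 d) //= !eqxx !mulr1.
  rewrite big1 ?addr0 => [|y /negbTE ->]; last by rewrite !mulr0.
  rewrite big1 ?addr0 // => x /negbTE ->.
  by rewrite big1 // => y _; rewrite mul0r mulr0.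
rewrite -opprB; apply: ann_tail_opp.
apply: (key (fun x y => Rent k1 k2 x y c d) _ (fun x y => (b == y)%:R * (a == x)%:R)).
  by move=> x y; exact: (ctx_pmul_vacuum (E2 b y) (E1 a x) (h2' b y) (h1' a x)).
rewrite (bigD1 a) //= (bigD1 b) //= !eqxx !mulr1.
rewrite big1 ?addr0 => [|y]; last by rewrite eq_sym => /negbTE ->; rewrite mul0r mulr0.
rewrite big1 ?addr0 // => x; rewrite eq_sym => /negbTE ->.
by rewrite big1 // => y _; rewrite !mulr0.
Qed.

(** For T_2 T_1 the outer pair brings in R_20 R_10, and for T_1 T_2 it brings in R_10 R_20. The
    Yang-Baxter equation R_12 R_10 R_20 = R_20 R_10 R_12 moves R_12 next to T_1 T_2, so that R_20
    R_10 becomes a common factor and the defect reappears behind it. *)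
Lemma FRTdefect_rec (V : finType) (C : (V -> R) -> R[i]) u v a b c d :
  ann_tail (hgt M v)
   (FRTdefect_num C u v a b c d -
    \sum_l \sum_a' \sum_b' \sum_n
      FRTdefect (fun k : option V -> R => C (k \o Some) *
          \sum_m Rent k2 (k None) b l b' m * Rent k1 (k None) a m a' n)
        (map (vren Some) u ++ [:: vcr l None]) (van n None :: map (vren Some) v)
        a' b' c d).
Proof.
set Z := \sum_l _.
pose F P (l n : 'I_N) (K : R -> R[i]) :=
  ctx P (fun k : option V -> R => C (k \o Some) * K (k None))
    (map (vren Some) u ++ [:: vcr l None]) (van n None :: map (vren Some) v).
pose S12 x y := \sum_m \sum_b' \sum_n \sum_a' \sum_l F (pmul (T1 a' c) (T2 b' d)) l n
  (fun k0 => Rent k2 k0 y m b' n * Rent k1 k0 x l a' m).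
pose S21 x y := \sum_m \sum_a' \sum_n \sum_b' \sum_l F (pmul (T2 b' y) (T1 a' x)) l n
  (fun k0 => Rent k1 k0 a m a' n * Rent k2 k0 b l b' m).
have t12 x y : ann_tail (hgt M v) (ctxnum (pmul (T1 x c) (T2 y d)) C u v - S12 x y).
  have := ctxnum_pmul_intertwines YB i1 i2 h2 C u v x y c d.
  congr (ann_tail _ (_ - _)); do 5![apply: eq_bigr => ? _].
  by apply: eq_ctx => k; rewrite mulrA.
have t21 x y : ann_tail (hgt M v) (ctxnum (pmul (T2 b y) (T1 a x)) C u v - S21 x y).
  have := ctxnum_pmul_intertwines YB i2 i1 h1 C u v b a y x.
  congr (ann_tail _ (_ - _)); do 5![apply: eq_bigr => ? _].
  by apply: eq_ctx => k; rewrite mulrA.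
suff -> : Z = \sum_x \sum_y Rent k1 k2 a b x y *: S12 x y -
             \sum_x \sum_y Rent k1 k2 x y c d *: S21 x y.
  rewrite opprD opprK addrACA; apply: ann_tail_add.
    rewrite -sumrB; apply: ann_tail_sum => x _; rewrite -sumrB.
    by apply: ann_tail_sum => y _; rewrite -scalerBr; apply: ann_tail_scale.
  rewrite addrC -opprB; apply: ann_tail_opp.
  rewrite -sumrB; apply: ann_tail_sum => x _; rewrite -sumrB.
  by apply: ann_tail_sum => y _; rewrite -scalerBr; apply: ann_tail_scale.
have FZ P l n A (K : R -> R[i]) : A *: F P l n K = F P l n (fun k0 => A * K k0).
  by rewrite /F -ctxZ; apply: eq_ctx => k; rewrite mulrCA.
have FS P l n (K : 'I_N -> R -> R[i]) : F P l n (fun k0 => \sum_m K m k0) = \sum_m F P l n (K m).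
  by rewrite /F -ctx_sum; apply: eq_ctx => k; rewrite mulr_sumr.
have -> : Z = (\sum_l \sum_a' \sum_b' \sum_n \sum_x \sum_y \sum_m
     F (pmul (T1 x c) (T2 y d)) l n
       (fun k0 => Rent k2 k0 b l b' m * Rent k1 k0 a m a' n * Rent k1 k2 a' b' x y)) -
   \sum_l \sum_a' \sum_b' \sum_n \sum_x \sum_y \sum_m
     F (pmul (T2 b' y) (T1 a' x)) l n
       (fun k0 => Rent k1 k2 x y c d * (Rent k2 k0 b l b' m * Rent k1 k0 a m a' n)).
  rewrite -sumrB; apply: eq_bigr => l _; rewrite -sumrB; apply: eq_bigr => a' _.
  rewrite -sumrB; apply: eq_bigr => b' _; rewrite -sumrB; apply: eq_bigr => n _.
  rewrite /FRTdefect; congr (_ - _); apply: eq_bigr => x _; apply: eq_bigr => y _.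
    rewrite -[ctx _ _ _ _]/(F _ l n (fun k0 => \sum_m Rent k2 k0 b l b' m * Rent k1 k0 a m a' n)).
    rewrite FZ -FS; congr F; apply: funext => k0.
    by rewrite mulr_sumr; apply: eq_bigr => m _; rewrite mulrC.
  rewrite -[ctx _ _ _ _]/(F _ l n (fun k0 => \sum_m Rent k2 k0 b l b' m * Rent k1 k0 a m a' n)).
  by rewrite FZ -FS; congr F; apply: funext => k0; rewrite mulr_sumr.
congr (_ - _); last first.
  rewrite sum7_perm21; apply: eq_bigr => x _; apply: eq_bigr => y _.
  rewrite scaler_sum5; do 5![apply: eq_bigr => ? _].
  by rewrite FZ; congr F; apply: funext => k0; rewrite [X in _ * X]mulrC.
rewrite sum7_perm12.
under [RHS]eq_bigr do under eq_bigr do rewrite scaler_sum5.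
rewrite [RHS]sum7_perm12'; apply: eq_bigr => a' _; apply: eq_bigr => b' _.
apply: eq_bigr => l _; apply: eq_bigr => n _.
under eq_bigr do under eq_bigr do rewrite -FS.
under eq_bigr do rewrite -FS.
under [RHS]eq_bigr do under eq_bigr do under eq_bigr do rewrite FZ.
under [RHS]eq_bigr do under eq_bigr do rewrite -FS.
under [RHS]eq_bigr do rewrite -FS.
rewrite -!FS; congr F; apply: funext => k0.
rewrite -YB; do 3![apply: eq_bigr => ? _].
by rewrite -mulrA [Rent k2 _ _ _ _ _ * _]mulrC.
Qed.

Lemma FRTdefect_ann_tail d (V : finType) (C : (V -> R) -> R[i]) u v a b c e :
  (0 < d <= M)%N -> ann_tail (hgt d v) (FRTdefect C u v a b c e).
Proof.
elim: d V C u v a b c e => // -[|d] IHd V C u v a b c e; first by move=> _; exact: FRTdefect1.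
move=> /andP[_ dM].
apply: (@ann_tail_step _ _ _ _ _ 0 _ _ _ _ _ (numop_FRTdefect _ _ _ _ _ _ _)) => //.
  exact: (IHd _ _ _ _ _ _ _ _ (ltnW dM)).
rewrite scale0r addr0 -[X in ann_tail _ X](subrK (\sum_l \sum_a' \sum_b' \sum_n
      FRTdefect (fun k : option V -> R => C (k \o Some) *
          \sum_m Rent k2 (k None) b l b' m * Rent k1 (k None) a m a' n)
        (map (vren Some) u ++ [:: vcr l None]) (van n None :: map (vren Some) v)
        a' b' c e)).
apply: ann_tail_add; first by apply: ann_tail_le _ (FRTdefect_rec _ _ _ _ _ _ _); rewrite leq_hgt.
apply: ann_tail_sum => l _; apply: ann_tail_sum => a' _; apply: ann_tail_sum => b' _.
apply: ann_tail_sum => n _; rewrite -(hgt_ren Some).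
exact: (IHd _ _ _ (van n None :: map (vren Some) v) _ _ _ _ (ltnW dM)).
Qed.

End FRTContext.
End Products.

(** * R-matrices acting on words *)

Section Tensors.
Variables (N : nat).

Lemma tent_tmx (A : Type) (L : finType) (X : tidx N L -> tidx N L -> A) f g :
  tent (tmx X) f g = X f g.
Proof. by rewrite /tent mxE !enum_rankK. Qed.

Lemma tentP (A : Type) (L : finType) (X Y : tend N A L) :
  (forall f g, tent X f g = tent Y f g) -> X = Y.
Proof.
by move=> XY; apply/matrixP => x y; have := XY (enum_val x) (enum_val y); rewrite /tent !enum_valK.
Qed.

Lemma tentM (A : pzSemiRingType) (L : finType) (X Y : tend N A L) f g :
  tent (X *m Y) f g = \sum_h tent X f h * tent Y h g.
Proof.
by rewrite /tent mxE (reindex _ (onW_bij _ (@enum_rank_bij _))).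
Qed.

Lemma tent1 (A : pzSemiRingType) (L : finType) f g :
  tent (1%:M : tend N A L) f g = (f == g)%:R.
Proof. by rewrite /tent mxE (inj_eq (@enum_rank_inj _)). Qed.

Lemma tentD (A : nmodType) (L : finType) (X Y : tend N A L) f g :
  tent (X + Y) f g = tent X f g + tent Y f g.
Proof. by rewrite /tent mxE. Qed.

Lemma tentZ (A : pzRingType) (L : finType) a (X : tend N A L) f g :
  tent (a *: X) f g = a * tent X f g.
Proof. by rewrite /tent mxE. Qed.

Lemma tent_sum (A : nmodType) (L : finType) (I : Type) (r : seq I) (P : pred I)
    (X : I -> tend N A L) f g :
  tent (\sum_(i <- r | P i) X i) f g = \sum_(i <- r | P i) tent (X i) f g.
Proof. by rewrite /tent summxE. Qed.

(** Used to fix the index of infinity: an entry (i, j) becomes a sum over all multi-indices, on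
    which full matrix products can act. *)
Definition tproj (A : pzSemiRingType) (L : finType) (l : L) (i : 'I_N) : tend N A L :=
  tmx (fun f g => ((f == g) && (f l == i))%:R).

Lemma tent_projl (A : pzSemiRingType) (L : finType) (l : L) i (X : tend N A L) f g :
  tent (tproj A l i *m X) f g = (f l == i)%:R * tent X f g.
Proof.
rewrite tentM (bigD1 f) //= tent_tmx eqxx /= big1 ?addr0 // => h.
by rewrite eq_sym tent_tmx => /negbTE ->; rewrite mul0r.
Qed.

Lemma tent_projr (A : pzSemiRingType) (L : finType) (l : L) i (X : tend N A L) f g :
  tent (X *m tproj A l i) f g = tent X f g * (g l == i)%:R.
Proof.
rewrite tentM (bigD1 g) //= tent_tmx eqxx /= big1 ?addr0 // => h.
by rewrite tent_tmx => /negbTE ->; rewrite mulr0.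
Qed.

Definition upd2 (L : finType) (g : tidx N L) (a : L) (i : 'I_N) (b : L) (j : 'I_N) : tidx N L :=
  [ffun l => if l == a then i else if l == b then j else g l].

Definition agree_off (L : finType) (a b : L) (f g : tidx N L) : bool :=
  [forall l, (l != a) ==> (l != b) ==> (f l == g l)].

Lemma sum_upd2 (Z : nmodType) (L : finType) (a b : L) (g : tidx N L) (F : tidx N L -> Z) :
  a != b -> (forall g', ~~ agree_off a b g g' -> F g' = 0) ->
  \sum_g' F g' = \sum_i \sum_j F (upd2 g a i b j).
Proof.
move=> ab F0; rewrite pair_bigA /=.
rewrite (bigID (agree_off a b g)) /= [X in _ + X]big1 // addr0.
rewrite (reindex_onto (fun p : 'I_N * 'I_N => upd2 g a p.1 b p.2) (fun h => (h a, h b))) /=.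
  apply: eq_bigl => -[i j] /=; rewrite !ffunE !eqxx [b == a]eq_sym (negbTE ab) eqxx andbT.
  apply/forallP => l; apply/implyP => /negbTE la; apply/implyP => /negbTE lb.
  by rewrite ffunE la lb.
move=> h /forallP gh; apply/ffunP => l; rewrite ffunE.
case: eqVneq => [->//|la]; case: eqVneq => [->//|lb].
by have := gh l; rewrite la lb => /eqP.
Qed.

Lemma agree_off_upd2 (L : finType) (a b : L) (g : tidx N L) i j :
  agree_off a b g (upd2 g a i b j).
Proof.
apply/forallP => l; apply/implyP => /negbTE la; apply/implyP => /negbTE lb.
by rewrite ffunE la lb.
Qed.

Lemma agree_offC (L : finType) (a b : L) (f g : tidx N L) : agree_off a b f g = agree_off a b g f.
Proof. by apply: eq_forallb => l; rewrite [f l == _]eq_sym. Qed.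

Lemma agree_off_swap (L : finType) (a b : L) (f g : tidx N L) : agree_off a b f g = agree_off b a f g.
Proof. by apply: eq_forallb => l; case: (l != a); case: (l != b). Qed.

Lemma agree_off_upd2l (L : finType) (a b : L) (f g : tidx N L) i j :
  agree_off a b (upd2 f a i b j) g = agree_off a b f g.
Proof.
apply: eq_forallb => l; rewrite ffunE.
by case: eqVneq => //= _; case: eqVneq.
Qed.

Lemma upd2a (L : finType) (g : tidx N L) a i b j : upd2 g a i b j a = i.
Proof. by rewrite ffunE eqxx. Qed.

Lemma upd2b (L : finType) (g : tidx N L) a i b j : a != b -> upd2 g a i b j b = j.
Proof. by move=> ab; rewrite ffunE [b == a]eq_sym (negbTE ab) eqxx. Qed.

Lemma upd2_off (L : finType) (g : tidx N L) a i b j l :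
  l != a -> l != b -> upd2 g a i b j l = g l.
Proof. by move=> /negbTE la /negbTE lb; rewrite ffunE la lb. Qed.

End Tensors.

(** * R-matrices on labelled copies of V; the Yang-Baxter equation in entries *)

Section RLegs.
Variables (R : realType) (N : nat) (Rm : Rmatrix R N).
Local Notation Rent := (Rent Rm).
Local Notation Rleg := (Rleg Rm).

Lemma tent_Rleg (L : finType) (k : L -> R) (a b : L) f g : a != b ->
  tent (Rleg k a b) f g =
  if agree_off a b f g then Rent (k a) (k b) (f a) (f b) (g a) (g b) else 0.
Proof.
move=> ab; rewrite /Rleg /embed tent_tmx.
have -> : [forall l, (l \notin codom (pair2 a b)) ==> (f l == g l)] = agree_off a b f g.
  apply: eq_forallb => l; have -> : (l \notin codom (pair2 a b)) = (l != a) && (l != b).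
    rewrite -negb_or; congr (~~ _); apply/codomP/orP => [[i ->]|[/eqP ->|/eqP ->]].
    - by rewrite /pair2; case: ifP; rewrite eqxx; [left|right].
    - by exists ord0.
    - by exists ord_max.
  by case: (l != a); case: (l != b).
case: ifP => // _; rewrite /Rent; congr tent; apply/ffunP => i; rewrite !ffunE /pair2;
  by case: ifP.
Qed.

Lemma sum_Rleg (Z : nmodType) (L : finType) (k : L -> R) (a b : L) g (F : R[i] -> tidx N L -> Z) :
  a != b -> (forall g', F 0 g' = 0) ->
  \sum_g' F (tent (Rleg k a b) g g') g' =
  \sum_i \sum_j F (Rent (k a) (k b) (g a) (g b) i j) (upd2 g a i b j).
Proof.
move=> ab F0; rewrite (sum_upd2 (g := g) ab) => [|g' ag].
  apply: eq_bigr => i _; apply: eq_bigr => j _.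
  by rewrite tent_Rleg // agree_off_upd2 upd2a upd2b.
by rewrite tent_Rleg // (negbTE ag) F0.
Qed.

Let o0 := @Ordinal 3 0 isT.
Let o1 := @Ordinal 3 1 isT.
Let o2 := @Ordinal 3 2 isT.

Definition tri (a b c : 'I_N) : tidx N 'I_3 := [ffun i : 'I_3 => nth a [:: a; b; c] i].

Lemma triE (a b c : 'I_N) : (tri a b c o0 = a) * (tri a b c o1 = b) * (tri a b c o2 = c).
Proof. by rewrite !ffunE. Qed.

Lemma upd2_tri a b c x y :
  (upd2 (tri a b c) o0 x o1 y = tri x y c) * (upd2 (tri a b c) o0 x o2 y = tri x b y) *
  (upd2 (tri a b c) o1 x o2 y = tri a x y).
Proof.
by do !split; apply/ffunP => -[[|[|[|//]]] ?]; rewrite !ffunE.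
Qed.

Lemma agree_off_tri a b c a' b' c' :
  (agree_off o0 o1 (tri a b c) (tri a' b' c') = (c == c')) *
  (agree_off o1 o2 (tri a b c) (tri a' b' c') = (a == a')).
Proof.
split; apply/forallP/idP => [H|/eqP e].
- by have := H o2; rewrite !triE.
- by move=> -[[|[|[|//]]] ?]; apply/implyP => // _; apply/implyP => // _; rewrite !ffunE /= e.
- by have := H o0; rewrite !triE.
by move=> -[[|[|[|//]]] ?]; apply/implyP => // _; apply/implyP => // _; rewrite !ffunE /= e.
Qed.

Lemma YBE_entriesP : Yang_Baxter Rm -> YBE_entries Rm.
Proof.
move=> YB k1 k2 k3 a b c a' b' c'.
pose k (i : 'I_3) := nth k1 [:: k1; k2; k3] i.
have /(congr1 (fun X => tent X (tri a b c) (tri a' b' c'))) := YB k.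
rewrite /= -!/o0 -!/o1 -!/o2 -!mulmxA.
rewrite !tentM.
rewrite (@sum_Rleg _ _ _ _ _ _ (fun z h => z * tent _ h _)) // => [|g]; last by rewrite mul0r.
rewrite (@sum_Rleg _ _ _ _ _ _ (fun z h => z * tent _ h _)) // => [|g]; last by rewrite mul0r.
rewrite !triE => YBe; apply: etrans (etrans YBe _).
  apply: eq_bigr => x _; apply: eq_bigr => y _.
  rewrite upd2_tri tentM (@sum_Rleg _ _ _ _ _ _ (fun z h => z * tent _ h _)) // => [|g]; last by rewrite mul0r.
  rewrite !triE /= [X in _ = _ * X](bigD1 a') //= [X in _ = _ * (_ + X)]big1 ?addr0 => [|x' xa]; last first.
    by rewrite big1 // => z _; rewrite upd2_tri tent_Rleg // agree_off_tri (negbTE xa) mulr0.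
  rewrite mulr_sumr; apply: eq_bigr => z _.
  by rewrite upd2_tri tent_Rleg // agree_off_tri eqxx !triE mulrA.
rewrite [RHS]exchange_big; apply: eq_bigr => y _ /=.
rewrite [RHS]exchange_big; apply: eq_bigr => z _ /=.
rewrite upd2_tri tentM (@sum_Rleg _ _ _ _ _ _ (fun z h => z * tent _ h _)) // => [|g]; last by rewrite mul0r.
rewrite !triE /= mulr_sumr; apply: eq_bigr => x _.
rewrite (bigD1 c') //= big1 ?addr0 => [|z' zc]; last first.
  by rewrite upd2_tri tent_Rleg // agree_off_tri (negbTE zc) mulr0.
by rewrite upd2_tri tent_Rleg // agree_off_tri eqxx !triE mulrA.
Qed.

End RLegs.

(** * Unitarity, and reordering of words by products of R-matrices *)

Section Routes.
Variables (R : realType) (N : nat) (Rm : Rmatrix R N).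
Local Notation vl := (vletter N).
Local Notation zV := (@zV R N Rm _).
Local Notation Rent := (Rent Rm).
Local Notation Rleg := (Rleg Rm).
Local Notation Rroute := (Rroute Rm).

Definition unit_entries : Prop := forall (k1 k2 : R) (a b c d : 'I_N),
  \sum_x \sum_y Rent k1 k2 a b x y * Rent k2 k1 y x d c = ((a == c) && (b == d))%:R.

Lemma unit_entriesP : unitarity Rm -> unit_entries.
Proof.
move=> U k1 k2 a b c d.
pose o0 := @Ordinal 2 0 isT; pose o1 := @Ordinal 2 1 isT.
pose k (i : 'I_2) := nth k1 [:: k1; k2] i.
pose duo (x y : 'I_N) : tidx N 'I_2 := [ffun i : 'I_2 => nth x [:: x; y] i].
have /(congr1 (fun X => tent X (duo a b) (duo c d))) := U k.
rewrite /= -/o0 -/o1 tentM tent1.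
rewrite (@sum_Rleg _ _ _ _ _ _ _ _ _ (fun z h => z * tent _ h _)) // => [|g]; last by rewrite mul0r.
have agree f g : agree_off o1 o0 f g by apply/forallP => -[[|[|//]] ?]; apply/implyP => // _; apply/implyP.
move=> H; apply: etrans (etrans H _).
  apply: eq_bigr => x _; apply: eq_bigr => y _.
  by rewrite tent_Rleg // agree upd2a upd2b // !ffunE.
congr (_%:R); congr nat_of_bool; apply/eqP/andP => [/ffunP e|[/eqP -> /eqP ->] //].
by have := e o0; have := e o1; rewrite !ffunE /= => -> ->.
Qed.

Hypothesis UE : unit_entries.

Lemma Rleg_mulV (L : finType) (k : L -> R) (a b : L) :
  a != b -> Rleg k a b *m Rleg k b a = 1%:M.
Proof.
move=> ab; apply: tentP => f g; rewrite tentM tent1.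
rewrite (@sum_Rleg _ _ _ _ _ _ _ _ _ (fun z h => z * tent _ h _)) // => [|h]; last by rewrite mul0r.
under eq_bigr do under eq_bigr do
  rewrite tent_Rleg 1?eq_sym // -agree_off_swap agree_off_upd2l upd2a upd2b //.
have [fg|fg] := boolP (agree_off a b f g).
  rewrite UE; congr (_%:R); congr nat_of_bool; apply/andP/eqP => [[/eqP fa /eqP fb]|-> //].
  apply/ffunP => l; have [->//|la] := eqVneq l a; have [->//|lb] := eqVneq l b.
  by have := forallP fg l; rewrite la lb => /eqP.
rewrite big1 => [|x _]; last by rewrite big1 // => y _; rewrite mulr0.
case: eqP => // fg'; case/negP: fg; rewrite fg'.
by apply/forallP => l; rewrite eqxx !implybT.
Qed.

Lemma Rleg_unit (L : finType) (k : L -> R) (a b : L) : a != b -> Rleg k a b \in unitmx.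
Proof. by move=> ab; case: (mulmx1_unit (Rleg_mulV k ab)). Qed.

Lemma Rleg_proj (L : finType) (k : L -> R) (a b l : L) i :
  a != b -> l != a -> l != b ->
  tproj _ l i *m Rleg k a b = Rleg k a b *m tproj _ l i.
Proof.
move=> ab la lb; apply: tentP => f g; rewrite tent_projl tent_projr tent_Rleg //.
case: ifP => [/forallP fg|_]; last by rewrite mulr0 mul0r.
by have := fg l; rewrite la lb /= => /eqP ->; rewrite mulrC.
Qed.

Section Fixed.
(** [kap] is kept apart from [var] because infinity has a spectral parameter but no integration
    variable; the two only have to agree on the letters of the words. *)
Variables (V L : finType) (var : L -> V) (l0 : L) (kap : (V -> R) -> L -> R).

Definition annw (g : tidx N L) (s : seq L) : seq (vl V) := [seq van (g l) (var l) | l <- s].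
Definition crew (g : tidx N L) (s : seq L) : seq (vl V) := rev [seq vcr (g l) (var l) | l <- s].

(* [M] is a product of R-matrices with [a_w = M a_s] and
   [a^dagger_{rev w} M = a^dagger_{rev s}] *)
Record routes (M : (V -> R) -> tend N R[i] L) (s w : seq L) : Prop := Routes {
  routes_ann : forall (C : (V -> R) -> R[i]) u v g,
    \sum_g' zV (fun k => C k * tent (M k) g g') (u ++ annw g' s ++ v) =
    zV C (u ++ annw g w ++ v);
  routes_cre : forall (C : (V -> R) -> R[i]) u v f,
    \sum_f' zV (fun k => C k * tent (M k) f' f) (u ++ crew f' w ++ v) =
    zV C (u ++ crew f s ++ v);
  routes_unit : forall k, M k \in unitmx;
  routes_proj : forall k i, tproj _ l0 i *m M k = M k *m tproj _ l0 i }.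

Lemma routes1 s : routes (fun=> 1%:M) s s.
Proof.
split.
- move=> C u v g; rewrite (bigD1 g) //= big1 ?addr0.
    by apply: eq_zV => // k; rewrite tent1 eqxx mulr1.
  move=> h hg; rewrite -(zV0 Rm (u ++ annw h s ++ v)); apply: eq_zV => // k.
  by rewrite tent1 eq_sym (negbTE hg) mulr0.
- move=> C u v g; rewrite (bigD1 g) //= big1 ?addr0.
    by apply: eq_zV => // k; rewrite tent1 eqxx mulr1.
  move=> h hg; rewrite -(zV0 Rm (u ++ crew h s ++ v)); apply: eq_zV => // k.
  by rewrite tent1 (negbTE hg) mulr0.
- by move=> k; exact: unitmx1.
by move=> k i; rewrite mulmx1 mul1mx.
Qed.

Lemma routes_comp M1 M2 s s' s'' :
  routes M1 s s' -> routes M2 s' s'' -> routes (fun k => M2 k *m M1 k) s s''.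
Proof.
move=> [a1 c1 u1 p1] [a2 c2 u2 p2]; split.
- move=> C u v g; rewrite -a2.
  under [RHS]eq_bigr do rewrite -a1.
  rewrite exchange_big; apply: eq_bigr => h _ /=; rewrite -zV_sum; apply: eq_zV => // k.
  by rewrite tentM mulr_sumr; apply: eq_bigr => h' _; rewrite mulrA.
- move=> C u v g; rewrite -c1.
  under [RHS]eq_bigr do rewrite -c2.
  rewrite exchange_big; apply: eq_bigr => h _ /=; rewrite -zV_sum; apply: eq_zV => // k.
  by rewrite tentM mulr_sumr; apply: eq_bigr => h' _; rewrite -mulrA [_ * tent (M1 k) _ _]mulrC.
- by move=> k; rewrite unitmx_mul u1 u2.
by move=> k i; rewrite mulmxA p2 -!mulmxA p1.
Qed.

Lemma routes_swap s1 a b s2 :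
  uniq (l0 :: s1 ++ a :: b :: s2) ->
  (forall k, kap k a = k (var a)) -> (forall k, kap k b = k (var b)) ->
  routes (fun k => Rleg (kap k) a b) (s1 ++ a :: b :: s2) (s1 ++ b :: a :: s2).
Proof.
move=> us ka kb.
have ab : a != b.
  by move: us; rewrite cons_uniq cat_uniq => /and3P[_ _ /andP[_ /=]]; rewrite inE negb_or -andbA => /andP[].
have l0a : l0 != a.
  by move: us => /= /andP[]; rewrite mem_cat !inE !negb_or => /and4P[].
have l0b : l0 != b.
  by move: us => /= /andP[]; rewrite mem_cat !inE !negb_or => /and4P[].
have notin : {in s1 ++ s2, forall l, (l != a) && (l != b)}.
  move=> l; rewrite mem_cat; move: us; rewrite cons_uniq cat_uniq => /and3P[_ _].
  case/andP=> /hasPn sab /= /and3P[]; rewrite inE negb_or => /andP[_ as2] bs2 _.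
  case/orP=> ls.
    have := sab a; have := sab b; rewrite !inE !eqxx orbT /= => /(_ isT) bs1 /(_ isT) as1.
    by apply/andP; split; [apply: contraNneq as1 => <-|apply: contraNneq bs1 => <-].
  by apply/andP; split; [apply: contraNneq as2 => <-|apply: contraNneq bs2 => <-].
have offa g i j s : {subset s <= s1 ++ s2} -> annw (upd2 g a i b j) s = annw g s.
  move=> ss; apply/eq_in_map => l /ss /notin /andP[la lb]; by rewrite upd2_off.
have offc g i j s : {subset s <= s1 ++ s2} -> crew (upd2 g a i b j) s = crew g s.
  move=> ss; congr rev; apply/eq_in_map => l /ss /notin /andP[la lb]; by rewrite upd2_off.
have ss1 : {subset s1 <= s1 ++ s2} by move=> l; rewrite mem_cat => ->.
have ss2 : {subset s2 <= s1 ++ s2} by move=> l; rewrite mem_cat orbC => ->.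
split.
- move=> C u v g.
  have annE h x y : annw h (s1 ++ x :: y :: s2) =
      annw h s1 ++ van (h x) (var x) :: van (h y) (var y) :: annw h s2 by rewrite /annw map_cat.
  rewrite annE -catA catA /= zV_ann_ann.
  rewrite (sum_upd2 (g := g) ab) => [|g' ag]; last first.
    rewrite -[RHS](zV0 Rm (u ++ annw g' (s1 ++ a :: b :: s2) ++ v)).
    by apply: eq_zV => // k; rewrite tent_Rleg // (negbTE ag) mulr0.
  rewrite exchange_big; apply: eq_bigr => i _; apply: eq_bigr => j _ /=.
  apply: eq_zV => [k|]; first by rewrite tent_Rleg // agree_off_upd2 upd2a upd2b // ka kb.
  by rewrite annE !offa // upd2a upd2b // -!catA.
- move=> C u v g.
  have creE h x y : crew h (s1 ++ x :: y :: s2) =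
      crew h s2 ++ vcr (h y) (var y) :: vcr (h x) (var x) :: crew h s1.
    by rewrite /crew map_cat rev_cat !rev_cons -!cats1 -!catA.
  rewrite creE -catA catA /= zV_cre_cre.
  rewrite (sum_upd2 (g := g) ab) => [|g' ag]; last first.
    rewrite -[RHS](zV0 Rm (u ++ crew g' (s1 ++ b :: a :: s2) ++ v)).
    by apply: eq_zV => // k; rewrite tent_Rleg // agree_offC (negbTE ag) mulr0.
  rewrite exchange_big; apply: eq_bigr => i _; apply: eq_bigr => j _ /=.
  apply: eq_zV => [k|]; first by rewrite tent_Rleg // agree_offC agree_off_upd2 upd2a upd2b // ka kb.
  by rewrite creE !offc // upd2a upd2b // -!catA.
- by move=> k; exact: Rleg_unit.
by move=> k i; exact: Rleg_proj.
Qed.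

Lemma routes_front p ys x t :
  uniq (l0 :: p ++ ys ++ x :: t) ->
  {in ys ++ x :: t, forall l k, kap k l = k (var l)} ->
  routes (fun k => foldr (fun y M => Rleg (kap k) y x *m M) 1%:M ys)
    (p ++ ys ++ x :: t) (p ++ x :: ys ++ t).
Proof.
elim: ys p => [|y ys IHys] p us kE /=; first exact: routes1.
apply: (@routes_comp _ (fun k => Rleg (kap k) y x) _ (p ++ y :: x :: ys ++ t)).
  have := IHys (rcons p y); rewrite !cat_rcons; apply=> // l lys.
  by apply: kE; rewrite inE lys orbT.
apply: routes_swap.
- move: us; rewrite (perm_uniq (s2 := l0 :: p ++ y :: x :: ys ++ t)) //.
  by rewrite perm_cons perm_cat2l /= perm_cons perm_catC /= perm_cons perm_catC.
- by apply: kE; rewrite inE eqxx.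
by apply: kE; rewrite inE mem_cat inE eqxx !orbT.
Qed.

(** The prefix [p] collects the letters already brought into place, following the recursion of
    [Rroute]. *)
Lemma routes_Rroute p s w :
  uniq (l0 :: p ++ s) -> perm_eq s w -> {in s, forall l k, kap k l = k (var l)} ->
  routes (fun k => Rroute (kap k) s w) (p ++ s) (p ++ w).
Proof.
elim: w p s => [|x w IHw] p s us sw kE /=.
  by rewrite (perm_nilP sw); exact: routes1.
have xs : x \in s by rewrite (perm_mem sw) inE eqxx.
have sE := cat_take_drop (index x s) s.
have dE : drop (index x s) s = x :: drop (index x s).+1 s.
  by rewrite (drop_nth x) ?index_mem // nth_index.
have remE : rem x s = take (index x s) s ++ drop (index x s).+1 s by exact: remE.
have sE' : s = take (index x s) s ++ x :: drop (index x s).+1 s by rewrite -dE sE.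
apply: (@routes_comp (fun k => foldr (fun y M => Rleg (kap k) y x *m M) 1%:M (take (index x s) s))
  (fun k => Rroute (kap k) (rem x s) w) _ (p ++ x :: rem x s)).
  have := @routes_front p (take (index x s) s) x (drop (index x s).+1 s).
  by rewrite -sE' -remE; apply.
rewrite -!cat_rcons; apply: IHw.
- move: us; rewrite (perm_uniq (s2 := l0 :: rcons p x ++ rem x s)) //.
  by rewrite perm_cons cat_rcons perm_cat2l perm_to_rem.
- by rewrite -(perm_cons x) -(permPl (perm_to_rem xs)).
by move=> l /mem_rem; exact: kE.
Qed.

(** This is how normally ordered words absorb R-matrices: M a_s = a_w on the right, and
    a^dagger_{rev s} M^-1 = a^dagger_{rev w} on the left. *)
Lemma routes_conj (M A : (V -> R) -> tend N R[i] L) s w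
    (C : (V -> R) -> R[i]) u v :
  routes M s w ->
  \sum_f \sum_g zV (fun k => C k * tent (invmx (M k) *m A k *m M k) f g)
      (u ++ crew f s ++ annw g s ++ v) =
  \sum_f \sum_g zV (fun k => C k * tent (A k) f g)
      (u ++ crew f w ++ annw g w ++ v).
Proof.
case=> annM creM unitM _.
transitivity (\sum_f \sum_g' zV (fun k => C k * tent (invmx (M k) *m A k) f g')
    (u ++ crew f s ++ annw g' w ++ v)).
  apply: eq_bigr => f _.
  under [RHS]eq_bigr do rewrite catA -annM.
  rewrite [RHS]exchange_big; apply: eq_bigr => g _ /=; rewrite -zV_sum -catA.
  apply: eq_zV => // k; rewrite tentM mulr_sumr; apply: eq_bigr => g' _; exact: mulrA.
under eq_bigr do under eq_bigr do rewrite -creM.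
rewrite exchange_big [RHS]exchange_big; apply: eq_bigr => g _ /=.
rewrite exchange_big; apply: eq_bigr => f _ /=; rewrite -zV_sum.
apply: eq_zV => // k; rewrite -[A k in RHS](mulKVmx (unitM k)) tentM mulr_sumr.
by apply: eq_bigr => f' _; rewrite -mulrA [tent _ _ g * _]mulrC.
Qed.

End Fixed.
End Routes.

(** * The recursion for the coefficients of T *)

Section Indices.
Variable N : nat.

Definition ext (T : finType) (i : 'I_N) (f : tidx N T) : tidx N (option T) :=
  [ffun o => oapp f i o].

Lemma sum_ext (Z : nmodType) (T : finType) (F : tidx N (option T) -> Z) :
  \sum_f F f = \sum_i \sum_f F (ext i f).
Proof.
rewrite pair_bigA /= (reindex (fun p : 'I_N * tidx N T => ext p.1 p.2)); first by [].
exists (fun f : tidx N (option T) => (f None, [ffun l => f (Some l)])).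
  by move=> [i f] _; rewrite !ffunE; congr pair; apply/ffunP => l; rewrite !ffunE.
by move=> f _; apply/ffunP => -[l|]; rewrite ffunE /= ?ffunE.
Qed.

Definition consh n (h : 'I_n.+1) (i : 'I_N) (f : tidx N 'I_n) : tidx N 'I_n.+1 :=
  [ffun l => oapp f i (unlift h l)].

Lemma conshh n (h : 'I_n.+1) i f : consh h i f h = i.
Proof. by rewrite ffunE unlift_none. Qed.

Lemma consh_lift n (h : 'I_n.+1) i f l : consh h i f (lift h l) = f l.
Proof. by rewrite ffunE liftK. Qed.

Lemma sum_consh (Z : nmodType) n (h : 'I_n.+1) (F : tidx N 'I_n.+1 -> Z) :
  \sum_f F f = \sum_i \sum_f F (consh h i f).
Proof.
rewrite pair_bigA /= (reindex (fun p : 'I_N * tidx N 'I_n => consh h p.1 p.2)); first by [].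
exists (fun f : tidx N 'I_n.+1 => (f h, [ffun l => f (lift h l)])).
  by move=> [i f] _; rewrite conshh; congr pair; apply/ffunP => l; rewrite ffunE consh_lift.
move=> f _; apply/ffunP => l; rewrite ffunE.
by case: unliftP => [l' ->|->] //=; rewrite ffunE.
Qed.

Lemma tent_embed_bij (A : nmodType) (L L' : finType) (iota : L -> L') (X : tend N A L) f g :
  bijective iota ->
  tent (embed iota X) f g = tent X [ffun l => f (iota l)] [ffun l => g (iota l)].
Proof.
move=> [io' ioK io'K]; rewrite /embed tent_tmx ifT //.
by apply/forallP => l; rewrite -(io'K l) codom_f.
Qed.

Lemma embed_bij_comp (A : nmodType) (L0 L L' : finType) (iota : L -> L') (io : L0 -> L)
    (X : tend N A L0) :
  bijective iota -> embed iota (embed io X) = embed (iota \o io) X.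
Proof.
move=> bi; apply: tentP => f g; rewrite tent_embed_bij // /embed !tent_tmx.
have [io' ioK io'K] := bi.
have -> : [forall l, (l \notin codom io) ==>
     ([ffun l => f (iota l)] l == [ffun l => g (iota l)] l)] =
    [forall l, (l \notin codom (iota \o io)) ==> (f l == g l)].
  have codE l : (iota l \in codom (iota \o io)) = (l \in codom io).
    apply/codomP/codomP => [[z e]|[z ->]]; exists z => //.
    exact: (can_inj ioK).
  apply/forallP/forallP => H l.
    by have := H (io' l); rewrite !ffunE io'K -codE io'K.
  by have := H (iota l); rewrite !ffunE codE.
by case: ifP => // _; congr tent; apply/ffunP => l; rewrite !ffunE.
Qed.

Lemma embedM_bij (A : pzSemiRingType) (L L' : finType) (iota : L -> L') (X Y : tend N A L) :
  bijective iota -> embed iota (X *m Y) = embed iota X *m embed iota Y.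
Proof.
move=> bi; apply: tentP => f g; rewrite tent_embed_bij // !tentM.
have [io' ioK io'K] := bi.
rewrite [RHS](reindex (fun h : tidx N L => [ffun l => h (io' l)])); last first.
  exists (fun h : tidx N L' => [ffun l => h (iota l)]).
    by move=> h _; apply/ffunP => l; rewrite !ffunE ioK.
  by move=> h _; apply/ffunP => l; rewrite !ffunE io'K.
apply: eq_bigr => h _; rewrite !tent_embed_bij //.
by congr (tent X _ _ * tent Y _ _); apply/ffunP => l; rewrite !ffunE ioK.
Qed.

End Indices.

(** * Normally ordered terms and conjugation of their coefficients *)

Section NormalTerms.
Variables (R : realType) (N : nat) (Rm : Rmatrix R N).
Local Notation vl := (vletter N).
Local Notation zV := (@zV R N Rm _).
Local Notation ctx P := (@ctx R N Rm P _).
Local Notation mon := (mon R N).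

Definition nword n (f g : tidx N 'I_n) : seq (vl 'I_n) :=
  rev [seq vcr (f l) l | l <- enum 'I_n] ++ [seq van (g l) l | l <- enum 'I_n].

(* the entries of [a^dagger_{n...1} X_{infinity 1...n} a_{1...n}] *)
Definition nmons n (X : (option 'I_n -> R) -> tend N R[i] (option 'I_n)) (kinf : R)
    (i j : 'I_N) : seq mon :=
  [seq Mon (fun k => tent (X (oapp k kinf)) (ext i f) (ext j g)) (nword f g)
  | f <- enum {: tidx N 'I_n}, g <- enum {: tidx N 'I_n}].

Lemma ctx_nmons n (X : (option 'I_n -> R) -> tend N R[i] (option 'I_n)) kinf i j
    (V : finType) (C : (V -> R) -> R[i]) u v :
  ctx (nmons X kinf i j) C u v =
  \sum_f \sum_g zV (fun k : V + 'I_n -> R =>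
      C (k \o inl) * tent (X (oapp (k \o inr) kinf)) (ext i f) (ext j g))
    (map (vren inl) u ++ map (vren inr) (nword f g) ++ map (vren inl) v).
Proof.
etransitivity; first exact: big_allpairs_dep.
by rewrite /= big_enum; apply: eq_bigr => f _; rewrite big_enum.
Qed.

Hypothesis UE : unit_entries Rm.

Section Conj.
Variables (n : nat) (kinf : R) (i j : 'I_N) (V : finType) (C : (V -> R) -> R[i]).
Variables (u v : seq (vl V)).

(** The value at [None] is arbitrary: infinity is not among the letters [s0]. *)
Let var (o : option 'I_n.+1) : V + 'I_n.+1 := inr (odflt ord0 o).
Let kap (k : V + 'I_n.+1 -> R) : option 'I_n.+1 -> R := oapp (k \o inr) kinf.
Let s0 : seq (option 'I_n.+1) := [seq Some l | l <- enum 'I_n.+1].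

Lemma ctx_nmons_proj (X : (option 'I_n.+1 -> R) -> tend N R[i] (option 'I_n.+1)) :
  ctx (nmons X kinf i j) C u v =
  \sum_f \sum_g zV (fun k : V + 'I_n.+1 -> R =>
      C (k \o inl) * tent (tproj _ None i *m X (kap k) *m tproj _ None j) f g)
    (map (vren inl) u ++ crew var f s0 ++ annw var g s0 ++ map (vren inl) v).
Proof.
rewrite ctx_nmons.
transitivity (\sum_f \sum_g zV (fun k => C (k \o inl) * tent (X (kap k)) (ext i f) (ext j g))
    (map (vren inl) u ++ crew var (ext i f) s0 ++ annw var (ext j g) s0 ++ map (vren inl) v)).
  apply: eq_bigr => f _; apply: eq_bigr => g _; apply: eq_zV => //.
  rewrite map_cat -catA; congr (_ ++ _ ++ _ ++ _).
    by rewrite /crew map_rev -!map_comp; congr rev; apply: eq_map => l; rewrite /= ffunE.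
  by rewrite /annw -!map_comp; apply: eq_map => l; rewrite /= ffunE.
symmetry.
rewrite sum_ext (bigD1 i) //= [X in _ + X]big1 ?addr0 => [|i' ii]; last first.
  rewrite big1 // => f _; rewrite big1 // => g _.
  set w := _ ++ _; rewrite -[RHS](zV0 Rm w); apply: eq_zV => // k.
  by rewrite tent_projr tent_projl ffunE /= (negbTE ii) !mul0r mulr0.
apply: eq_bigr => f _; rewrite sum_ext (bigD1 j) //= [X in _ + X]big1 ?addr0 => [|j' jj].
  apply: eq_bigr => g _; apply: eq_zV => // k.
  rewrite tent_projr tent_projl ![ext _ _ None]ffunE /= !eqxx.
  by rewrite mul1r mulr1.
rewrite big1 // => g _.
set w := _ ++ _; rewrite -[RHS](zV0 Rm w); apply: eq_zV => // k.
by rewrite tent_projr [ext _ _ None]ffunE /= (negbTE jj) !mulr0.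
Qed.

(** [routes_conj] trades the conjugation for a permutation of the letters, which renaming the
    integration variables by [s] undoes. The projectors at infinity pass through, since these
    R-matrices do not act there. *)
Lemma ctx_nmons_conj (X : (option 'I_n.+1 -> R) -> tend N R[i] (option 'I_n.+1)) (s : 'S_n.+1) :
  ctx (nmons (fun k => invmx (Rperm Rm k s) *m embed (omap s) (X (k \o omap s)) *m Rperm Rm k s)
         kinf i j) C u v =
  ctx (nmons X kinf i j) C u v.
Proof.
pose w := [seq Some (s l) | l <- enum 'I_n.+1].
have sB : bijective (omap s : option 'I_n.+1 -> option 'I_n.+1).
  exists (omap (s^-1)%g) => -[l|] //=; by rewrite ?permK ?permKV.
pose Q k := Rroute Rm (kap k) s0 w.
have rM : routes Rm var None Q s0 w.
  have s0u : uniq s0 by rewrite map_inj_uniq ?enum_uniq // => a b [].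
  have s0N : None \notin s0 by apply/mapP => -[].
  apply: (@routes_Rroute _ _ _ UE _ _ var None kap [::]).
  - by rewrite /= s0N s0u.
  - have wu : uniq w by rewrite map_inj_uniq ?enum_uniq // => a b [] /perm_inj.
    apply: uniq_perm => // -[l|]; last first.
      by rewrite (negbTE s0N); symmetry; apply/negbTE/mapP => -[].
    apply/mapP/mapP => _; last by exists l; rewrite ?mem_enum.
    by exists ((s^-1)%g l); rewrite ?mem_enum ?permKV.
  by move=> l /mapP[l' _ ->] k.
rewrite !ctx_nmons_proj.
transitivity (\sum_f \sum_g zV (fun k : V + 'I_n.+1 -> R => C (k \o inl) *
    tent (invmx (Q k) *m (tproj _ None i *m embed (omap s) (X (kap k \o omap s)) *m tproj _ None j)
          *m Q k) f g)
    (map (vren inl) u ++ crew var f s0 ++ annw var g s0 ++ map (vren inl) v)).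
  apply: eq_bigr => f _; apply: eq_bigr => g _; apply: eq_zV => // k.
  congr (_ * tent _ _ _); rewrite -[Rperm Rm (kap k) s]/(Q k).
  have invP i0 : tproj _ None i0 *m invmx (Q k) = invmx (Q k) *m tproj _ None i0.
    rewrite -[LHS](mulKmx (routes_unit rM k)) [Q k *m (_ *m _)]mulmxA -(routes_proj rM).
    by rewrite mulmxK //; exact: (routes_unit rM k).
  by rewrite !mulmxA invP -!mulmxA (routes_proj rM).
have Xs := routes_conj (fun k => tproj _ None i *m embed (omap s) (X (kap k \o omap s)) *m tproj _ None j)
  (fun k => C (k \o inl)) (map (vren inl) u) (map (vren inl) v) rM.
rewrite {}Xs.
pose rho (f : tidx N (option 'I_n.+1)) : tidx N (option 'I_n.+1) :=
  [ffun o => f (omap (s^-1)%g o)].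
have rhoB : bijective rho.
  exists (fun f : tidx N (option 'I_n.+1) => [ffun o => f (omap s o)]) => f; apply/ffunP => -[l|];
    by rewrite !ffunE /= ?permK ?permKV.
rewrite (reindex rho) /=; last exact: onW_bij.
apply: eq_bigr => f _; rewrite (reindex rho) /=; last exact: onW_bij.
apply: eq_bigr => g _.
pose h (x : V + 'I_n.+1) : V + 'I_n.+1 := match x with inl v => inl v | inr l => inr (s l) end.
rewrite [RHS](@zV_reindex _ _ _ _ _ h); last first.
  exists (fun x => match x with inl v => inl v | inr l => inr ((s^-1)%g l) end);
    by move=> [z|l]; rewrite /= ?permK ?permKV.
have rhoE f' o : rho f' (omap s o) = f' o.
  by rewrite ffunE; case: o => //= l; rewrite permK.
apply: eq_zV => [k|].
  congr (_ * _); rewrite !tent_projr !tent_projl tent_embed_bij //.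
  have -> : kap (k \o h) = kap k \o omap s by apply: funext => -[].
  by rewrite (rhoE f None) (rhoE g None); congr (_ * tent _ _ _ * _); apply/ffunP => o; rewrite ffunE rhoE.
rewrite !map_cat !map_vren_comp; congr (_ ++ _ ++ _ ++ _).
  rewrite /crew map_rev -!map_comp; congr rev; apply: eq_map => l /=.
  by rewrite -[Some (s l)]/(omap s (Some l)) rhoE.
rewrite /annw -!map_comp; apply: eq_map => l /=.
by rewrite -[Some (s l)]/(omap s (Some l)) rhoE.
Qed.

End Conj.

End NormalTerms.

(** * Collapse of the recursion; innermost and outermost pairs of a normal term *)

Section Recursion.
Variables (R : realType) (N : nat) (Rm : Rmatrix R N).
Local Notation ZF := (ZF Rm).
Local Notation vl := (vletter N).
Local Notation zVnum := (@zVnum R N Rm _).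
Local Notation ctx P := (@ctx R N Rm P _).
Local Notation ctxnum P := (@ctxnum R N Rm P _).
Local Notation Rent := (Rent Rm).
Local Notation Rleg := (Rleg Rm).
Local Notation labelled n := ((option 'I_n -> R) -> tend N R[i] (option 'I_n)).

Section Linear.
Variables (n : nat) (kinf : R) (i j : 'I_N) (V : finType) (C : (V -> R) -> R[i]).
Variables (u v : seq (vl V)).

Lemma ctx_nmonsD (X Y : labelled n) :
  ctx (nmons (fun k => X k + Y k) kinf i j) C u v =
  ctx (nmons X kinf i j) C u v + ctx (nmons Y kinf i j) C u v.
Proof.
rewrite !ctx_nmons -big_split; apply: eq_bigr => f _ /=.
rewrite -big_split; apply: eq_bigr => g _ /=; rewrite -zVD.
by apply: eq_zV => // k; rewrite tentD mulrDr.
Qed.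

Lemma ctx_nmonsZ a (X : labelled n) :
  ctx (nmons (fun k => a *: X k) kinf i j) C u v = a *: ctx (nmons X kinf i j) C u v.
Proof.
rewrite !ctx_nmons scaler_sumr; apply: eq_bigr => f _ /=.
rewrite scaler_sumr; apply: eq_bigr => g _ /=; rewrite -zVZ.
by apply: eq_zV => // k; rewrite tentZ mulrCA.
Qed.

Lemma ctx_nmons_sum (I : finType) (X : I -> labelled n) :
  ctx (nmons (fun k => \sum_a X a k) kinf i j) C u v =
  \sum_a ctx (nmons (X a) kinf i j) C u v.
Proof.
under [RHS]eq_bigr do rewrite ctx_nmons.
rewrite ctx_nmons [RHS]exchange_big; apply: eq_bigr => f _ /=.
rewrite [RHS]exchange_big; apply: eq_bigr => g _ /=; rewrite -zV_sum.
by apply: eq_zV => // k; rewrite tent_sum mulr_sumr.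
Qed.

End Linear.

Lemma eq_nmons n (X Y : labelled n) : X =1 Y -> nmons X = nmons Y.
Proof. by move=> /funext ->. Qed.

(* T^(n), with T^(0) = 1 *)
Definition Tcoef0 n : labelled n :=
  match n with 0 => fun=> 1%:M | m.+1 => @Tcoef R N Rm m end.

(** T^(n) placed on all copies but [h]. It is used for [ord0] and [ord_max]: creators being written
    in reverse order, these label the innermost and the outermost pair of a normal word. *)
Definition shiftX n (h : 'I_n.+1) : labelled n.+1 :=
  fun k => embed (omap (lift h)) (@Tcoef0 n (k \o omap (lift h))).

Lemma embed1 (L L' : finType) (iota : L -> L') :
  embed iota (1%:M : tend N R[i] L) = 1%:M.
Proof.
apply: tentP => f g; rewrite /embed tent_tmx !tent1.
case: forallP => [fg|nfg]; last first.
  by case: eqP => // fg; case: nfg => l; rewrite fg eqxx implybT.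
congr (_%:R); congr nat_of_bool; apply/eqP/eqP => [/ffunP e|-> //].
apply/ffunP => l; have [/codomP[l' ->]|nl] := boolP (l \in codom iota).
  by have := e l'; rewrite !ffunE.
by have := fg l; rewrite nl => /eqP.
Qed.

Lemma embed_Rleg (L L' : finType) (iota : L -> L') (k : L' -> R) a b :
  bijective iota -> embed iota (Rleg (k \o iota) a b) = Rleg k (iota a) (iota b).
Proof.
move=> bi; rewrite /Rleg embed_bij_comp //; congr embed.
by apply: funext => l; rewrite /pair2 /=; case: ifP.
Qed.

Lemma bij_omap (T : Type) (s : T -> T) : bijective s -> bijective (omap s).
Proof.
move=> [s' sK s'K]; exists (omap s') => -[l|] //=; by rewrite ?sK ?s'K.
Qed.

Hypothesis UE : unit_entries Rm.

Lemma TcoefS n (k : option 'I_n.+2 -> R) :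
  Tcoef Rm k =
  n.+2%:R^-1 *: (\sum_(a < n.+2) invmx (Rperm Rm k (pcyc a)) *m
     embed (tail_labels (pcyc a)) (Tcoef Rm (fun o => k (tail_labels (pcyc a) o))) *m
     Rperm Rm k (pcyc a)) -
  (n.+2)`!%:R^-1 *: (\sum_(s : 'S_n.+2) invmx (Rperm Rm k (pcyc ord_max * s)%g) *m
     (Rleg k None (Some (s ord0)) *m
      embed (tail_labels s) (Tcoef Rm (fun o => k (tail_labels s o)))) *m
     Rperm Rm k (pcyc ord_max * s)%g).
Proof. by []. Qed.

(* Each sum in the recursion is an average of conjugates of one matrix, and the
   conjugations are absorbed by [ctx_nmons_conj]. *)
Lemma ctx_nmons_Tcoef n kinf i j (V : finType) (C : (V -> R) -> R[i]) u v :
  ctx (nmons (@Tcoef R N Rm n) kinf i j) C u v =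
  ctx (nmons (@shiftX n ord0) kinf i j) C u v -
  ctx (nmons (fun k => Rleg k None (Some ord_max) *m @shiftX n ord_max k) kinf i j) C u v.
Proof.
(* The convention T^(0) = 1 makes T^(1) = 1 - R an instance of the general formula. *)
case: n => [|n].
  rewrite -scaleN1r -ctx_nmonsZ -ctx_nmonsD.
  apply: (congr1 (fun P => ctx (P kinf i j) C u v)); apply: eq_nmons => k; rewrite /shiftX /= !embed1 mulmx1 scaleN1r; congr (_ - Rleg k _ (Some _)).
  exact: val_inj.
pose X0 : labelled n.+2 := shiftX ord0.
pose X1 : labelled n.+2 := fun k => Rleg k None (Some ord_max) *m shiftX ord_max k.
pose cj (X : labelled n.+2) (s : 'S_n.+2) : labelled n.+2 :=
  fun k => invmx (Rperm Rm k s) *m embed (omap s) (X (k \o omap s)) *m Rperm Rm k s.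
have TE : @Tcoef R N Rm n.+1 =1 (fun k =>
    n.+2%:R^-1 *: (\sum_(a < n.+2) cj X0 (pcyc a) k) +
    (-1) *: ((n.+2)`!%:R^-1 *: (\sum_(s : 'S_n.+2) cj X1 (pcyc ord_max * s)%g k))).
  move=> k; rewrite scaleN1r.
  have TsE (s : 'S_n.+2) : embed (omap s) (X0 (k \o omap s)) =
      embed (tail_labels s) (Tcoef Rm (fun o => k (tail_labels s o))).
    rewrite /X0 /shiftX embed_bij_comp; last exact/bij_omap/injF_bij/perm_inj.
    have -> : omap s \o omap (lift ord0) = tail_labels s by apply: funext => -[].
    by congr (embed _ (Tcoef _ _)); apply: funext => -[].
  have Ea a : invmx (Rperm Rm k (pcyc a)) *m
     embed (tail_labels (pcyc a)) (Tcoef Rm (fun o => k (tail_labels (pcyc a) o))) *m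
     Rperm Rm k (pcyc a) = cj X0 (pcyc a) k by rewrite /cj TsE.
  suff Es s : invmx (Rperm Rm k (pcyc ord_max * s)%g) *m
     (Rleg k None (Some (s ord0)) *m
      embed (tail_labels s) (Tcoef Rm (fun o => k (tail_labels s o)))) *m
     Rperm Rm k (pcyc ord_max * s)%g = cj X1 (pcyc ord_max * s)%g k.
    apply: etrans (TcoefS k) _.
    exact: (congr2 (fun A B => _ *: A - _ *: B) (eq_bigr _ (fun a _ => Ea a))
      (eq_bigr _ (fun s _ => Es s))).
  rewrite /cj; apply: (congr1 (fun Z => invmx _ *m Z *m _)).
  set p := (pcyc ord_max * s)%g.
  have pB : bijective (omap p) by exact/bij_omap/injF_bij/perm_inj.
  (* The permutation sends the last copy to s(0) and the others, in order, to s(1), s(2), ..., so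
     each summand of the second sum is a conjugate of [X1]. *)
  have p_max : p ord_max = s ord0 by rewrite permM lift_perm_id.
  have p_lift l : p (lift ord_max l) = s (lift ord0 l) by rewrite permM lift_perm_lift perm1.
  rewrite /X1 embedM_bij // (embed_Rleg _ _ _ pB) /= p_max; congr (_ *m _).
  rewrite /shiftX embed_bij_comp //.
  have -> : omap p \o omap (lift ord_max) = tail_labels s.
    by apply: funext => -[l|] //=; rewrite p_lift.
  by congr (embed _ (Tcoef _ _)); apply: funext => -[l|] //=; rewrite p_lift.
rewrite (eq_nmons TE) ctx_nmonsD !ctx_nmonsZ !ctx_nmons_sum.
under eq_bigr do rewrite /cj (ctx_nmons_conj UE).
under [X in _ + _ *: (_ *: X)]eq_bigr do rewrite /cj (ctx_nmons_conj UE).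
have avg (m : nat) (x : ZF) : (0 < m)%N -> m%:R^-1 *: (x *+ m) = x.
  by move=> m0; rewrite -[x *+ m]scaler_nat scalerA mulVf ?scale1r // pnatr_eq0 -lt0n.
by rewrite !sumr_const card_ord card_Sn avg // avg ?fact_gt0 // scaleN1r.
Qed.

Lemma tent_embed_lift n (h : 'I_n.+1) (Y : tend N R[i] (option 'I_n)) i j m m2 f g :
  tent (embed (omap (lift h)) Y) (ext i (consh h m f)) (ext j (consh h m2 g)) =
  if m == m2 then tent Y (ext i f) (ext j g) else 0.
Proof.
rewrite /embed tent_tmx.
have -> : [forall l, (l \notin codom (omap (lift h))) ==>
   (ext i (consh h m f) l == ext j (consh h m2 g) l)] = (m == m2).
  apply/forallP/eqP => [H|->].
    have := H (Some h); rewrite !ffunE /= !conshh => /implyP H'; apply/eqP/H'.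
    by apply/codomP => -[[l|]] //= [] /eqP; rewrite (negbTE (neq_lift h l)).
  case=> [l|]; last by rewrite (_ : None \in _) //; apply/codomP; exists None.
  case: (unliftP h l) => [l' ->|->]; last by rewrite !ffunE /= !conshh eqxx implybT.
  by rewrite (_ : Some _ \in _) //; apply/codomP; exists (Some l').
case: eqP => // _; congr tent; apply/ffunP => -[l|]; rewrite !ffunE //=;
  by rewrite consh_lift.
Qed.

Lemma tent_Rleg_embed_lift n (h : 'I_n.+1) (k : option 'I_n.+1 -> R)
    (Y : tend N R[i] (option 'I_n)) i j m m2 f g :
  tent (Rleg k None (Some h) *m embed (omap (lift h)) Y)
    (ext i (consh h m f)) (ext j (consh h m2 g)) =
  \sum_i' Rent (k None) (k (Some h)) i m i' m2 * tent Y (ext i' f) (ext j g).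
Proof.
rewrite tentM (@sum_Rleg _ _ _ _ _ _ _ _ _ (fun z h => z * tent _ h _)) // => [|g'];
  last by rewrite mul0r.
apply: eq_bigr => i' _; rewrite ![ext i _ _]ffunE /= conshh (bigD1 m2) //=.
have updE m' : upd2 (ext i (consh h m f)) None i' (Some h) m' = ext i' (consh h m' f).
  apply/ffunP => -[l|]; rewrite !ffunE //=; case: (unliftP h l) => [l' ->|->].
    by rewrite !consh_lift (inj_eq Some_inj) eq_sym (negbTE (neq_lift h l')).
  by rewrite !conshh eqxx.
rewrite big1 ?addr0 => [|m' mm]; first by rewrite updE tent_embed_lift eqxx.
by rewrite updE tent_embed_lift (negbTE mm) mulr0.
Qed.

Lemma nword_consh0 n (f g : tidx N 'I_n) m m2 :
  nword (consh ord0 m f) (consh ord0 m2 g) =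
  map (vren (lift ord0)) (rev [seq vcr (f l) l | l <- enum 'I_n]) ++
  vcr m ord0 :: van m2 ord0 ::
  map (vren (lift ord0)) [seq van (g l) l | l <- enum 'I_n].
Proof.
rewrite /nword enum_ordSl !map_cons rev_cons cat_rcons !conshh.
rewrite map_rev -![map _ (map (lift ord0) _)]map_comp -![map (vren _) _]map_comp.
congr (rev _ ++ _ :: _ :: _); apply: eq_map => l /=; by rewrite consh_lift.
Qed.

Lemma nword_consh_max n (f g : tidx N 'I_n) m m2 :
  nword (consh ord_max m f) (consh ord_max m2 g) =
  vcr m ord_max :: map (vren (lift ord_max)) (nword f g) ++ [:: van m2 ord_max].
Proof.
have enumE : enum 'I_n.+1 = rcons (map (lift ord_max) (enum 'I_n)) ord_max.
  by rewrite enum_ordSr; congr rcons; apply: eq_map => l; apply: val_inj; exact: (esym (lift_max l)).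
rewrite /nword enumE !map_rcons rev_rcons !conshh map_cat map_rev -catA -cats1 cat_cons.
rewrite -![map _ (map (lift ord_max) _)]map_comp -![map (vren _) _]map_comp.
congr (_ :: rev _ ++ _ ++ _); apply: eq_map => l /=; by rewrite consh_lift.
Qed.

Lemma eq_map_vren (V W : Type) (h h' : V -> W) (w : seq (vl V)) :
  h =1 h' -> map (vren h) w = map (vren h') w.
Proof. by move=> hh; apply: eq_map => -[b [i x]]; rewrite /vren /= hh. Qed.

(* a^dagger_{n...1} a^dagger_0 T^(n) a_0 a_{1...n} is the n-th normal term with N
   inserted in its middle. *)
Lemma ctx_nmons_mid n kinf i j (V : finType) (C : (V -> R) -> R[i]) u v :
  ctx (nmons (@shiftX n ord0) kinf i j) C u v =
  ctxnum (nmons (@Tcoef0 n) kinf i j) C u v - n%:R *: ctx (nmons (@Tcoef0 n) kinf i j) C u v.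
Proof.
apply/eqP; rewrite -subr_eq0 opprB addrA subr_eq0; apply/eqP.
rewrite ctxnumE.
transitivity (\sum_f \sum_g zVnum (fun k : V + 'I_n -> R =>
    C (k \o inl) * tent (Tcoef0 (oapp (k \o inr) kinf)) (ext i f) (ext j g))
    (map (vren inl) u ++ map (vren inr) (nword f g)) (map (vren inl) v)); last first.
  symmetry; etransitivity; first exact: big_allpairs_dep.
  by rewrite /= big_enum; apply: eq_bigr => f _; rewrite big_enum.
rewrite !ctx_nmons scaler_sumr.
rewrite (sum_consh ord0) exchange_big -big_split; apply: eq_bigr => f _ /=.
under eq_bigr do rewrite (sum_consh ord0) exchange_big /=.
rewrite exchange_big scaler_sumr -big_split; apply: eq_bigr => g _ /=.
rewrite map_cat.
set r := [seq vcr _ _ | l <- _]; set a := [seq van _ _ | l <- _].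
have aN : nann (map (vren (@inr V 'I_n)) a) = n.
  rewrite /nann count_map /a count_map (eq_count (a2 := predT)) //.
  by rewrite count_predT -cardE card_ord.
have aC : ncre (map (vren (@inr V 'I_n)) a) = 0%N.
  by rewrite /ncre count_map /a count_map (eq_count (a2 := pred0)) // count_pred0.
(* From the right end to the middle of the word, N crosses n annihilators and no creator. *)
rewrite [in RHS]catA zVnum_cat aN aC subr0 -!catA; congr (_ + _).
apply: eq_bigr => m _; rewrite (bigD1 m) //= [X in _ + X]big1 ?addr0 => [|m2 mm]; last first.
  set w := _ ++ _; rewrite -[RHS](zV0 Rm w); apply: eq_zV => // k.
  by rewrite /shiftX tent_embed_lift eq_sym (negbTE mm) mulr0.
pose h (x : V + 'I_n.+1) : option (V + 'I_n) :=
  match x with inl v => Some (inl v) | inr z => omap inr (unlift ord0 z) end.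
rewrite (@zV_reindex _ _ _ _ _ h); last first.
  exists (fun o => match o with None => inr ord0 | Some (inl v) => inl v
                              | Some (inr l) => inr (lift ord0 l) end).
    by move=> [z|z] //=; case: (unliftP ord0 z) => [l ->|->].
  by move=> [[z|z]|] //=; rewrite ?liftK ?unlift_none.
apply: eq_zV => [k|].
  rewrite /shiftX tent_embed_lift eqxx; congr (_ * tent (Tcoef0 _) _ _).
  by apply: funext => -[l|] //=; rewrite liftK.
rewrite nword_consh0 !(map_cat, map_cons) !map_vren_comp /= -!catA.
have hl : h \o (inr \o lift ord0) =1 Some \o inr by move=> l; rewrite /= liftK.
have hN : h (inr ord0) = None by rewrite /h unlift_none.
rewrite !(eq_map_vren _ hl).
by rewrite -[vren h (vren inr (vcr m _))]/(vcr m (h (inr ord0)))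
  -[vren h (vren inr (van m _))]/(van m (h (inr ord0))) hN.
Qed.

(** The last copy carries the outermost pair, which can be handed over to the context; R_{infinity
    0} multiplies T^(n) from the left and so changes only the row index [i]. *)
Lemma ctx_nmons_outer n kinf i j (V : finType) (C : (V -> R) -> R[i]) u v :
  ctx (nmons (fun k => Rleg k None (Some ord_max) *m @shiftX n ord_max k) kinf i j) C u v =
  \sum_m \sum_i' \sum_m'
    ctx (nmons (@Tcoef0 n) kinf i' j)
      (fun k : option V -> R => C (k \o Some) * Rent kinf (k None) i m i' m')
      (map (vren Some) u ++ [:: vcr m None]) (van m' None :: map (vren Some) v).
Proof.
under [RHS]eq_bigr do under eq_bigr do under eq_bigr do rewrite ctx_nmons.
rewrite ctx_nmons (sum_consh ord_max); apply: eq_bigr => m _.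
under [RHS]eq_bigr do rewrite exchange_big /=.
rewrite [RHS]exchange_big; apply: eq_bigr => f _ /=.
rewrite (sum_consh ord_max) [RHS]exchange_big; apply: eq_bigr => m' _ /=.
rewrite [RHS]exchange_big; apply: eq_bigr => g _ /=.
pose h (x : V + 'I_n.+1) : option V + 'I_n :=
  match x with inl v => inl (Some v)
             | inr z => if unlift ord_max z is Some l then inr l else inl None end.
have hE z : h (inr (lift ord_max z)) = inr z by rewrite /h liftK.
have hN : h (inr ord_max) = inl None by rewrite /h unlift_none.
rewrite (@zV_reindex _ _ _ _ _ h); last first.
  exists (fun x => match x with inl None => inr ord_max | inl (Some v) => inl v
                              | inr l => inr (lift ord_max l) end).
    by move=> [z|z] //=; case: (unliftP ord_max z) => [l ->|->].
  by move=> [[z|]|z] //=; rewrite ?liftK ?unlift_none.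
rewrite -zV_sum; apply: eq_zV => [k|].
  rewrite /shiftX tent_Rleg_embed_lift mulr_sumr; apply: eq_bigr => i' _.
  rewrite -[Rent _ _ i m i' m']/(Rent kinf (k (h (inr ord_max))) i m i' m') hN mulrA; congr (_ * tent (Tcoef0 _) _ _).
  by apply: funext => -[l|] //; exact: (congr1 k (hE l)).
rewrite nword_consh_max !(map_cat, map_cons) !map_vren_comp -!catA /=.
have hl : h \o (inr \o lift ord_max) =1 inr by exact: hE.
by rewrite !(eq_map_vren _ hl) -[vren h (vren inr (vcr m _))]/(vcr m (h (inr ord_max)))
  -[vren h (vren inr (van m' _))]/(van m' (h (inr ord_max))) hN -!catA.
Qed.

End Recursion.

(** * The vertex operator *)

Section VertexOperator.
Variables (R : realType) (N : nat) (Rm : Rmatrix R N).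
Local Notation ZF := (ZF Rm).
Local Notation vl := (vletter N).
Local Notation zV := (@zV R N Rm _).
Local Notation ctx P := (@ctx R N Rm P _).
Local Notation ctxnum P := (@ctxnum R N Rm P _).
Local Notation mon := (mon R N).
Local Notation Rent := (Rent Rm).
Local Notation Tcoef0 := (Tcoef0 Rm).

Definition tau (kinf : R) (n : nat) (i j : 'I_N) : seq mon :=
  map (mscale ((-1) ^+ n / n`!%:R)) (nmons (@Tcoef0 n) kinf i j).

Definition Tsum (kinf : R) (M : nat) (i j : 'I_N) : seq mon :=
  flatten [seq tau kinf n i j | n <- iota 0 M.+1].

Lemma ctx_tau kinf n i j (V : finType) (C : (V -> R) -> R[i]) u v :
  ctx (tau kinf n i j) C u v =
  ((-1) ^+ n / n`!%:R) *: ctx (nmons (@Tcoef0 n) kinf i j) C u v.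
Proof. exact: ctx_scale. Qed.

Lemma ctxnum_tau kinf n i j (V : finType) (C : (V -> R) -> R[i]) u v :
  ctxnum (tau kinf n i j) C u v =
  ((-1) ^+ n / n`!%:R) *: ctxnum (nmons (@Tcoef0 n) kinf i j) C u v.
Proof.
rewrite [RHS]scaler_sumr; apply: eq_bigr => m _; exact: ctx_tau.
Qed.

Lemma hgt_nword n d (f g : tidx N 'I_n) : hgt d (nword f g) = (d - n + n)%N.
Proof.
rewrite /nword hgt_cat hgt_ann; last by rewrite all_map; apply/allP.
rewrite hgt_cre; last by rewrite all_rev all_map; apply/allP.
have sizeE (h : 'I_n -> vl 'I_n) : size (map h (enum 'I_n)) = n.
  by rewrite size_map size_enum_ord.
by rewrite size_rev !sizeE.
Qed.

Lemma all_tau (P : forall n, seq (vl 'I_n) -> bool) kinf n i j :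
  (forall f g, P n (nword f g)) ->
  all (fun m : mon => P (mdim m) (mword m)) (tau kinf n i j).
Proof.
move=> Pn; rewrite /tau all_map /nmons.
set e := enum _; elim: {2}e => //= f r IHr; rewrite all_cat IHr andbT all_map.
by elim: e {IHr} => //= g r' ->; rewrite Pn.
Qed.

Hypothesis UE : unit_entries Rm.

(** The collapsed recursion, solved for the term that contains N. The weight (-1)^n / n! is the one
    that turns the normal term of T^(n+1) into -(n+1) times the next term of the series. *)
Lemma ctxnum_tau_rec kinf n i j (V : finType) (C : (V -> R) -> R[i]) u v :
  ctxnum (tau kinf n i j) C u v =
  n%:R *: ctx (tau kinf n i j) C u v - n.+1%:R *: ctx (tau kinf n.+1 i j) C u v +
  \sum_m \sum_i' \sum_m'
    ctx (tau kinf n i' j)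
      (fun k : option V -> R => C (k \o Some) * Rent kinf (k None) i m i' m')
      (map (vren Some) u ++ [:: vcr m None]) (van m' None :: map (vren Some) v).
Proof.
under eq_bigr do under eq_bigr do under eq_bigr do rewrite ctx_tau.
under eq_bigr do under eq_bigr do rewrite -scaler_sumr.
under eq_bigr do rewrite -scaler_sumr.
rewrite -scaler_sumr -ctx_nmons_outer !ctx_tau ctxnum_tau.
rewrite (ctx_nmons_Tcoef UE) ctx_nmons_mid.
set a := (-1) ^+ n / n`!%:R.
have cE : n.+1%:R * ((-1) ^+ n.+1 / (n.+1)`!%:R) = - a :> R[i].
  rewrite factS natrM invfM exprS mulN1r !mulNr mulrN /a; congr (- _).
  by rewrite mulrCA mulVKf // pnatr_eq0.
rewrite [n.+1%:R *: _]scalerA cE scaleNr.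
rewrite opprK !scalerBr !scalerA [n%:R * a]mulrC addrC.
set x := a *: ctxnum _ _ _ _; set y := (a * n%:R) *: _; set z := a *: _.
by rewrite [y + _]addrA [y + _]addrC subrK addrC subrK.
Qed.

(** Over n the recursion telescopes and leaves -(M+1) times the first omitted term of the series,
    whose words end with M+1 annihilators. *)
Lemma Tsum_intertwines kinf M : intertwines Rm (Tsum kinf M) kinf M.
Proof.
exists (fun i j => map (mscale (- M.+1%:R)) (tau kinf M.+1 i j)).
  move=> i j; rewrite all_map.
  by apply: (@all_tau (fun n w => M.+1 <= hgt 0 w)%N) => f g; rewrite hgt_nword leq_addl.
move=> V C u v i j; rewrite ctx_scale scaleNr.
have numE : ctxnum (Tsum kinf M i j) C u v = \sum_(n <- iota 0 M.+1) ctxnum (tau kinf n i j) C u v.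
  by rewrite [RHS]exchange_big; apply: eq_bigr => m _; rewrite ctx_flatten.
rewrite numE; under eq_bigr do rewrite ctxnum_tau_rec.
rewrite big_split /= addrC; congr (_ + _).
  rewrite exchange_big; apply: eq_bigr => m _ /=.
  rewrite exchange_big; apply: eq_bigr => i' _ /=.
  by rewrite exchange_big; apply: eq_bigr => m' _ /=; rewrite ctx_flatten.
rewrite -[X in \sum_(_ <- X) _]/(index_iota 0 M.+1).
under eq_bigr do rewrite -opprB.
by rewrite sumrN (telescope_sumr (fun n => n%:R *: ctx (tau kinf n i j) C u v)) // scale0r subr0.
Qed.

Lemma Tsum_hgt kinf M i j : all (fun m : mon => M <= hgt M (mword m))%N (Tsum kinf M i j).
Proof.
rewrite /Tsum; elim: (iota _ _) => //= n r IHr; rewrite all_cat IHr andbT.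
apply: (@all_tau (fun n w => M <= hgt M w)%N) => f g.
by rewrite hgt_nword addnC -leq_subLR.
Qed.

Lemma ctx_tau0 kinf i j (V : finType) (C : (V -> R) -> R[i]) u v :
  ctx (tau kinf 0 i j) C u v = (i == j)%:R *: zV C (u ++ v).
Proof.
rewrite ctx_tau expr0 fact0 invr1 mulr1 scale1r ctx_nmons -zVZ.
pose f0 : tidx N 'I_0 := [ffun=> i].
have f0P f : true = (f == f0) by symmetry; apply/eqP/ffunP => -[].
rewrite (big_pred1 f0) // (big_pred1 f0) //.
have -> : nword f0 f0 = [::] by rewrite /nword (size0nil (size_enum_ord 0)).
pose h (x : V + 'I_0) : V := match x with inl v => v | inr l => False_rect V (notF (ltn_ord l)) end.
rewrite (@zV_reindex _ _ _ _ _ h); last first.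
  by exists inl => // -[v'|[]].
apply: eq_zV => [k|]; last by rewrite /= map_cat !map_vren_comp !map_vren_id.
rewrite /= tent1 mulrC; congr (_%:R * _); congr nat_of_bool.
apply/eqP/eqP => [/ffunP/(_ None)|->//]; by rewrite !ffunE.
Qed.

Definition Tsum1 (kinf : R) (M : nat) (i j : 'I_N) : seq mon :=
  flatten [seq tau kinf n i j | n <- iota 1 M].

Lemma Tsum1_hgt kinf M i j : all (fun m : mon => 0 < hgt 0 (mword m))%N (Tsum1 kinf M i j).
Proof.
have : all (fun n => 0 < n)%N (iota 1 M) by apply/allP => n; rewrite mem_iota => /andP[].
rewrite /Tsum1; elim: (iota 1 M) => //= n r IHr /andP[n0 /IHr]; rewrite all_cat => ->; rewrite andbT.
by apply: (@all_tau (fun n w => 0 < hgt 0 w)%N) => f g; rewrite hgt_nword addn_gt0 n0 orbT.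
Qed.

Lemma ctx_Tsum kinf M i j (V : finType) (C : (V -> R) -> R[i]) u v :
  ctx (Tsum kinf M i j) C u v = (i == j)%:R *: zV C (u ++ v) + ctx (Tsum1 kinf M i j) C u v.
Proof. by rewrite /Tsum /= ctx_cat ctx_tau0. Qed.

Lemma Tpart_mval kinf M i j : Tpart Rm M kinf i j = mval Rm (Tsum kinf M i j).
Proof.
have tauE n : mval Rm (tau kinf n.+1 i j) =
    ((-1) ^+ n.+1 / (n.+1)`!%:R) *: normal_term Rm (@Tcoef R N Rm n) kinf i j.
  rewrite mval_ctx ctx_tau -mval_ctx mxE; congr (_ *: _).
  rewrite /mval /nmons big_allpairs_dep big_enum; apply: eq_bigr => f _.
  rewrite big_enum; apply: eq_bigr => g _ /=.
  rewrite (@zV_zint _ _ _ _ _ id); last by exists id.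
  congr (zint Rm _ _); rewrite /nword /normal_word map_cat map_rev -!map_comp.
  by [].
rewrite mxE mval_ctx ctx_flatten.
rewrite (eq_bigr _ (fun n _ => esym (mval_ctx Rm (tau kinf n i j)))).
rewrite -[iota 0 M.+1]/(0%N :: iota 1 M) big_cons; congr (_ + _).
  rewrite mval_ctx ctx_tau0 (@zV_zint _ _ _ _ 0 (fun x : void => match x with end)); last first.
    by exists (fun l : 'I_0 => False_rect void (notF (ltn_ord l))) => -[].
  have -> : zint Rm (fun _ : 'I_0 -> R => 1) [::] = 1.
    by apply/zclassP; exact: zeq_trans (zeq_int_nil _ _) (zeq_scale1 _ _).
  by rewrite scaler_nat mxE.
rewrite (iotaDl 1 0) big_map.
rewrite -(big_mkord xpredT (fun n => ((-1) ^+ n.+1 / (n.+1)`!%:R) *: normal_term Rm (@Tcoef R N Rm n) kinf i j)).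
by rewrite /index_iota subn0; apply: eq_bigr => n _; rewrite -tauE.
Qed.

(** * Entries on two copies of V, and the relation for the partial sums *)

Definition duo (x y : 'I_N) : tidx N 'I_2 := finfun (pair2 x y).

Lemma duoE (f : tidx N 'I_2) : f = duo (f (@Ordinal 2 0 isT)) (f (@Ordinal 2 1 isT)).
Proof.
apply/ffunP => l; rewrite ffunE /pair2; case: eqP => [->|/eqP].
  by congr (f _); apply: val_inj.
by case: l => -[|[|//]] //= lt2 _; congr (f _); apply: val_inj.
Qed.

Lemma sum_duo (Z : nmodType) (F : tidx N 'I_2 -> Z) : \sum_f F f = \sum_x \sum_y F (duo x y).
Proof.
rewrite pair_bigA /= (reindex (fun p : 'I_N * 'I_N => duo p.1 p.2)); first by [].
exists (fun f : tidx N 'I_2 => (f (@Ordinal 2 0 isT), f (@Ordinal 2 1 isT))).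
  by move=> [x y] _; rewrite !ffunE.
by move=> f _; rewrite -duoE.
Qed.

Lemma tent_leg0 (A : nmodType) (X : 'M[A]_N) x y z w :
  tent (leg (@Ordinal 2 0 isT) X) (duo x y) (duo z w) = if y == w then X x z else 0.
Proof.
rewrite /leg tent_tmx !ffunE /=.
have -> // : [forall l, (l != @Ordinal 2 0 isT) ==> (duo x y l == duo z w l)] = (y == w).
apply/forallP/idP => [/(_ (@Ordinal 2 1 isT))|/eqP ->]; first by rewrite !ffunE.
by move=> [[|[|//]] ?]; apply/implyP => // _; rewrite !ffunE.
Qed.

Lemma tent_leg1 (A : nmodType) (X : 'M[A]_N) x y z w :
  tent (leg (@Ordinal 2 1 isT) X) (duo x y) (duo z w) = if x == z then X y w else 0.
Proof.
rewrite /leg tent_tmx !ffunE /=.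
have -> // : [forall l, (l != @Ordinal 2 1 isT) ==> (duo x y l == duo z w l)] = (x == z).
apply/forallP/idP => [/(_ (@Ordinal 2 0 isT))|/eqP ->]; first by rewrite !ffunE.
by move=> [[|[|//]] ?]; apply/implyP => // _; rewrite !ffunE.
Qed.

Lemma tent_leg01 (A : pzSemiRingType) (X Y : 'M[A]_N) x y z w :
  tent (leg (@Ordinal 2 0 isT) X *m leg (@Ordinal 2 1 isT) Y) (duo x y) (duo z w) =
  X x z * Y y w.
Proof.
rewrite tentM sum_duo (bigD1 z) //= [X in _ + X]big1 ?addr0 => [|z' /negbTE zz].
  rewrite (bigD1 y) //= big1 ?addr0 => [|y' /negbTE yy]; rewrite tent_leg0 tent_leg1 ?eqxx //.
  by rewrite eq_sym yy mul0r.
by rewrite big1 // => y' _; rewrite tent_leg1 zz mulr0.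
Qed.

Lemma tent_leg10 (A : pzSemiRingType) (X Y : 'M[A]_N) x y z w :
  tent (leg (@Ordinal 2 1 isT) Y *m leg (@Ordinal 2 0 isT) X) (duo x y) (duo z w) =
  Y y w * X x z.
Proof.
rewrite tentM sum_duo (bigD1 x) //= [X in _ + X]big1 ?addr0 => [|x' /negbTE xx].
  rewrite (bigD1 w) //= big1 ?addr0 => [|w' /negbTE ww]; rewrite tent_leg0 tent_leg1 ?eqxx //.
  by rewrite ww mulr0.
by rewrite big1 // => w' _; rewrite tent_leg1 eq_sym xx mul0r.
Qed.

Lemma tent_map_alg (X : tend N R[i] 'I_2) f g :
  tent (map_mx (in_alg ZF) X) f g = (tent X f g)%:A.
Proof. by rewrite /tent mxE. Qed.

Hypothesis YB : YBE_entries Rm.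

Lemma Tpart_FRT : FRT (@Tpart R N Rm).
Proof.
(* [M >= p] would give the required height; one more keeps M positive, as the induction for
   [FRTdefect] starts at d = 1. *)
move=> k1 k2 c1 c2 R12 x y p; exists p.+1 => M pM.
set A := R12 *m _ *m _; set B := _ *m R12.
have -> : A x y - B x y =
    tent A (enum_val x) (enum_val y) - tent B (enum_val x) (enum_val y).
  by rewrite /tent !enum_valK.
rewrite (duoE (enum_val x)) (duoE (enum_val y)).
move: (enum_val x c1) (enum_val x c2) (enum_val y c1) (enum_val y c2) => a b c d.
(* The relation itself is the defect in the empty context, with no variables and no surrounding
   letters. *)
have -> : tent A (duo a b) (duo c d) - tent B (duo a b) (duo c d) =
    FRTdefect Rm (Tsum k1 M) (Tsum k2 M) k1 k2 (fun _ : void -> R => 1) [::] [::] a b c d.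
  congr (_ - _).
    rewrite /A -mulmxA tentM sum_duo; apply: eq_bigr => s _; apply: eq_bigr => t _.
    by rewrite tent_map_alg tent_leg01 mulr_algl !Tpart_mval -mval_mul mval_ctx.
  rewrite /B tentM sum_duo; apply: eq_bigr => s _; apply: eq_bigr => t _.
  by rewrite tent_map_alg tent_leg10 mulr_algr !Tpart_mval -mval_mul mval_ctx.
apply: (@ann_tail_le _ _ _ M p); first exact: ltnW.
have M0 : (0 < M <= M)%N by rewrite leqnn andbT (leq_trans _ pM).
exact: (@FRTdefect_ann_tail _ _ _ M _ _ (Tsum1 k1 M) (Tsum1 k2 M) _ _ YB
  (Tsum_intertwines k1 M) (Tsum_intertwines k2 M) (@Tsum_hgt k1 M) (@Tsum_hgt k2 M)
  (@ctx_Tsum k1 M) (@ctx_Tsum k2 M) (@Tsum1_hgt k1 M) (@Tsum1_hgt k2 M)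
  M void (fun=> 1) [::] [::] a b c d M0).
Qed.

End VertexOperator.

Theorem mainTheorem2 (R : realType) (N : nat) (N_gt0 : (0 < N)%N)
    (Rm : Rmatrix R N) (YB : Yang_Baxter Rm) (unit_Rm : unitarity Rm) :
  FRT (@Tpart R N Rm).
Proof. exact: Tpart_FRT (unit_entriesP unit_Rm) (YBE_entriesP YB). Qed.
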